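(* Let $(M_1\times_fM_2,F)$ be a twisted product Finsler manifold and suppose $f$ is not constant on $M_1$. Then $(M_1\times_fM_2,F)$ is Berwaldian if and only if $(M_1,F_1)$ is Berwaldian, $(M_2,F_2)$ is Riemannian and the equation $C^{kh}_l f_h=0$ holds.
   Context: Let $(M_1,F_1)$, $(M_2,F_2)$ be Finsler manifolds (metrics smooth on the slit tangent bundle, positively 1-homogeneous on fibres, with positive definite fundamental tensor) and $f:M_1\times M_2\to\mathbb{R}^+$ smooth. The twisted product $M_1\times_f M_2$ is $M=M_1\times M_2$ with $F=\sqrt{F_1^2(x,y)+f^2(x,u)F_2^2(u,v)}$, considered where $y\ne0$, $v\ne 0$. Local coordinates are $\mathbf{x}^a=(x^i,u^\alpha)$ with fibre coordinates $\mathbf{y}^a=(y^i,v^\alpha)$. For a Finsler metric $F$ with fundamental tensor $g_{ij}=\frac12(F^2)_{y^iy^j}$, the spray coefficients are $G^i=\frac14g^{il}\big(\frac{\partial^2F^2}{\partial x^k\partial y^l}y^k-\frac{\partial F^2}{\partial x^l}\big)$ and the Berwald curvature is $B^i_{\ jkl}=\frac{\partial^3G^i}{\partial y^j\partial y^k\partial y^l}$; $F$ is Berwaldian if $B^i_{\ jkl}=0$. For $F_1$: $g_{ij}=\frac12(F_1^2)_{y^iy^j}$, $C_{ijk}=\frac12\frac{\partial g_{ij}}{\partial y^k}$, $C^{kh}_l=g^{ki}g^{hj}C_{ijl}$. $f_h=\partial f/\partial x^h$. ''$f$ is constant on $M_1$'' means $f_h=0$ for all $h$; ''$f$ is not constant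 on $M_1$'' is the negation of this.
   Formalization: Manifolds are taken connected and of positive dimension, and ''Riemannian'' means g_ij(x,y) is independent of y on each connected component of the nonzero vectors; for disconnected M_2, or one-dimensional M_2 with an irreversible F_2 under the usual notion, the claim as worded fails. *)

(* Defs.v *)
From HB Require Import structures.
From mathcomp Require Import all_boot all_order all_algebra.
From mathcomp Require Import all_classical all_reals all_analysis.
Set Implicit Arguments.
Unset Strict Implicit.
Unset Printing Implicit Defensive.
Import Order.TTheory GRing.Theory Num.Theory.
Import numFieldNormedType.Exports.
Local Open Scope classical_set_scope.
Local Open Scope ring_scope.

(* [U] is meant to be open and [V] finite-dimensional: then all iterated
   directional derivatives exist and are continuous iff [f] is C^k. *)
Fixpoint Ck_on (R : realType) (V W : normedModType R) (k : nat)
    (U : set V) (f : V -> W) : Prop :=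
  (forall x, U x -> {for x, continuous f}) /\
  (if k is k'.+1 then
     forall v, (forall x, U x -> derivable f x v) /\ Ck_on k' U ('D_v f)
   else True).

Definition smooth_on (R : realType) (V W : normedModType R)
    (U : set V) (f : V -> W) : Prop :=
  forall k, Ck_on k U f.

(* A smooth structure is given by an atlas. [chart_inv c] is a total function
   whose values off [chart c @` chart_dom c] are irrelevant. *)
Record smooth_manifold (R : realType) (n : nat) := SmoothManifold {
  mpoint :> topologicalType;
  dim_gt0 : (0 < n)%N;
  m_hausdorff : hausdorff_space mpoint;
  m_second_countable : @second_countable mpoint;
  m_connected : connected [set: mpoint];
  chart_idx : Type;
  chart_dom : chart_idx -> set mpoint;
  chart : chart_idx -> mpoint -> 'rV[R]_n;
  chart_inv : chart_idx -> 'rV[R]_n -> mpoint;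
  chart_dom_open : forall c, open (chart_dom c);
  chart_cover : forall p, exists c, chart_dom c p;
  chart_im_open : forall c, open (chart c @` chart_dom c);
  chartK : forall c p, chart_dom c p -> chart_inv c (chart c p) = p;
  chart_continuous : forall c p, chart_dom c p ->
    {for p, continuous (chart c)};
  chart_inv_continuous : forall c p, chart_dom c p ->
    {for chart c p, continuous (chart_inv c)};
  transition_smooth : forall c c',
    smooth_on (chart c @` (chart_dom c `&` chart_dom c'))
              (chart c' \o chart_inv c)
}.

Definition chart_im (R : realType) (n : nat) (M : smooth_manifold R n)
    (c : chart_idx M) : set 'rV[R]_n :=
  chart c @` chart_dom c.

Section LocalFinsler.
Context {R : realType} {n : nat}.
Implicit Types (H F : 'rV[R]_n -> 'rV[R]_n -> R) (x y : 'rV[R]_n).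
Implicit Types (i j k l h : 'I_n).

Definition d_base k H x y : R := 'D_(delta_mx 0 k) (fun x' => H x' y) x.
Definition d_fib k H x y : R := 'D_(delta_mx 0 k) (fun y' => H x y') y.

Definition sqF F x y : R := F x y ^+ 2.

Definition fundamental F x y : 'M[R]_n :=
  \matrix_(i, j) (2^-1 * d_fib j (d_fib i (sqF F)) x y).

Definition inv_fundamental F x y : 'M[R]_n := invmx (fundamental F x y).

Definition cartan F i j k x y : R :=
  2^-1 * d_fib k (fun x' y' => fundamental F x' y' i j) x y.

(* C^{kh}_l = g^{ki} g^{hj} C_{ijl} *)
Definition cartan_up F k h l x y : R :=
  \sum_i \sum_j
    inv_fundamental F x y k i * inv_fundamental F x y h j * cartan F i j l x y.

Definition spray F i x y : R :=
  4^-1 * \sum_l inv_fundamental F x y i l *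
    ((\sum_k d_base k (d_fib l (sqF F)) x y * y 0 k) - d_base l (sqF F) x y).

Definition berwald F i j k l x y : R :=
  d_fib l (d_fib k (d_fib j (spray F i))) x y.

Definition berwald_vanishes_on (D : set ('rV[R]_n * 'rV[R]_n)) F : Prop :=
  forall z, D z -> forall i j k l, berwald F i j k l z.1 z.2 = 0.

End LocalFinsler.

Definition slit_bundle (R : realType) (n : nat) (M : smooth_manifold R n)
    (c : chart_idx M) : set ('rV[R]_n * 'rV[R]_n) :=
  [set z | chart_im c z.1 /\ z.2 != 0].

(* A function on the tangent bundle, given by its expressions [fm c x y] in the
   bundle charts; [fm_compat] says that they agree under change of chart, a
   tangent vector with components [y] in the chart [c] having components
   'D_y (chart c' \o chart_inv c) in the chart [c']. *)
Record finsler_metric (R : realType) (n : nat) (M : smooth_manifold R n) :=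
  FinslerMetric {
  fm :> chart_idx M -> 'rV[R]_n -> 'rV[R]_n -> R;
  fm_compat : forall (c c' : chart_idx M) (p : M) (y : 'rV[R]_n),
    chart_dom c p -> chart_dom c' p ->
    fm c' (chart c' p) ('D_y (chart c' \o chart_inv c) (chart c p)) =
    fm c (chart c p) y;
  fm_ge0 : forall c x y, chart_im c x -> 0 <= fm c x y;
  fm_smooth : forall c,
    smooth_on (slit_bundle c) (fun z : 'rV[R]_n * 'rV[R]_n => fm c z.1 z.2);
  fm_homogeneous : forall c x y (t : R), chart_im c x -> 0 < t ->
    fm c x (t *: y) = t * fm c x y;
  fm_posdef : forall c x y, chart_im c x -> y != 0 ->
    forall w : 'rV[R]_n, w != 0 ->
    0 < \sum_i \sum_j fundamental (fm c) x y i j * w 0 i * w 0 j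
}.

Definition berwaldian (R : realType) (n : nat) (M : smooth_manifold R n)
    (F : finsler_metric M) : Prop :=
  forall c, berwald_vanishes_on (slit_bundle c) (F c).

(* The fundamental tensor g_{ij}(x, y) does not depend on y <> 0. For n >= 2 the
   slit tangent space is connected and the component condition is void. For
   n = 1 it has two components, and independence is required on each of them:
   the metric may be irreversible. *)
Definition riemannian (R : realType) (n : nat) (M : smooth_manifold R n)
    (F : finsler_metric M) : Prop :=
  forall c x, chart_im c x -> forall y y' : 'rV[R]_n,
    connected_component [set w : 'rV[R]_n | w != 0] y y' ->
    fundamental (F c) x y = fundamental (F c) x y'.

Section TwistedProduct.
Context {R : realType} {n1 n2 : nat}.
Context {M1 : smooth_manifold R n1} {M2 : smooth_manifold R n2}.
Implicit Types (f : M1 * M2 -> R).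

Definition loc2 f (c1 : chart_idx M1) (c2 : chart_idx M2)
    (x : 'rV[R]_n1) (u : 'rV[R]_n2) : R :=
  f (chart_inv c1 x, chart_inv c2 u).

Definition smooth_on_product f : Prop :=
  forall c1 c2,
    smooth_on (chart_im c1 `*` chart_im c2)
      (fun z : 'rV[R]_n1 * 'rV[R]_n2 => loc2 f c1 c2 z.1 z.2).

(* f_h = d f / d x^h at the point of M1 x M2 with coordinates (x, u) *)
Definition d_M1 f (c1 : chart_idx M1) (c2 : chart_idx M2)
    (h : 'I_n1) (x : 'rV[R]_n1) (u : 'rV[R]_n2) : R :=
  'D_(delta_mx 0 h) (fun x' => loc2 f c1 c2 x' u) x.

Definition constant_on_M1 f : Prop :=
  forall c1 c2 x u, chart_im c1 x -> chart_im c2 u ->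
  forall h, d_M1 f c1 c2 h x u = 0.

(* Coordinates on M1 x M2 are z = (x, u), fibre coordinates are w = (y, v). *)
Definition twisted_metric (F1 : finsler_metric M1) (F2 : finsler_metric M2) f
    (c1 : chart_idx M1) (c2 : chart_idx M2) (z w : 'rV[R]_(n1 + n2)) : R :=
  Num.sqrt (F1 c1 (lsubmx z) (lsubmx w) ^+ 2 +
    loc2 f c1 c2 (lsubmx z) (rsubmx z) ^+ 2 *
    F2 c2 (rsubmx z) (rsubmx w) ^+ 2).

Definition twisted_dom (c1 : chart_idx M1) (c2 : chart_idx M2) :
    set ('rV[R]_(n1 + n2) * 'rV[R]_(n1 + n2)) :=
  [set zw | [/\ chart_im c1 (lsubmx zw.1), chart_im c2 (rsubmx zw.1),
                lsubmx zw.2 != 0 & rsubmx zw.2 != 0]].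

Definition twisted_berwaldian (F1 : finsler_metric M1)
    (F2 : finsler_metric M2) f : Prop :=
  forall c1 c2,
    berwald_vanishes_on (twisted_dom c1 c2) (twisted_metric F1 F2 f c1 c2).

(* C^{kh}_l f_h = 0 *)
Definition cartan_df_vanishes (F1 : finsler_metric M1) f : Prop :=
  forall c1 c2 x u y, chart_im c1 x -> chart_im c2 u -> y != 0 ->
  forall k l,
    \sum_h cartan_up (F1 c1) k h l x y * d_M1 f c1 c2 h x u = 0.

End TwistedProduct.

(* Main.v *)
(** On the product, the spray coefficients are
      G^i = G_1^i - 1/2 f f_l g^{il} F_2^2   and
      G^a = Gtilde^a + f^{-1} (f_k y^k) v^a,
    where Gtilde is the spray of the metric f(x, .) F_2 on M_2 with x frozen.
    Since d g^{ih} / d y^j = - 2 C^{ih}_j, reading off the third fibre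
    derivatives of these formulas by type gives most of the theorem. What
    remains is that F_2 is Riemannian at every u, although B^i_{abc} = 0 only
    gives this at those u for which some f_h(x, u) is nonzero. There
    f(x, .) F_2 is a Berwald metric on the connected manifold M_2 whose norm is
    Euclidean at one point. For every Finsler metric F one has
    (F^2)_{x^m} = (d G^i / d y^m) (F^2)_{y^i}; in the Berwald case the
    coefficient is linear in y, so that F^2 is transported along a segment of a
    chart by a linear flow. Euler polygons approximate this flow by linear maps
    well enough to carry the parallelogram law from one end of the segment to
    the other, and connectedness carries it to all of M_2. A 2-homogeneous
    function obeying the parallelogram law has a constant Hessian. In dimension
    one the law may fail (irreversible metrics), but there g is 0-homogeneous,
    hence constant on each of the two rays. *)

Require Import Defs.
From HB Require Import structures.
From mathcomp Require Import all_boot all_order all_algebra.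
From mathcomp Require Import all_classical all_reals all_analysis.
From mathcomp Require Import ring lra.
Set Implicit Arguments.
Unset Strict Implicit.
Unset Printing Implicit Defensive.
Import Order.TTheory GRing.Theory Num.Theory.
Import numFieldNormedType.Exports.
Local Open Scope classical_set_scope.
Local Open Scope ring_scope.

(** * Directional derivatives *)

Section DirectionalDerivatives.
Context {R : realType} {V : normedModType R}.
Implicit Types (f g : V -> R) (U : set V) (x v w : V).

(** The metric to which transport applies is f(x, .) F_2, not F_2: its Berwald property is what the
    curvature of the product yields, and F_2 is recovered at the end by dividing by f. The property
    transported has to survive approximation of the values of F^2 only. Constancy of the Hessian
    does not survive it, an identity between values does; such an identity is also preserved by
    linear substitutions, so that polygons and changes of chart are treated alike. Errors are kept
    relative, a factor 1 - eh or 1 + eh per step: over 1/h steps the lower factors multiply to at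
    least 1 - e, and 2-homogeneity extends a relative estimate from the unit sphere, where
    compactness is available, to all vectors. The converse rests on degrees: over a fixed base point
    every summand of the spray of the product turns out to have degree at most two in the fibre
    coordinates, which disposes of all components of the curvature, mixed ones included. *)

Lemma open_near U x : open U -> U x -> \forall z \near x, U z.
Proof. by move=> oU Ux; apply: open_nbhs_nbhs. Qed.

Lemma derive_eq_on (W : normedModType R) (f g : V -> W) U x v :
  open U -> U x -> (forall z, U z -> f z = g z) -> 'D_v f x = 'D_v g x.
Proof.
by move=> oU Ux fg; apply: near_eq_derive; apply: filterS fg (open_near oU Ux).
Qed.

Lemma derivable_eq_on (W : normedModType R) (f g : V -> W) U x v :
  open U -> U x -> (forall z, U z -> f z = g z) ->
  derivable f x v -> derivable g x v.
Proof.
by move=> oU Ux fg; apply: near_eq_derivable; apply: filterS fg (open_near oU Ux).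
Qed.

Lemma is_derive_line f x v (s : R) : derivable f (x + s *: v) v ->
  is_derive s (1 : R) (fun t => f (x + t *: v)) ('D_v f (x + s *: v)).
Proof.
move=> df; set g := fun t => _.
have E : (fun h => h^-1 *: ((g \o shift s) (h *: (1 : R)) - g s)) =
  (fun h => h^-1 *: ((f \o shift (x + s *: v)) (h *: v) - f (x + s *: v))).
  apply/funext => h; rewrite /g /= [h *: 1]mulr1 scalerDl.
  by congr (_ *: (f _ - _)); rewrite addrCA.
by split; rewrite /derivable /derive E.
Qed.

Lemma MVT_line f x v :
  (forall s, 0 <= s <= 1 -> derivable f (x + s *: v) v) ->
  exists2 s, 0 <= s <= 1 & f (x + v) - f x = 'D_v f (x + s *: v).
Proof.
move=> df; pose g t := f (x + t *: v).
have dg (s : R) : 0 <= s <= 1 -> is_derive s (1 : R) g ('D_v f (x + s *: v)).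
  by move=> /df; apply: is_derive_line.
have [||c + gE] := @MVT_segment _ g (fun s => 'D_v f (x + s *: v)) 0 1 ler01.
- move=> s; rewrite in_itv /= => /andP[s0 s1].
  by apply: dg; rewrite !ltW.
- apply: derivable_within_continuous => s; rewrite in_itv /= => s01.
  by have [] := dg s s01.
rewrite in_itv /= => c01; exists c => //.
by move: gE; rewrite /g scale1r scale0r addr0 subr0 mulr1.
Qed.

Lemma derive_dirZ f x v (k : R) : derivable f x v ->
  derivable f x (k *: v) /\ 'D_(k *: v) f x = k * 'D_v f x.
Proof.
move=> df; have [->|k0] := eqVneq k 0.
  by rewrite scale0r derive0 mul0r; split; [exact: derivable0|].
pose q h := h^-1 *: ((f \o shift x) (h *: v) - f x).
have E : (fun h => h^-1 *: ((f \o shift x) (h *: (k *: v)) - f x)) =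
         (fun h => k *: q (h * k)).
  apply/funext => h; rewrite /q /= scalerA invfM mulrC [RHS]scalerA.
  by rewrite mulrCA mulfV// mulr1.
suff cv : (fun h => k *: q (h * k)) @ 0^' --> k *: 'D_v f x.
  by split; rewrite /derivable /derive E; [apply/cvg_ex; eexists; exact: cv|apply/cvg_lim].
apply: cvgZl_tmp.
have : (h * k @[h --> (0 : R)^'] --> (0 : R)^').
  have := @continuous_injective_withinNx R R (fun h => h * k) 0.
  rewrite mul0r; apply; first exact: cvgMr_tmp cvg_id.
  by move=> y /eqP; rewrite mulf_eq0 (negPf k0) orbF => /eqP.
by move=> /cvg_comp; apply; exact: df.
Qed.

(** Directional derivatives alone need not be additive in the direction; continuity of ['D_w f]
    makes them so. The increment along [h *: (v + w)] is split at [h *: v + x], and the mean value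
    theorem turns the part along [w] into ['D_w f] at a nearby point. *)
Lemma derive_dirD f U x v w : open U -> U x ->
  (forall z, U z -> derivable f z w) -> {for x, continuous ('D_w f)} ->
  derivable f x v ->
  derivable f x (v + w) /\ 'D_(v + w) f x = 'D_v f x + 'D_w f x.
Proof.
move=> oU Ux dw cw dv.
pose q h := h^-1 *: ((f \o shift x) (h *: v) - f x).
pose p h := h^-1 *: (f (h *: v + x + h *: w) - f (h *: v + x)).
have E : (fun h => h^-1 *: ((f \o shift x) (h *: (v + w)) - f x)) = p \+ q.
  apply/funext => h; rewrite /p /q /= -scalerDr addrA subrK.
  by rewrite [h *: (v + w)]scalerDr [in RHS]addrAC.
suff cp : p @ 0^' --> 'D_w f x.
  have cv : p \+ q @ 0^' --> 'D_w f x + 'D_v f x by apply: cvgD.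
  rewrite [in RHS]addrC.
  by split; rewrite /derivable /derive E; [apply/cvg_ex; eexists; exact: cv|apply/cvg_lim].
apply/cvgrPdist_le => e e0.
have /nbhs_ballP[d /= d0 hd] : \forall z \near x, U z /\ `|'D_w f x - 'D_w f z| <= e.
  apply: filterI; first exact: open_near.
  by move/cvgrPdist_le : cw; apply.
near=> h.
have h0 : h != 0 by near: h; apply: nbhs_dnbhs_neq.
have hs : `|h| * (`|v| + `|w|) < d.
  have : `|h| < d / (`|v| + `|w| + 1).
    near: h; apply: dnbhs0_lt; by rewrite divr_gt0// ltr_wpDl// addr_ge0.
  rewrite ltr_pdivlMr; last by rewrite ltr_wpDl// addr_ge0.
  by apply: le_lt_trans; rewrite ler_wpM2l// lerDl.
have inb s : 0 <= s <= 1 -> ball x d (h *: v + x + s *: (h *: w)).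
  move=> /andP[s0 s1]; rewrite -ball_normE /=.
  have -> : x - (h *: v + x + s *: (h *: w)) = - (h *: v + s *: (h *: w)).
    by rewrite addrAC [_ + x]addrC opprD addrA subrr add0r.
  rewrite normrN (le_lt_trans (ler_normD _ _))// (le_lt_trans _ hs)//.
  rewrite !normrZ mulrDr lerD2l (ger0_norm s0).
  by rewrite ler_piMl// mulr_ge0.
have [s s01 E1] := @MVT_line f (h *: v + x) (h *: w) (fun s s01 =>
  (derive_dirZ h (dw _ (proj1 (hd _ (inb s s01))))).1).
rewrite /p E1 (derive_dirZ h (dw _ (proj1 (hd _ (inb s s01))))).2.
by rewrite [_ *: _]mulKf// (proj2 (hd _ (inb s s01))).
Unshelve. all: by end_near. Qed.

(** The mean value theorem is applied twice: to the increment [phi] along [h *: a], then to ['D_a f]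
    along [h *: b]. The quotient is thus the mixed derivative at a point of the small parallelogram,
    and continuity concludes. *)
Lemma second_difference_cvg f U x a b (e : R) : open U -> U x -> 0 < e ->
  (forall z, U z -> derivable f z a) -> (forall z, U z -> derivable ('D_a f) z b) ->
  {for x, continuous ('D_b ('D_a f))} ->
  \forall h \near 0^'+, `|'D_b ('D_a f) x -
    h^-2 * (f (x + h *: a + h *: b) - f (x + h *: a) - f (x + h *: b) + f x)| <= e.
Proof.
move=> oU Ux e0 da dba cba.
have /nbhs_ballP[d /= d0 hd] : \forall z \near x, U z /\
    `|'D_b ('D_a f) x - 'D_b ('D_a f) z| <= e.
  apply: filterI; first exact: open_near.
  by move/cvgrPdist_le : cba; apply.
near=> h.
have h0 : 0 < h by near: h; apply: nbhs_right_gt.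
have hs : h * (`|a| + `|b|) < d.
  have : h < d / (`|a| + `|b| + 1).
    near: h; apply: nbhs_right_lt; by rewrite divr_gt0// ltr_wpDl// addr_ge0.
  rewrite ltr_pdivlMr; last by rewrite ltr_wpDl// addr_ge0.
  by apply: le_lt_trans; rewrite ler_wpM2l ?lerDl// ltW.
have inb s t : 0 <= s <= 1 -> 0 <= t <= 1 ->
    ball x d (x + s *: (h *: a) + t *: (h *: b)).
  move=> /andP[s0 s1] /andP[t0 t1]; rewrite -ball_normE /=.
  rewrite opprD addrA opprD addrA subrr add0r -opprD normrN.
  rewrite (le_lt_trans (ler_normD _ _))// (le_lt_trans _ hs)//.
  rewrite !normrZ mulrDr (ger0_norm s0) (ger0_norm t0) (gtr0_norm h0).
  by rewrite lerD// ler_piMl// mulr_ge0// ltW.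
have i0 : 0 <= (0 : R) <= 1 by rewrite lexx ler01.
have i1 : 0 <= (1 : R) <= 1 by rewrite lexx ler01.
have in0 s : 0 <= s <= 1 -> U (x + s *: (h *: a)).
  by move=> s01; have := (hd _ (inb s 0 s01 i0)).1; rewrite scale0r addr0.
have in1 s : 0 <= s <= 1 -> U (x + s *: (h *: a) + h *: b).
  by move=> s01; have := (hd _ (inb s 1 s01 i1)).1; rewrite scale1r.
pose phi z := f (z + h *: b) - f z.
have dsh (z : V) : derivable f (z + h *: b) a ->
    derivable (fun z => f (z + h *: b)) z a /\
    'D_a (fun z => f (z + h *: b)) z = 'D_a f (z + h *: b).
  move=> df.
  have E : (fun k => k^-1 *: (((fun z => f (z + h *: b)) \o shift z) (k *: a) - f (z + h *: b))) =
     (fun k => k^-1 *: ((f \o shift (z + h *: b)) (k *: a) - f (z + h *: b))).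
    by apply/funext => k /=; rewrite addrA.
  by rewrite /derivable /derive E.
have dphi s : 0 <= s <= 1 -> derivable phi (x + s *: (h *: a)) a /\
    'D_a phi (x + s *: (h *: a)) = 'D_a f (x + s *: (h *: a) + h *: b) - 'D_a f (x + s *: (h *: a)).
  move=> s01.
  have [d1 e1] := dsh _ (da _ (in1 s s01)).
  have d2 := da _ (in0 s s01).
  by split; [exact: derivableB|rewrite deriveB ?e1].
have [s s01 E1] := @MVT_line phi x (h *: a) (fun s s01 =>
   (derive_dirZ h (dphi s s01).1).1).
rewrite (derive_dirZ h (dphi s s01).1).2 (dphi s s01).2 in E1.
have dinn t (t01 : 0 <= t <= 1) : derivable ('D_a f) (x + s *: (h *: a) + t *: (h *: b)) b.
  by apply: dba; apply: (hd _ (inb s t s01 t01)).1.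
have [t t01 E2] := @MVT_line ('D_a f) (x + s *: (h *: a)) (h *: b) (fun t t01 =>
   (derive_dirZ h (dinn t t01)).1).
rewrite (derive_dirZ h (dinn t t01)).2 in E2.
have -> : f (x + h *: a + h *: b) - f (x + h *: a) - f (x + h *: b) + f x =
    phi (x + h *: a) - phi x by rewrite /phi; ring.
rewrite E1 E2 mulrA -expr2 mulKf ?expf_neq0 ?gt_eqF//.
exact: (hd _ (inb s t s01 t01)).2.
Unshelve. all: by end_near. Qed.

(** The second difference is symmetric in [v] and [w], so one and the same quotient approximates
    both mixed derivatives. *)
Lemma derive_schwarz f U x v w : open U -> U x ->
  (forall z, U z -> derivable f z v) -> (forall z, U z -> derivable f z w) ->
  (forall z, U z -> derivable ('D_v f) z w) ->
  (forall z, U z -> derivable ('D_w f) z v) ->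
  {for x, continuous ('D_w ('D_v f))} -> {for x, continuous ('D_v ('D_w f))} ->
  'D_w ('D_v f) x = 'D_v ('D_w f) x.
Proof.
move=> oU Ux dv dw dwv dvw cwv cvw.
apply/eqP; rewrite -subr_eq0 -normr_le0; apply/ler_addgt0Pl => e e0.
rewrite addr0.
have e2 : 0 < e / 2 by rewrite divr_gt0.
near (0:R)^'+ => h.
have A := near (second_difference_cvg oU Ux e2 dv dwv cwv) h.
have B := near (second_difference_cvg oU Ux e2 dw dvw cvw) h.
move: A B => /(_ _) A /(_ _) B.
set D := f _ - _ - _ + _ in A.
have A' : `|'D_w ('D_v f) x - h^-2 * D| <= e / 2 by apply: A.
have B' : `|'D_v ('D_w f) x - h^-2 * D| <= e / 2.
  have -> : D = f (x + h *: w + h *: v) - f (x + h *: w) - f (x + h *: v) + f x.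
    by rewrite /D [x + _ + h *: w]addrAC; ring.
  by apply: B.
rewrite (splitr e) -[X in X - _](subrK (h^-2 * D)) -addrA.
by apply: (le_trans (ler_normD _ _)); apply: lerD A' _; rewrite distrC.
Unshelve. all: by end_near. Qed.
End DirectionalDerivatives.

(** * Functions of class C^k in terms of directional derivatives *)

Section Smoothness.
Context {R : realType} {V : normedModType R}.
Implicit Types (U : set V) (f g : V -> R).

Lemma Ck_on_continuous (W : normedModType R) k U (f : V -> W) x :
  Ck_on k U f -> U x -> {for x, continuous f}.
Proof. by case: k => [|k] [cf _]; exact: cf. Qed.

Lemma Ck_onS (W : normedModType R) k U (f : V -> W) :
  Ck_on k.+1 U f -> Ck_on k U f.
Proof.
elim: k f => [|k IH] f [cf df]; split=> // v.
by have [? ?] := df v; split=> //; apply: IH.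
Qed.

Lemma continuous_eq_on (W : topologicalType) U (f g : V -> W) x : open U -> U x ->
  (forall z, U z -> f z = g z) -> {for x, continuous f} -> {for x, continuous g}.
Proof.
move=> oU Ux fg cf; rewrite /prop_for /continuous_at -fg//.
apply: cvg_trans cf; apply: near_eq_cvg.
by apply: filterS (open_near oU Ux) => z /fg.
Qed.

Lemma Ck_on_eq (W : normedModType R) k U (f g : V -> W) : open U ->
  (forall z, U z -> f z = g z) -> Ck_on k U f -> Ck_on k U g.
Proof.
move=> oU; elim: k f g => [|k IH] f g fg [cf df].
  by split=> // x Ux; exact: (continuous_eq_on oU Ux fg (cf x Ux)).
split=> [x Ux|v]; first exact: (continuous_eq_on oU Ux fg (cf x Ux)).
have [dv Cv] := df v; split=> [x Ux|].
  exact: (derivable_eq_on oU Ux fg (dv x Ux)).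
by apply: IH Cv => z Uz; exact: (derive_eq_on v oU Uz fg).
Qed.

Lemma Ck_on_cst (W : normedModType R) k U (c : W) : Ck_on k U (fun _ : V => c).
Proof.
elim: k c => [|k IH] c; first by split=> // x _; exact: cvg_cst.
split=> [x _|v]; first exact: cvg_cst.
split=> [x _|]; first exact: derivable_cst.
have -> : 'D_v (fun _ : V => c) = (fun _ => 0); last exact: IH.
by apply/funext => x; exact: derive_cst.
Qed.

Lemma Ck_onD k U f g : open U -> Ck_on k U f -> Ck_on k U g ->
  Ck_on k U (fun z => f z + g z).
Proof.
move=> oU; elim: k f g => [|k IH] f g [cf df] [cg dg].
  by split=> // x Ux; apply: continuousD; [exact: cf|exact: cg].
split=> [x Ux|v]; first by apply: continuousD; [exact: cf|exact: cg].
have [dfv Cf] := df v; have [dgv Cg] := dg v.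
split=> [x Ux|]; first by apply: derivableD; [exact: dfv|exact: dgv].
apply: Ck_on_eq (IH _ _ Cf Cg) => // z Uz.
by rewrite -deriveD//; [exact: dfv|exact: dgv].
Qed.

Lemma Ck_onM k U f g : open U -> Ck_on k U f -> Ck_on k U g ->
  Ck_on k U (fun z => f z * g z).
Proof.
move=> oU; elim: k f g => [|k IH] f g Cf Cg.
  by case: Cf Cg => [cf _] [cg _]; split=> // x Ux; apply: continuousM; [exact: cf|exact: cg].
have [[cf df] [cg dg]] := (Cf, Cg).
split=> [x Ux|v]; first by apply: continuousM; [exact: cf|exact: cg].
have [dfv Cfv] := df v; have [dgv Cgv] := dg v.
split=> [x Ux|]; first by apply: derivableM; [exact: dfv|exact: dgv].
apply: Ck_on_eq (Ck_onD oU (IH _ _ (Ck_onS Cf) Cgv) (IH _ _ (Ck_onS Cg) Cfv)) => // z Uz.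
have := deriveM (dfv _ Uz) (dgv _ Uz); rewrite /GRing.scale /= => <-.
by [].
Qed.

Lemma Ck_onV k U f : open U -> (forall z, U z -> f z != 0) -> Ck_on k U f ->
  Ck_on k U (fun z => (f z)^-1).
Proof.
move=> oU f0; elim: k f f0 => [|k IH] f f0 Cf.
  by case: Cf => cf _; split=> // x Ux; apply: continuousV; [exact: f0|exact: cf].
have [cf df] := Cf.
split=> [x Ux|v]; first by apply: continuousV; [exact: f0|exact: cf].
have [dfv Cfv] := df v.
split=> [x Ux|]; first by apply: derivableV; [exact: f0|exact: dfv].
have CV := IH _ f0 (Ck_onS Cf).
have C1 : Ck_on k U (fun _ : V => -1 : R) by exact: Ck_on_cst.
apply: (Ck_on_eq oU _ (Ck_onM oU C1 (Ck_onM oU (Ck_onM oU CV CV) Cfv))) => z Uz.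
rewrite (deriveV (f0 _ Uz) (dfv _ Uz)) /GRing.scale /= expr2 invfM.
by ring.
Qed.

(** The derivative of a composition with an affine map is again a composition with the same map,
    which keeps inductions on the order of differentiability closed. Projections, translations,
    scalings and the freezing of a variable all have this form. *)
Lemma derive_comp_affine (V' W : normedModType R) (A L : V -> V') (f : V' -> W) v :
  (forall (h : R) u z, A (h *: u + z) = h *: L u + A z) ->
  'D_v (f \o A) = ('D_(L v) f) \o A.
Proof.
move=> AL; apply/funext => x; rewrite /derive /=.
have -> // : (fun h : R => h^-1 *: (f (A (h *: v + x)) - f (A x))) =
  (fun h => h^-1 *: (f (h *: L v + A x) - f (A x))).
by apply/funext => h; rewrite AL.
Qed.

Lemma derivable_comp_affine (V' W : normedModType R) (A L : V -> V') (f : V' -> W) x v :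
  (forall (h : R) u z, A (h *: u + z) = h *: L u + A z) ->
  derivable f (A x) (L v) -> derivable (f \o A) x v.
Proof.
move=> AL; rewrite /derivable /=.
have -> // : (fun h : R => h^-1 *: (f (A (h *: v + x)) - f (A x))) =
  (fun h => h^-1 *: (f (h *: L v + A x) - f (A x))).
by apply/funext => h; rewrite AL.
Qed.

Lemma Ck_on_comp_affine (V' W : normedModType R) (A L : V -> V') k U (U' : set V')
    (f : V' -> W) : (forall (h : R) u z, A (h *: u + z) = h *: L u + A z) ->
  continuous A -> (forall z, U z -> U' (A z)) -> Ck_on k U' f ->
  Ck_on k U (fun z => f (A z)).
Proof.
move=> AL cA AU; elim: k f => [|k IH] f [cf df].
  by split=> // x Ux; apply: continuous_comp; [exact: cA|exact: cf (AU _ Ux)].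
split=> [x Ux|v]; first by apply: continuous_comp; [exact: cA|exact: cf (AU _ Ux)].
have [dv Cv] := df (L v); split=> [x Ux|].
  by apply: (derivable_comp_affine AL); exact: dv (AU _ Ux).
by have := derive_comp_affine f v AL; rewrite /comp => ->; exact: (IH ('D_(L v) f) Cv).
Qed.

Lemma derive_linear (W : normedModType R) (L : V -> W) v : linear L ->
  'D_v L = (fun _ => L v).
Proof.
move=> lL; have := @derive_comp_affine W W L L id v lL; rewrite /comp => ->.
by apply/funext => x; rewrite derive_id.
Qed.

Lemma Ck_on_linear (W : normedModType R) (L : V -> W) k U : linear L -> continuous L ->
  Ck_on k U L.
Proof.
move=> lL cL; case: k => [|k]; first by split=> // x _; exact: cL.
split=> [x _|v]; first exact: cL.
split=> [x _|]; last by rewrite derive_linear//; exact: Ck_on_cst.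
by apply: (@derivable_comp_affine _ _ L L id) => //; exact: derivable_id.
Qed.

Lemma smooth_on_cst (W : normedModType R) U (c : W) : smooth_on U (fun _ : V => c).
Proof. by move=> k; exact: Ck_on_cst. Qed.

Lemma smooth_onD U f g : open U -> smooth_on U f -> smooth_on U g ->
  smooth_on U (fun z => f z + g z).
Proof. by move=> oU sf sg k; exact: Ck_onD. Qed.

Lemma smooth_onM U f g : open U -> smooth_on U f -> smooth_on U g ->
  smooth_on U (fun z => f z * g z).
Proof. by move=> oU sf sg k; exact: Ck_onM. Qed.

Lemma smooth_onZ U f (c : R) : open U -> smooth_on U f ->
  smooth_on U (fun z => c * f z).
Proof. by move=> oU sf; apply: smooth_onM => //; exact: smooth_on_cst. Qed.

Lemma smooth_onB U f g : open U -> smooth_on U f -> smooth_on U g ->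
  smooth_on U (fun z => f z - g z).
Proof.
move=> oU sf sg; have := smooth_onD oU sf (smooth_onZ (-1) oU sg).
by under eq_fun do rewrite mulN1r.
Qed.

Lemma smooth_onX U f n : open U -> smooth_on U f -> smooth_on U (fun z => f z ^+ n).
Proof.
move=> oU sf; elim: n => [|n IH]; first exact: smooth_on_cst.
by under eq_fun do rewrite exprS; exact: smooth_onM.
Qed.

Lemma smooth_onV U f : open U -> (forall z, U z -> f z != 0) -> smooth_on U f ->
  smooth_on U (fun z => (f z)^-1).
Proof. by move=> oU f0 sf k; exact: Ck_onV. Qed.

Lemma smooth_on_sum (I : Type) (r : seq I) (P : pred I) (F : I -> V -> R) U :
  open U -> (forall i, smooth_on U (F i)) ->
  smooth_on U (fun z => \sum_(i <- r | P i) F i z).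
Proof.
move=> oU sF; elim: r => [|i r IH].
  by under eq_fun do rewrite big_nil; exact: smooth_on_cst.
under eq_fun do rewrite big_cons; case: (P i) => //.
exact: smooth_onD.
Qed.

Lemma smooth_on_prod (I : Type) (r : seq I) (P : pred I) (F : I -> V -> R) U :
  open U -> (forall i, smooth_on U (F i)) ->
  smooth_on U (fun z => \prod_(i <- r | P i) F i z).
Proof.
move=> oU sF; elim: r => [|i r IH].
  by under eq_fun do rewrite big_nil; exact: smooth_on_cst.
under eq_fun do rewrite big_cons; case: (P i) => //.
exact: smooth_onM.
Qed.

Lemma smooth_on_det n (A : V -> 'M[R]_n) U : open U ->
  (forall i j, smooth_on U (fun z => A z i j)) -> smooth_on U (fun z => \det (A z)).
Proof.
move=> oU sA; rewrite /determinant; apply: smooth_on_sum => // s.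
by apply: smooth_onZ => //; apply: smooth_on_prod => // i.
Qed.

Lemma smooth_on_eq (W : normedModType R) U (f g : V -> W) : open U ->
  (forall z, U z -> f z = g z) -> smooth_on U f -> smooth_on U g.
Proof. by move=> oU fg sf k; exact: (Ck_on_eq oU fg). Qed.

(** Cramer's rule: an entry of the inverse is a cofactor divided by the determinant, both polynomial
    in the entries. *)
Lemma smooth_on_invmx n (A : V -> 'M[R]_n) U : open U ->
  (forall z, U z -> A z \in unitmx) ->
  (forall i j, smooth_on U (fun z => A z i j)) ->
  forall i j, smooth_on U (fun z => invmx (A z) i j).
Proof.
move=> oU uA sA i j.
apply: (@smooth_on_eq _ _ (fun z => (\det (A z))^-1 * cofactor (A z) j i)) => //.
  by move=> z Uz; rewrite /invmx uA// !mxE.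
apply: smooth_onM => //.
  apply: smooth_onV => //; last exact: smooth_on_det.
  by move=> z Uz; have := uA z Uz; rewrite unitmxE unitfE.
apply: smooth_onZ => //; apply: smooth_on_det => // a b.
by under eq_fun do rewrite !mxE; exact: sA.
Qed.

Lemma smooth_on_comp_affine (V' W : normedModType R) (A L : V -> V') U (U' : set V')
    (f : V' -> W) : (forall (h : R) u z, A (h *: u + z) = h *: L u + A z) ->
  continuous A -> (forall z, U z -> U' (A z)) -> smooth_on U' f ->
  smooth_on U (fun z => f (A z)).
Proof. by move=> AL cA AU sf k; exact: (Ck_on_comp_affine AL cA AU). Qed.

Lemma smooth_on_comp_linear (V' W : normedModType R) (L : V -> V') U (U' : set V')
    (f : V' -> W) : linear L -> continuous L ->
  (forall z, U z -> U' (L z)) -> smooth_on U' f -> smooth_on U (fun z => f (L z)).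
Proof. exact: smooth_on_comp_affine. Qed.

Lemma smooth_on_linear (W : normedModType R) (L : V -> W) U :
  linear L -> continuous L -> smooth_on U L.
Proof. by move=> lL cL k; exact: Ck_on_linear. Qed.

Lemma smooth_on_subset (W : normedModType R) U U' (f : V -> W) :
  U' `<=` U -> smooth_on U f -> smooth_on U' f.
Proof.
move=> UU sh k; have := sh k; move: {sh}f.
elim: k => [|k IH] h [ch dh]; first by split=> // x /UU; exact: ch.
split=> [x /UU|v]; first exact: ch.
have [d cc] := dh v; split=> [x /UU|]; [exact: d|exact: IH].
Qed.

Lemma smooth_on_continuous (W : normedModType R) U (f : V -> W) x :
  smooth_on U f -> U x -> {for x, continuous f}.
Proof. by move=> /(_ 0)/Ck_on_continuous; exact. Qed.

Lemma smooth_on_derivable (W : normedModType R) U (f : V -> W) x v :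
  smooth_on U f -> U x -> derivable f x v.
Proof. by move=> /(_ 1)[_ /(_ v)[+ _]]; exact. Qed.

Lemma smooth_on_derive (W : normedModType R) U (f : V -> W) v :
  smooth_on U f -> smooth_on U ('D_v f).
Proof. by move=> sf k; have [_ /(_ v)[]] := sf k.+1. Qed.

End Smoothness.

(* Locked: unification would otherwise unfold ['D_v f] to a limit, and the
   values of ['D_v f] live in a structure that is only convertible to [R]. *)
HB.lock Definition ddir {R : realType} {V : normedModType R} (v : V) (f : V -> R) (x : V) : R :=
  'D_v f x.

Lemma ddirE (R : realType) (V : normedModType R) (v : V) (f : V -> R) :
  ddir v f = 'D_v f.
Proof. by apply/funext => x; rewrite unlock. Qed.

Section DirectionalDerivativeRules.
Context {R : realType} {V : normedModType R}.
Implicit Types (U : set V) (f g : V -> R) (v w x : V).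

Lemma smooth_ddir U f v : smooth_on U f -> smooth_on U (ddir v f).
Proof. by rewrite ddirE; exact: smooth_on_derive. Qed.

Lemma ddir_eq_on U f g v x : open U -> U x -> (forall z, U z -> f z = g z) ->
  ddir v f x = ddir v g x.
Proof. by move=> oU Ux fg; rewrite !ddirE; exact: derive_eq_on oU Ux fg. Qed.

Lemma ddir0 f x : ddir 0 f x = 0.
Proof. by rewrite ddirE derive0. Qed.

Lemma ddirD U f g v x : smooth_on U f -> smooth_on U g -> U x ->
  ddir v (fun z => f z + g z) x = ddir v f x + ddir v g x.
Proof.
by move=> sf sg Ux; rewrite !ddirE; apply: deriveD; exact: smooth_on_derivable Ux.
Qed.

Lemma ddirM U f g v x : smooth_on U f -> smooth_on U g -> U x ->
  ddir v (fun z => f z * g z) x = f x * ddir v g x + g x * ddir v f x.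
Proof.
by move=> sf sg Ux; rewrite !ddirE; apply: deriveM; exact: smooth_on_derivable Ux.
Qed.

Lemma ddirZ U f v (c : R) x : smooth_on U f -> U x ->
  ddir v (fun z => c * f z) x = c * ddir v f x.
Proof.
move=> sf Ux; rewrite !ddirE; apply: (@deriveZ _ _ _ f c).
exact: smooth_on_derivable Ux.
Qed.

Lemma ddir_cst v (c : R) x : ddir v (fun _ => c) x = 0.
Proof. by rewrite ddirE; exact: derive_cst. Qed.

Lemma ddir_eq0_on U f v x : open U -> U x -> (forall z, U z -> f z = 0) ->
  ddir v f x = 0.
Proof. by move=> oU Ux f0; rewrite (ddir_eq_on v oU Ux f0) ddir_cst. Qed.

Lemma ddir_sum (I : Type) (r : seq I) (P : pred I) (F : I -> V -> R) U v x :
  open U -> (forall i, smooth_on U (F i)) -> U x ->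
  ddir v (fun z => \sum_(i <- r | P i) F i z) x = \sum_(i <- r | P i) ddir v (F i) x.
Proof.
move=> oU sF Ux; elim: r => [|i r IH].
  by under eq_fun do rewrite big_nil; rewrite big_nil; exact: ddir_cst.
rewrite big_cons; under eq_fun do rewrite big_cons; case: (P i) => //.
by rewrite (ddirD _ (sF i) _ Ux) ?IH//; exact: smooth_on_sum.
Qed.

Lemma ddir_dirZ U f v (c : R) x : smooth_on U f -> U x ->
  ddir (c *: v) f x = c * ddir v f x.
Proof.
by move=> sf Ux; rewrite !ddirE (derive_dirZ c (smooth_on_derivable sf Ux)).2.
Qed.

Lemma ddir_dir_linear U f (c : R) v w x : open U -> U x -> smooth_on U f ->
  ddir (c *: v + w) f x = c * ddir v f x + ddir w f x.
Proof.
move=> oU Ux sf; rewrite !ddirE.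
have dv : derivable f x v by exact: smooth_on_derivable Ux.
have [dcv E] := derive_dirZ c dv.
rewrite -E; apply: (proj2 (derive_dirD oU Ux _ _ dcv)).
  by move=> z Uz; exact: smooth_on_derivable Uz.
by apply: smooth_on_continuous Ux; exact: smooth_on_derive.
Qed.

Lemma ddir_dir_sum (I : Type) (r : seq I) (c : I -> R) (e : I -> V) U f x :
  open U -> U x -> smooth_on U f ->
  ddir (\sum_(i <- r) c i *: e i) f x = \sum_(i <- r) c i * ddir (e i) f x.
Proof.
move=> oU Ux sf; elim: r => [|i r IH]; first by rewrite !big_nil ddir0.
by rewrite !big_cons (ddir_dir_linear _ _ _ oU Ux sf) IH.
Qed.

Lemma ddirC U f v w x : open U -> U x -> smooth_on U f ->
  ddir w (ddir v f) x = ddir v (ddir w f) x.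
Proof.
move=> oU Ux sf; rewrite !ddirE; apply: (derive_schwarz oU Ux).
- by move=> z Uz; exact: smooth_on_derivable Uz.
- by move=> z Uz; exact: smooth_on_derivable Uz.
- by move=> z Uz; apply: smooth_on_derivable Uz; exact: smooth_on_derive.
- by move=> z Uz; apply: smooth_on_derivable Uz; exact: smooth_on_derive.
- by apply: smooth_on_continuous Ux; do 2 apply: smooth_on_derive.
- by apply: smooth_on_continuous Ux; do 2 apply: smooth_on_derive.
Qed.

Lemma ddir_scalar (L : V -> R) v x : scalar L -> ddir v L x = L v.
Proof. by move=> lL; rewrite ddirE; exact: (congr1 (@^~ x) (derive_linear v lL)). Qed.

Lemma smooth_scalar (L : V -> R) U : scalar L -> continuous L -> smooth_on U L.
Proof. exact: smooth_on_linear. Qed.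

Lemma ddir_comp_affine (V' : normedModType R) (A L : V -> V') (f : V' -> R) v x :
  (forall (h : R) u z, A (h *: u + z) = h *: L u + A z) ->
  ddir v (fun z => f (A z)) x = ddir (L v) f (A x).
Proof.
by move=> AL; rewrite !ddirE; exact: (congr1 (@^~ x) (derive_comp_affine f v AL)).
Qed.

Lemma ddir_comp_linear (V' : normedModType R) (L : V -> V') (f : V' -> R) v x :
  linear L -> ddir v (fun z => f (L z)) x = ddir (L v) f (L x).
Proof. exact: ddir_comp_affine. Qed.

Lemma ddir_line U f x v : smooth_on U f ->
  (forall s, 0 <= s <= 1 -> U (x + s *: v)) ->
  exists2 s, 0 <= s <= 1 & f (x + v) - f x = ddir v f (x + s *: v).
Proof.
move=> sf inU; rewrite ddirE; apply: MVT_line => s s01.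
by apply: smooth_on_derivable sf _; exact: inU.
Qed.

End DirectionalDerivativeRules.

(** * Local Finsler geometry *)

Section LocalFinslerCalculus.
Context {R : realType} {n : nat}.
Local Notation P := ('rV[R]_n * 'rV[R]_n)%type.
Implicit Types (U : set 'rV[R]_n) (F H : 'rV[R]_n -> 'rV[R]_n -> R) (G : P -> R).
Implicit Types (x y : 'rV[R]_n) (z : P) (i j k l m : 'I_n).

(** Base and fibre derivatives become directional derivatives on one product space, so that symmetry
    of second derivatives also covers the mixed ones. *)
Definition unc H : P -> R := fun z => H z.1 z.2.
(* The fibre and base coordinate directions of the tangent bundle. *)
Definition vt k : P := (0, delta_mx 0 k).
Definition hz k : P := (delta_mx 0 k, 0).

Lemma unc_d_fib k H : unc (d_fib k H) = ddir (vt k) (unc H).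
Proof.
apply/funext => -[x y]; rewrite ddirE /unc /d_fib /derive /=.
by under [in RHS]eq_fun do rewrite scaler0 add0r.
Qed.

Lemma unc_d_base k H : unc (d_base k H) = ddir (hz k) (unc H).
Proof.
apply/funext => -[x y]; rewrite ddirE /unc /d_base /derive /=.
by under [in RHS]eq_fun do rewrite scaler0 add0r.
Qed.

Definition slit U : set P := [set z | U z.1 /\ z.2 != 0].

Definition punctured : set 'rV[R]_n := [set y | y != 0].

Lemma open_punctured : open punctured.
Proof.
have -> : punctured = ~` [set 0] by apply/seteqP; split=> y /= /eqP.
apply: closed_openC; apply: accessible_closed_set1; apply: hausdorff_accessible.
exact: norm_hausdorff.
Qed.

Lemma open_slit U : open U -> open (slit U).
Proof.
move=> oU; apply: openI.
  by apply: (open_comp _ oU) => z _; exact: cvg_fst.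
by apply: (open_comp _ open_punctured) => z _; exact: cvg_snd.
Qed.

Lemma scalar_snd_coord k : scalar (fun z : P => z.2 0 k).
Proof. by move=> a u v /=; rewrite !mxE. Qed.

Lemma continuous_snd_coord k : continuous (fun z : P => z.2 0 k).
Proof.
move=> z; apply: (@continuous_comp _ _ _ snd (fun y : 'rV[R]_n => y 0 k)).
  exact: cvg_snd.
exact: coord_continuous.
Qed.

Lemma smooth_snd_coord (S : set P) k : smooth_on S (fun z : P => z.2 0 k).
Proof.
by apply: smooth_scalar; [exact: scalar_snd_coord|exact: continuous_snd_coord].
Qed.

Lemma ddir_snd_coord k v z : ddir v (fun z : P => z.2 0 k) z = v.2 0 k.
Proof. by rewrite (ddir_scalar _ _ (scalar_snd_coord k)). Qed.

Lemma vt_snd k m : (vt m).2 0 k = (k == m)%:R.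
Proof. by rewrite /= mxE eqxx. Qed.

Lemma linear_pair_sum (L : 'rV[R]_n -> P) y : linear L ->
  L y = \sum_k y 0 k *: L (delta_mx 0 k).
Proof.
move=> lL; have L0 : L 0 = 0.
  by have := lL (-1) 0 0; rewrite scaler0 addr0 scaleN1r addNr.
rewrite {1}(row_sum_delta y); elim: (index_enum _) => [|k r IH].
  by rewrite !big_nil.
by rewrite !big_cons lL IH.
Qed.

Lemma ddir_vertical (S : set P) G z y : open S -> S z -> smooth_on S G ->
  ddir (0, y) G z = \sum_k y 0 k * ddir (vt k) G z.
Proof.
move=> oS Sz sG; rewrite -(ddir_dir_sum _ _ _ oS Sz sG); congr (ddir _ G z).
apply: (@linear_pair_sum (fun y => (0, y))) => a u v.
by rewrite [RHS]/GRing.add /= /add_pair /= scaler0 addr0.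
Qed.

Lemma ddir_horizontal (S : set P) G z x : open S -> S z -> smooth_on S G ->
  ddir (x, 0) G z = \sum_k x 0 k * ddir (hz k) G z.
Proof.
move=> oS Sz sG; rewrite -(ddir_dir_sum _ _ _ oS Sz sG); congr (ddir _ G z).
apply: (@linear_pair_sum (fun y => (y, 0))) => a u v.
by rewrite [RHS]/GRing.add /= /add_pair /= scaler0 addr0.
Qed.

Definition fibre_homogeneous U (d : nat) G :=
  forall z (t : R), slit U z -> 0 < t -> G (z.1, t *: z.2) = t ^+ d * G z.

Lemma fibre_homogeneousZ U d G (c : R) :
  fibre_homogeneous U d G -> fibre_homogeneous U d (fun z => c * G z).
Proof. by move=> hG z t Sz t0; rewrite hG// mulrCA. Qed.

Lemma fibre_homogeneousM U d d' G G' : fibre_homogeneous U d G ->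
  fibre_homogeneous U d' G' -> fibre_homogeneous U (d + d') (fun z => G z * G' z).
Proof. by move=> hG hG' z t Sz t0; rewrite hG// hG'// exprD mulrACA. Qed.

Lemma fibre_homogeneous_sum U d (I : finType) (G : I -> P -> R) :
  (forall a, fibre_homogeneous U d (G a)) ->
  fibre_homogeneous U d (fun z => \sum_a G a z).
Proof.
by move=> hG z t Sz t0; rewrite mulr_sumr; apply: eq_bigr => a _; exact: hG.
Qed.

Lemma slitZ U z (t : R) : slit U z -> 0 < t -> slit U (z.1, t *: z.2).
Proof. by move=> [Uz z0] t0; split=> //=; rewrite scaler_eq0 negb_or gt_eqF. Qed.

(** For [t] near 0, where [1 + t] is positive, [G] takes the value [(1 + t) ^+ d * G z] at the
    vector scaled by [1 + t]; both sides are the derivative of this function of [t] at 0. *)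
Lemma euler_identity U d G z : open U -> smooth_on (slit U) G ->
  fibre_homogeneous U d G -> slit U z ->
  \sum_k z.2 0 k * ddir (vt k) G z = d%:R * G z.
Proof.
move=> oU sG hG Sz; have oS := open_slit oU.
rewrite -(ddir_vertical _ oS Sz sG).
have zE : z + (0 : R) *: ((0, z.2) : P) = z by rewrite scale0r addr0.
have /is_derive_line[_ dG] : derivable G (z + (0 : R) *: ((0, z.2) : P)) (0, z.2).
  by rewrite zE; exact: smooth_on_derivable Sz.
rewrite zE in dG; rewrite ddirE -dG.
have -> : 'D_1 (fun t : R => G (z + t *: ((0, z.2) : P))) 0 =
          'D_1 (fun t : R => (1 + t) ^+ d * G z) 0.
  apply: near_eq_derive; near=> t.
  have t1 : 0 < 1 + t.
    rewrite -ltrBlDl sub0r.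
    have : `|t| < 1 by near: t; apply: (@nbhs0_lt _ R^o).
    by rewrite ltr_norml => /andP[].
  rewrite -hG//; congr G.
  by rewrite [LHS]/GRing.add /= /add_pair /= scaler0 addr0 scalerDl scale1r.
have -> : (fun t : R => (1 + t) ^+ d * G z) = (cst 1 + id) ^+ d * cst (G z).
  by rewrite mulrfctE exprfctE.
have d1 : derivable (cst (1 : R) + id) 0 1.
  by apply: derivableD; [exact: derivable_cst|exact: derivable_id].
rewrite deriveM; last 2 first.
- exact: derivableX.
- exact: derivable_cst.
rewrite derive_cst scaler0 add0r deriveX// deriveD; last 2 first.
- exact: derivable_cst.
- exact: derivable_id.
rewrite derive_cst derive_id add0r !fctE /= addr0 expr1n.
by rewrite [LHS]mulrC; congr (_ * _); rewrite [LHS]mulr1 mulr1.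
Unshelve. all: by end_near. Qed.

Lemma ddir_fibre_scale G (t : R) v z :
  ddir v (fun z : P => G (z.1, t *: z.2)) z = ddir (v.1, t *: v.2) G (z.1, t *: z.2).
Proof.
apply: (@ddir_comp_linear _ _ _ (fun z : P => (z.1, t *: z.2)) G v z).
by move=> a [u1 u2] [v1 v2]; congr (_, _); rewrite /= scalerDr !scalerA [t * a]mulrC.
Qed.

(** Differentiating the homogeneity relation of degree [d.+1] produces one factor [t] on the left,
    which cancels one on the right. *)
Lemma fibre_homogeneous_vt U d G k : open U -> smooth_on (slit U) G ->
  fibre_homogeneous U d.+1 G -> fibre_homogeneous U d (ddir (vt k) G).
Proof.
move=> oU sG hG z t Sz t0; have oS := open_slit oU; have t0' := gt_eqF t0.
have : ddir (vt k) (fun z : P => G (z.1, t *: z.2)) z =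
       ddir (vt k) (fun z => t ^+ d.+1 * G z) z.
  by apply: (ddir_eq_on _ oS Sz) => w Sw; rewrite hG.
rewrite (ddir_fibre_scale G t (vt k) z) (ddirZ _ _ sG Sz).
have -> : ((vt k).1, t *: (vt k).2) = t *: vt k.
  by rewrite [RHS]/GRing.scale /= /scale_pair /= scaler0.
have Stz : slit U (z.1, t *: z.2) by exact: slitZ.
rewrite (ddir_dirZ _ _ sG Stz) exprS -mulrA.
by move/mulfI; apply; rewrite t0'.
Qed.

Lemma fibre_homogeneous_hz U d G k : open U -> smooth_on (slit U) G ->
  fibre_homogeneous U d G -> fibre_homogeneous U d (ddir (hz k) G).
Proof.
move=> oU sG hG z t Sz t0; have oS := open_slit oU.
have : ddir (hz k) (fun z : P => G (z.1, t *: z.2)) z =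
       ddir (hz k) (fun z => t ^+ d * G z) z.
  by apply: (ddir_eq_on _ oS Sz) => w Sw; rewrite hG.
by rewrite (ddir_fibre_scale G t (hz k) z) (ddirZ _ _ sG Sz) /= scaler0.
Qed.

(** A row [w] of the left kernel makes the quadratic form of [A] vanish. *)
Lemma posdef_unitmx (A : 'M[R]_n) :
  (forall w : 'rV[R]_n, w != 0 -> 0 < \sum_i \sum_j A i j * w 0 i * w 0 j) ->
  A \in unitmx.
Proof.
move=> pA; rewrite -row_free_unit -kermx_eq0; apply/rowV0P => w.
rewrite sub_kermx => /eqP wA; apply/eqP; apply: contraT => /pA.
rewrite exchange_big /= big1 ?ltxx// => j _.
have := congr1 (fun M : 'rV[R]_n => M 0 j) wA; rewrite !mxE => {}wA.
by rewrite -mulr_suml; under eq_bigr do rewrite mulrC; rewrite wA mul0r.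
Qed.

(** The conditions on a Finsler metric that concern a single chart. The local calculus is thus
    available for both factors and for the fibre metric rescaled by f. *)
Definition local_finsler U F := [/\ open U,
  smooth_on (slit U) (unc F),
  (forall x y (t : R), U x -> 0 < t -> F x (t *: y) = t * F x y) &
  (forall x y, U x -> y != 0 -> forall w : 'rV[R]_n, w != 0 ->
    0 < \sum_i \sum_j fundamental F x y i j * w 0 i * w 0 j)].

Section Local.
Variables (U : set 'rV[R]_n) (F : 'rV[R]_n -> 'rV[R]_n -> R).
Hypothesis lF : local_finsler U F.
Let oU : open U. Proof. by case: lF. Qed.
Let oS : open (slit U). Proof. exact: open_slit. Qed.
Local Notation S := (slit U).
Local Notation E := (unc (sqF F)).

Lemma smooth_sqF : smooth_on S E.
Proof. by case: lF => _ sF _ _; exact: (smooth_onX 2 oS sF). Qed.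
Let sE := smooth_sqF.

Lemma homogeneous_sqF : fibre_homogeneous U 2 E.
Proof.
by case: lF => _ _ hF _ z t [Uz _] t0; rewrite /unc /sqF /= hF// exprMn.
Qed.

Lemma fundamentalE i j z : fundamental F z.1 z.2 i j = 2^-1 * ddir (vt j) (ddir (vt i) E) z.
Proof. by rewrite mxE -(unc_d_fib i (sqF F)) -(unc_d_fib j (d_fib i (sqF F))). Qed.

Lemma fundamental_sym i j z : S z ->
  fundamental F z.1 z.2 i j = fundamental F z.1 z.2 j i.
Proof. by move=> Sz; rewrite !fundamentalE (ddirC _ _ oS Sz sE). Qed.

Lemma smooth_fundamental i j : smooth_on S (fun z => fundamental F z.1 z.2 i j).
Proof.
under eq_fun do rewrite fundamentalE.
by apply: smooth_onZ => //; do 2 apply: smooth_ddir.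
Qed.

Lemma fundamental_unit z : S z -> fundamental F z.1 z.2 \in unitmx.
Proof. by case: lF => _ _ _ pF [Uz z0]; apply: posdef_unitmx; exact: pF. Qed.

Lemma smooth_inv_fundamental i j :
  smooth_on S (fun z => inv_fundamental F z.1 z.2 i j).
Proof.
apply: smooth_on_invmx => //; first exact: fundamental_unit.
exact: smooth_fundamental.
Qed.

Lemma homogeneous_fundamental i j :
  fibre_homogeneous U 0 (fun z => fundamental F z.1 z.2 i j).
Proof.
rewrite (_ : (fun z => _) = fun z => 2^-1 * ddir (vt j) (ddir (vt i) E) z); last first.
  by apply/funext => z; exact: fundamentalE.
move=> z t Sz t0.
have h1 := fibre_homogeneous_vt i oU sE homogeneous_sqF.
have h2 := fibre_homogeneous_vt j oU (smooth_ddir _ sE) h1.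
by rewrite h2// !expr0 !mul1r.
Qed.

Lemma euler_sqF_vt i z : S z -> \sum_k z.2 0 k * ddir (vt k) (ddir (vt i) E) z = ddir (vt i) E z.
Proof.
move=> Sz; rewrite (euler_identity oU (smooth_ddir _ sE) _ Sz (d := 1)) ?mul1r//.
exact: fibre_homogeneous_vt oU sE homogeneous_sqF.
Qed.

(** Euler's identity in degree 2 for F^2, then in degree 1 for its first fibre derivatives. *)
Lemma sqF_quadratic z : S z ->
  E z = \sum_i \sum_j fundamental F z.1 z.2 i j * z.2 0 i * z.2 0 j.
Proof.
move=> Sz; have e2 : (2 : R) != 0 by rewrite pnatr_eq0.
have := euler_identity oU sE homogeneous_sqF Sz.
move=> /esym /(canRL (mulKf e2)) ->; rewrite mulr_sumr; apply: eq_bigr => i _.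
rewrite -(euler_sqF_vt i Sz) !mulr_sumr; apply: eq_bigr => j _.
by rewrite fundamentalE; ring.
Qed.

Lemma sqF_gt0 z : S z -> 0 < E z.
Proof.
move=> Sz; rewrite sqF_quadratic//; case: lF => _ _ _ pF; case: Sz => Uz z0.
exact: pF.
Qed.

(** Four times the spray with its index lowered by g. *)
Definition spray_rhs l z : R :=
  (\sum_k ddir (hz k) (ddir (vt l) E) z * z.2 0 k) - ddir (hz l) E z.

Lemma sprayE i z : spray F i z.1 z.2 =
  4^-1 * \sum_l inv_fundamental F z.1 z.2 i l * spray_rhs l z.
Proof.
rewrite /spray /spray_rhs; congr (_ * _); apply: eq_bigr => l _.
rewrite -(unc_d_base l (sqF F)) -(unc_d_fib l (sqF F)).
by congr (_ * (_ - _)); apply: eq_bigr => k _; rewrite -(unc_d_base k (d_fib l (sqF F))).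
Qed.

Lemma smooth_spray_rhs l : smooth_on S (spray_rhs l).
Proof.
apply: smooth_onB => //; last exact: smooth_ddir.
apply: smooth_on_sum => // k; apply: smooth_onM => //; last exact: smooth_snd_coord.
by do 2 apply: smooth_ddir.
Qed.

Lemma smooth_spray i : smooth_on S (unc (spray F i)).
Proof.
rewrite /unc; under eq_fun do rewrite sprayE.
apply: smooth_onZ => //; apply: smooth_on_sum => // l; apply: smooth_onM => //.
  exact: smooth_inv_fundamental.
exact: smooth_spray_rhs.
Qed.

Lemma homogeneous_inv_fundamental i j :
  fibre_homogeneous U 0 (fun z => inv_fundamental F z.1 z.2 i j).
Proof.
move=> z t Sz t0; rewrite expr0 mul1r.
suff e : fundamental F z.1 (t *: z.2) = fundamental F z.1 z.2.
  exact: (congr1 (fun M : 'M[R]_n => invmx M i j) e).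
by apply/matrixP => a b; have := homogeneous_fundamental a b Sz t0; rewrite expr0 mul1r.
Qed.

Lemma homogeneous_spray_rhs l : fibre_homogeneous U 2 (spray_rhs l).
Proof.
move=> z t Sz t0; rewrite /spray_rhs mulrBr; congr (_ - _).
  rewrite mulr_sumr; apply: eq_bigr => k _.
  have h := fibre_homogeneous_hz k oU (smooth_ddir _ sE)
    (fibre_homogeneous_vt l oU sE homogeneous_sqF).
  by rewrite h//= mxE expr1 expr2; ring.
by rewrite (fibre_homogeneous_hz l oU sE homogeneous_sqF Sz t0).
Qed.

Lemma homogeneous_spray i : fibre_homogeneous U 2 (unc (spray F i)).
Proof.
have E1 : unc (spray F i) =
    fun z => 4^-1 * \sum_l inv_fundamental F z.1 z.2 i l * spray_rhs l z.
  by apply/funext => z; exact: sprayE.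
rewrite E1; apply: fibre_homogeneousZ; apply: fibre_homogeneous_sum => l.
apply: (@fibre_homogeneousM _ 0 2); first exact: homogeneous_inv_fundamental.
exact: homogeneous_spray_rhs.
Qed.

Lemma fundamental_spray l z : S z ->
  2 * \sum_i ddir (vt i) (ddir (vt l) E) z * unc (spray F i) z = spray_rhs l z.
Proof.
move=> Sz.
have gV : fundamental F z.1 z.2 *m inv_fundamental F z.1 z.2 = 1%:M.
  by apply: mulmxV; exact: fundamental_unit.
transitivity (\sum_i \sum_m (fundamental F z.1 z.2 l i * inv_fundamental F z.1 z.2 i m) * spray_rhs m z).
  rewrite mulr_sumr; apply: eq_bigr => i _.
  rewrite /unc sprayE fundamentalE !mulr_sumr; apply: eq_bigr => m _.
  have e4 : (4 : R)^-1 * 2 = 2^-1 by field.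
  by rewrite -e4; ring.
rewrite exchange_big /= (bigD1 l)//= [X in _ + X]big1 ?addr0.
  rewrite -mulr_suml; have := congr1 (fun M : 'M[R]_n => M l l) gV.
  by rewrite !mxE eqxx => ->; rewrite mul1r.
move=> m ml; rewrite -mulr_suml; have := congr1 (fun M : 'M[R]_n => M l m) gV.
by rewrite !mxE eq_sym (negPf ml) => ->; rewrite mul0r.
Qed.

(** Contraction of [fundamental_spray] with y. Euler's identity turns the Hessian on the left into
    the gradient; on the right y^k y^l (F^2)_{x^k y^l} = 2 y^k (F^2)_{x^k}, one copy of which is
    subtracted. Geometrically, F is constant along geodesics. *)
Lemma spray_energy z : S z ->
  2 * \sum_i unc (spray F i) z * ddir (vt i) E z = \sum_k z.2 0 k * ddir (hz k) E z.
Proof.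
move=> Sz.
have -> : 2 * \sum_i unc (spray F i) z * ddir (vt i) E z =
    \sum_l z.2 0 l * spray_rhs l z.
  under [RHS]eq_bigr do rewrite -fundamental_spray// mulrCA mulr_sumr.
  rewrite -mulr_sumr exchange_big /=; congr (_ * _); apply: eq_bigr => i _.
  rewrite -(euler_sqF_vt i Sz) mulr_sumr; apply: eq_bigr => l _.
  by rewrite (ddirC _ _ oS Sz sE); ring.
rewrite /spray_rhs; under eq_bigr do rewrite mulrBr mulr_sumr.
rewrite sumrB exchange_big /=.
rewrite (_ : \sum_j _ = \sum_k z.2 0 k * (2 * ddir (hz k) E z)).
  by rewrite -sumrB; apply: eq_bigr => k _; ring.
apply: eq_bigr => k _.
rewrite -(euler_identity oU (smooth_ddir _ sE) (fibre_homogeneous_hz k oU sE homogeneous_sqF) Sz).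
rewrite mulr_sumr; apply: eq_bigr => l _.
by rewrite (ddirC (hz k) (vt l) oS Sz sE); ring.
Qed.

(* Differentiate [spray_energy] along the fibre and subtract [fundamental_spray]. *)
Lemma spray_horizontal m z : S z ->
  \sum_i ddir (vt m) (unc (spray F i)) z * ddir (vt i) E z = ddir (hz m) E z.
Proof.
move=> Sz.
have sD v : smooth_on S (ddir v E) by exact: smooth_ddir.
have sG i := smooth_spray i.
have sy k : smooth_on S (fun z : P => z.2 0 k) by exact: smooth_snd_coord.
have sGE i : smooth_on S (fun z => unc (spray F i) z * ddir (vt i) E z) by exact: smooth_onM.
have syE k : smooth_on S (fun z : P => z.2 0 k * ddir (hz k) E z) by exact: smooth_onM.
have := ddir_eq_on (vt m) oS Sz spray_energy.
rewrite (ddirZ (vt m) 2 (smooth_on_sum _ _ oS sGE) Sz).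
rewrite (ddir_sum _ _ (vt m) oS sGE Sz) (ddir_sum _ _ (vt m) oS syE Sz).
under eq_bigr => i _ do rewrite (ddirM (vt m) (sG i) (sD (vt i)) Sz).
under [RHS]eq_bigr => i _ do
  rewrite (ddirM (vt m) (sy i) (sD (hz i)) Sz) ddir_snd_coord vt_snd.
rewrite !big_split /=.
rewrite [X in _ = _ + X](bigD1 m)//= eqxx mulr1 [X in _ = _ + (_ + X)]big1 ?addr0; last first.
  by move=> i im; rewrite (negPf im) mulr0.
move=> h.
have h1 : 2 * \sum_i unc (spray F i) z * ddir (vt m) (ddir (vt i) E) z =
    \sum_k z.2 0 k * ddir (vt m) (ddir (hz k) E) z - ddir (hz m) E z.
  transitivity (spray_rhs m z).
    rewrite -(fundamental_spray m Sz); congr (_ * _); apply: eq_bigr => i _.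
    by rewrite (ddirC (vt m) (vt i) oS Sz sE) mulrC.
  rewrite /spray_rhs; congr (_ - _); apply: eq_bigr => k _.
  by rewrite (ddirC (vt m) (hz k) oS Sz sE) mulrC.
rewrite mulrDr h1 in h.
have : 2 * \sum_i ddir (vt i) E z * ddir (vt m) (unc (spray F i)) z = 2 * ddir (hz m) E z.
  by apply: (addrI (\sum_k z.2 0 k * ddir (vt m) (ddir (hz k) E) z - ddir (hz m) E z)); rewrite h; ring.
have e2 : (2 : R) != 0 by rewrite pnatr_eq0.
move/(mulfI e2) => <-.
by apply: eq_bigr => i _; rewrite mulrC.
Qed.

End Local.
End LocalFinslerCalculus.

(** * Functions on a punctured fibre *)

Section Fibre.
Context {R : realType} {n : nat}.
Local Notation V := 'rV[R]_n.
Local Notation P := (V * V)%type.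
Implicit Types (x y z : V) (h : V -> R) (i j k : 'I_n).

Lemma ddir_row h (U : set V) y v : open U -> U y -> smooth_on U h ->
  ddir v h y = \sum_k v 0 k * ddir (delta_mx 0 k) h y.
Proof.
move=> oU Uy sh; rewrite -(ddir_dir_sum _ _ _ oU Uy sh); congr (ddir _ h y).
exact: row_sum_delta.
Qed.

Lemma segment_constant h (U : set V) y z : open U -> smooth_on U h ->
  (forall k w, U w -> ddir (delta_mx 0 k) h w = 0) ->
  (forall s, 0 <= s <= 1 -> U (y + s *: (z - y))) -> h y = h z.
Proof.
move=> oU sh h0 inU; have [s s01] := ddir_line sh inU.
rewrite (ddir_row _ oU (inU s s01) sh) big1 => [|k _]; last by rewrite h0 ?mulr0//; exact: inU.
by rewrite [y + _]addrC subrK => /eqP; rewrite subr_eq0 eq_sym => /eqP.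
Qed.

(** The segment between two nonzero vectors may meet the origin, so the path is taken through
    coordinate vectors, of which there are at least two. *)
Lemma punctured_constant h : (1 < n)%N -> smooth_on punctured h ->
  (forall k w, punctured w -> ddir (delta_mx 0 k) h w = 0) ->
  forall y z, y != 0 -> z != 0 -> h y = h z.
Proof.
move=> n1 sh h0.
have other k : exists k', k' != k.
  have [->|k0] := eqVneq k (Ordinal (ltnW n1)).
    by exists (Ordinal n1); rewrite -val_eqE.
  by exists (Ordinal (ltnW n1)); rewrite eq_sym.
(* The [k]-th coordinate along the segment is [(1 - s) * y 0 k]: it vanishes only at the end point
   [z], which is itself nonzero. *)
have step k y z : y 0 k != 0 -> z 0 k = 0 -> z != 0 -> h y = h z.
  move=> yk zk z0; apply: (segment_constant open_punctured sh h0) => s s01.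
  apply/eqP => E0; have := congr1 (fun M : V => M 0 k) E0.
  rewrite !mxE zk sub0r mulrN -[X in X - _]mul1r -mulrBl => /eqP.
  rewrite mulf_eq0 (negPf yk) orbF subr_eq0 => /eqP s1; move/eqP: z0; apply.
  by rewrite -E0 -s1 scale1r addrC subrK.
have delta_n0 k : (delta_mx 0 k : V) != 0.
  by apply/eqP => /matrixP/(_ 0 k)/eqP; rewrite !mxE !eqxx oner_eq0.
have base k k' : h (delta_mx 0 k) = h (delta_mx 0 k').
  have [->//|kk'] := eqVneq k k'.
  by apply: (step k); rewrite ?mxE ?eqxx ?oner_neq0// (negPf kk') andbF.
have nz y : y != 0 -> exists k, y 0 k != 0.
  move=> y0; apply: contrapT => /forallNP yk; move/eqP: y0; apply.
  apply/matrixP => a k; rewrite ord1 mxE; apply/eqP; apply: contrapT => /negP.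
  exact: yk.
have toD y : y != 0 -> exists k, h y = h (delta_mx 0 k).
  move=> /nz[k yk]; have [k' k'k] := other k; exists k'.
  by apply: (step k) => //; rewrite mxE eq_sym (negPf k'k) andbF.
by move=> y z /toD[k ->] /toD[k' ->]; exact: base.
Qed.

Lemma smooth_fibre (U : set V) (G : P -> R) x : U x -> smooth_on (slit U) G ->
  smooth_on punctured (fun y => G (x, y)).
Proof.
move=> Ux; apply: (@smooth_on_comp_affine _ _ _ _ (fun y => (x, y)) (fun y => (0, y))) => //.
  by move=> h u z; rewrite [RHS]/GRing.add /= /add_pair /= scaler0 add0r.
move=> y; apply: (@cvg_pair V V V (nbhs y) (nbhs x) (nbhs y) _ _ _ (fun=> x) id).
  exact: cvg_cst.
exact: cvg_id.
Qed.

Lemma ddir_fibre (G : P -> R) x v y : ddir v (fun y => G (x, y)) y = ddir (0, v) G (x, y).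
Proof.
apply: (@ddir_comp_affine _ _ _ (fun y => (x, y)) (fun y => (0, y)) G).
by move=> h u z; rewrite [RHS]/GRing.add /= /add_pair /= scaler0 add0r.
Qed.

(** Among the characterisations of a Euclidean norm this one involves values only, so it is stable
    under linear substitutions and under approximation of the values. The zero vector is included,
    since [y + z] or [y - z] may vanish. *)
Definition parallelogram_law (e : V -> R) :=
  forall y z, e (y + z) + e (y - z) = 2 * e y + 2 * e z.

Lemma ddir_translate h y z v : ddir v (fun w => h (w + z)) y = ddir v h (y + z).
Proof.
apply: (@ddir_comp_affine _ _ _ (fun w => w + z) id h).
by move=> c u w; rewrite addrA.
Qed.

Lemma smooth_translate h (U : set V) z : smooth_on U h ->
  smooth_on [set w | U (w + z)] (fun w => h (w + z)).
Proof.
apply: (@smooth_on_comp_affine _ _ _ _ (fun w => w + z) id) => //.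
  by move=> c u w; rewrite addrA.
by move=> w; exact: (cvgD cvg_id (cvg_cst z)).
Qed.

Lemma open_translate (U : set V) z : open U -> open [set w | U (w + z)].
Proof.
move=> oU; apply: (open_comp _ oU) => w _.
exact: (cvgD cvg_id (cvg_cst z)).
Qed.

(* Differentiating the parallelogram law twice in [y] gives
   [H (y + z) + H (y - z) = 2 H y] for the Hessian coefficient [H]; the choice
   [y = z + s u] with [s] tending to [0] then yields [H z = H u], since [H] is
   homogeneous of degree [0]. *)
Lemma parallelogram_hessian (e : V -> R) v w : smooth_on punctured e ->
  (forall (t : R) y, 0 < t -> e (t *: y) = t ^+ 2 * e y) ->
  parallelogram_law e ->
  forall z u, z != 0 -> u != 0 -> ddir w (ddir v e) z = ddir w (ddir v e) u.
Proof.
move=> se he PL z u z0 u0.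
pose H := ddir w (ddir v e).
have sH : smooth_on punctured H by do 2 apply: smooth_ddir.
have oP := @open_punctured R n.
have HL y a : y != 0 -> y + a != 0 -> y - a != 0 -> H (y + a) + H (y - a) = 2 * H y.
  move=> y0 ya0 yb0.
  pose O : set V := punctured `&` ([set w | punctured (w + a)] `&` [set w | punctured (w - a)]).
  have oO : open O by apply: openI => //; apply: openI; exact: open_translate.
  have Oy : O y by [].
  have rule b (g : V -> R) : smooth_on punctured g -> (b = a \/ b = - a) -> smooth_on O (fun w => g (w + b)).
    move=> sg bE; apply: (smooth_on_subset _ (smooth_translate b sg)).
    by move=> x [? []]; case: bE => ->.
  have se0 : smooth_on O e by apply: smooth_on_subset se => x [].
  have lin (g : V -> R) (c d : R) b : smooth_on punctured g ->
      (forall x, O x -> g (x + a) + g (x - a) = 2 * g x + c) ->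
      forall x, O x -> ddir b g (x + a) + ddir b g (x - a) = 2 * ddir b g x + 0.
    move=> sg gE x Ox.
    have sg0 : smooth_on O g by apply: smooth_on_subset sg => y' [].
    have sga := rule a g sg (or_introl erefl).
    have sgb := rule (- a) g sg (or_intror erefl).
    rewrite -(ddir_translate g x a) -(ddir_translate g x (- a)).
    rewrite -(ddirD b sga sgb Ox) (ddir_eq_on b oO Ox gE).
    rewrite (ddirD b (smooth_onZ 2 oO sg0) (smooth_on_cst _ _) Ox).
    by rewrite (ddirZ b 2 sg0 Ox) ddir_cst.
  have l1 := lin e (2 * e a) 0 v se (fun x _ => PL x a).
  have l2 := lin (ddir v e) 0 0 w (smooth_ddir v se) l1.
  by rewrite l2// addr0.
have hH (t : R) y : 0 < t -> y != 0 -> H (t *: y) = H y.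
  move=> t0 y0; have ty0 : t *: y != 0 by rewrite scaler_eq0 negb_or gt_eqF.
  have lin (g : V -> R) d b y' : smooth_on punctured g -> y' != 0 ->
      (forall y, punctured y -> g (t *: y) = t ^+ d.+1 * g y) ->
      ddir b g (t *: y') = t ^+ d * ddir b g y'.
    move=> sg y'0 gE; have := ddir_eq_on b oP y'0 gE.
    have ty'0 : t *: y' != 0 by rewrite scaler_eq0 negb_or gt_eqF.
    rewrite (ddirZ b _ sg y'0).
    rewrite (@ddir_comp_linear _ _ _ (fun y => t *: y)); last first.
      by move=> c p q; rewrite scalerDr !scalerA [t * c]mulrC.
    rewrite (ddir_dirZ _ _ sg ty'0) exprS -mulrA => /mulfI; apply.
    by rewrite gt_eqF.
  have l1 y' : punctured y' -> ddir v e (t *: y') = t ^+ 1 * ddir v e y'.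
    by move=> y'0; apply: lin => // y'' _; exact: he.
  have := lin (ddir v e) 0%N w y (smooth_ddir v se) y0 l1.
  by rewrite expr0 mul1r.
have z20 : z + z != 0 by rewrite -mulr2n -scaler_nat scaler_eq0 negb_or pnatr_eq0.
have H2 : H (z + z) = H z by rewrite -mulr2n -scaler_nat hH.
pose q (s : R) := 2 * H (z + s *: u) - H (z + z + s *: u).
have line c : {for 0, continuous (fun s : R => c + s *: u)}.
  apply: cvgD; first exact: cvg_cst.
  exact: (@cvgZr_tmp _ _ _ _ _ _ _ u cvg_id).
have cont c : c != 0 -> (fun s : R => H (c + s *: u)) @ (0 : R) --> H c.
  move=> c0; apply: (@cvg_comp _ _ _ (fun s : R => c + s *: u) H _ (nbhs c)).
    by have := line c; rewrite /prop_for /continuous_at scale0r addr0.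
  exact: smooth_on_continuous sH c0.
have cq : q @ (0 : R)^'+ --> 2 * H z - H (z + z).
  apply: cvg_at_right_filter; apply: cvgB; last exact: cont.
  by apply: cvgMl_tmp; exact: cont.
have qE : \forall s \near (0 : R)^'+, q s = H u.
  have n0 c : c != 0 -> \forall s \near (0 : R)^'+, c + s *: u != 0.
    move=> c0; have := cvg_at_right_filter (line c); rewrite scale0r addr0.
    by move=> /(_ punctured); apply; exact: open_near oP c0.
  near=> s; have s0 : 0 < s by near: s; exact: nbhs_right_gt.
  have y0 : z + s *: u != 0 by near: s; exact: n0.
  have y1 : z + z + s *: u != 0 by near: s; exact: n0.
  have su : s *: u != 0 by rewrite scaler_eq0 negb_or gt_eqF.
  have := HL (z + s *: u) z y0.
  rewrite addrAC [z + s *: u - z]addrAC subrr add0r => /(_ y1 su).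
  by rewrite /q => <-; rewrite hH// [LHS]addrC addKr.
have cu : q @ (0 : R)^'+ --> H u.
  apply: (@cvg_trans _ ((fun=> H u) @ (0 : R)^'+)); last exact: cvg_cst.
  by apply: near_eq_cvg; apply: filterS qE => s ->.
have E1 : 2 * H z - H (z + z) = H u := cvg_unique (@norm_hausdorff _ _) cq cu.
by rewrite -[LHS]/(H z) -[RHS]/(H u) -E1 H2; ring.
Unshelve. all: by end_near. Qed.

End Fibre.

(** * Transport of the parallelogram law *)

Section Transport.
Context {R : realType} {n : nat}.
Local Notation V := 'rV[R]_n.
Local Notation P := (V * V)%type.

Lemma continuous_sum (T : topologicalType) (W : normedModType R) (I : Type)
    (r : seq I) (f : I -> T -> W) (t : T) :
  (forall i, {for t, continuous (f i)}) -> {for t, continuous (fun s => \sum_(i <- r) f i s)}.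
Proof.
move=> cf; elim: r => [|i r IH].
  rewrite (_ : (fun s => _) = fun=> 0); first exact: cvg_cst.
  by apply/funext => s; rewrite big_nil.
rewrite (_ : (fun s => _) = fun s => f i s + \sum_(j <- r) f j s).
  exact: (continuousD (cf i) IH).
by apply/funext => s; rewrite big_cons.
Qed.

Lemma continuous_row (T : topologicalType) (f : T -> V) (t : T) :
  (forall k, {for t, continuous (fun s => f s 0 k)}) -> {for t, continuous f}.
Proof.
move=> cf.
have fE : f = fun s => \sum_k f s 0 k *: delta_mx 0 k.
  by apply/funext => s; exact: row_sum_delta.
rewrite fE; apply: continuous_sum => k.
by apply: cvgZr_tmp; exact: cf.
Qed.

Lemma continuous_mulmx (T : topologicalType) (f : T -> V) (A : T -> 'M[R]_n) (t : T) :
  {for t, continuous f} -> (forall i j, {for t, continuous (fun s => A s i j)}) ->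
  {for t, continuous (fun s => f s *m A s)}.
Proof.
move=> cf cA; apply: continuous_row => k.
rewrite (_ : (fun s => _) = fun s => \sum_j f s 0 j * A s j k); last first.
  by apply/funext => s; rewrite mxE.
apply: continuous_sum => j; apply: cvgM; last exact: cA.
by apply: (@continuous_comp _ _ _ f (fun y : V => y 0 j)) => //; exact: coord_continuous.
Qed.

Lemma continuous_pair (T A B : topologicalType) (f : T -> A) (g : T -> B) (t : T) :
  {for t, continuous f} -> {for t, continuous g} ->
  {for t, continuous (fun s => (f s, g s))}.
Proof. by move=> cf cg; exact: (@cvg_pair T A B (nbhs t) (nbhs (f t)) (nbhs (g t))). Qed.

Lemma bernoulli_ineq (x : R) k : 0 <= x <= 1 -> 1 - k%:R * x <= (1 - x) ^+ k.
Proof.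
move=> /andP[x0 x1]; elim: k => [|k IH]; first by rewrite mul0r subr0 expr0.
rewrite exprS; apply: (@le_trans _ _ ((1 - x) * (1 - k%:R * x))).
  rewrite -natr1 -subr_ge0.
  rewrite (_ : _ - _ = k%:R * x ^+ 2); last by ring.
  by rewrite mulr_ge0// exprn_ge0.
by rewrite ler_wpM2l// subr_ge0.
Qed.

Lemma sphere_compact : compact [set y : V | `|y| = 1].
Proof.
apply: bounded_closed_compact.
  by exists 1; split=> // M M1 y /= ->; exact: ltW.
have -> : [set y : V | `|y| = 1] = (@Num.norm R V) @^-1` [set 1].
  by [].
apply: closed_comp; last first.
  apply: accessible_closed_set1; apply: hausdorff_accessible; exact: Rhausdorff.
by move=> y _; exact: norm_continuous.
Qed.

(** * Euler polygons for a linear transport equation along a segment *)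

Section Step.
Variables (U : set V) (E : P -> R) (x0 d : V) (N : V -> 'M[R]_n).
Hypothesis oU : open U.
Hypothesis sE : smooth_on (slit U) E.
Hypothesis E0 : forall x, U x -> E (x, 0) = 0.
Hypothesis hE : forall x y (t : R), U x -> 0 < t -> E (x, t *: y) = t ^+ 2 * E (x, y).
Hypothesis E_gt0 : forall z, slit U z -> 0 < E z.
Hypothesis inU : forall t : R, 0 <= t <= 1 -> U (x0 + t *: d).
Hypothesis cN : forall i j x, U x -> {for x, continuous (fun x => N x i j)}.
Hypothesis EN : forall z, slit U z -> ddir (d, 0) E z = ddir (0, z.2 *m N z.1) E z.

Local Notation gam t := (x0 + t *: d).
Let oS := open_slit oU.

(** The derivatives in [s] of [E] under the two motions to be compared: with [f1] the vector moves
    along [y *m N] over a fixed point, with [f2] the point moves along the segment under a fixed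
    vector. [EN] makes them agree at [s = 0]. *)
Let f1 (q : (R * V) * R) : R := let: ((t, y), s) := q in
  \sum_k (y *m N (gam t)) 0 k * ddir (vt k) E (gam t, y + s *: (y *m N (gam t))).
Let f2 (q : (R * V) * R) : R := let: ((t, y), s) := q in
  ddir (d, 0) E (gam (t + s), y).

Let cq1 (q : (R * V) * R) : {for q, continuous (fun q : (R * V) * R => q.1.1)}.
Proof. by apply: continuous_comp; [exact: cvg_fst|exact: cvg_fst]. Qed.

Let cq2 (q : (R * V) * R) : {for q, continuous (fun q : (R * V) * R => q.1.2)}.
Proof. by apply: continuous_comp; [exact: cvg_fst|exact: cvg_snd]. Qed.

Let cX (T : topologicalType) (f : T -> R) q : {for q, continuous f} ->
  {for q, continuous (fun q => gam (f q))}.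
Proof.
move=> cf; apply: continuousD; first exact: cvg_cst.
exact: (@cvgZr_tmp _ _ _ _ _ _ _ d cf).
Qed.

Let cyN t y s : U (gam t) -> {for ((t, y), s), continuous
  (fun q : (R * V) * R => q.1.2 *m N (gam q.1.1))}.
Proof.
move=> Ut; apply: continuous_mulmx; first exact: cq2.
move=> i j; apply: (@continuous_comp _ _ _ (fun q : (R * V) * R => gam q.1.1) (fun x => N x i j)).
  exact: (cX (@cq1 _)).
exact: cN.
Qed.

Let f1_continuous t y : U (gam t) -> y != 0 -> {for ((t, y), 0), continuous f1}.
Proof.
move=> Ut y0.
have -> : f1 = fun q : (R * V) * R => \sum_k (q.1.2 *m N (gam q.1.1)) 0 k *
    ddir (vt k) E (gam q.1.1, q.1.2 + q.2 *: (q.1.2 *m N (gam q.1.1))).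
  by apply/funext => -[[t' y'] s'].
apply: continuous_sum => k; apply: cvgM.
  apply: (@continuous_comp _ _ _ (fun q : (R * V) * R => q.1.2 *m N (gam q.1.1))
    (fun y : V => y 0 k)); first exact: cyN.
  exact: coord_continuous.
apply: (@continuous_comp _ _ _ (fun q : (R * V) * R =>
  (gam q.1.1, q.1.2 + q.2 *: (q.1.2 *m N (gam q.1.1)))) (ddir (vt k) E)).
  apply: continuous_pair; first exact: (cX (@cq1 _)).
  apply: continuousD; first exact: cq2.
  by apply: cvgZ; [exact: cvg_snd|exact: cyN].
apply: smooth_on_continuous (smooth_ddir (vt k) sE) _.
by split=> //=; rewrite scale0r addr0.
Qed.

Let f2_continuous t y s : U (gam (t + s)) -> y != 0 -> {for ((t, y), s), continuous f2}.
Proof.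
move=> Ut y0.
have -> : f2 = fun q : (R * V) * R => ddir (d, 0) E (gam (q.1.1 + q.2), q.1.2).
  by apply/funext => -[[t' y'] s'].
apply: (@continuous_comp _ _ _ (fun q : (R * V) * R => (gam (q.1.1 + q.2), q.1.2)) (ddir (d, 0) E)).
  apply: continuous_pair; last exact: cq2.
  by apply: cX; apply: continuousD; [exact: cq1|exact: cvg_snd].
exact: smooth_on_continuous (smooth_ddir (d, 0) sE) _.
Qed.

Let f12 t y : U (gam t) -> y != 0 -> f1 ((t, y), 0) = f2 ((t, y), 0).
Proof.
move=> Ut y0; have Sz : slit U (gam t, y) by [].
by rewrite /f1 /f2 scale0r !addr0 (EN Sz) (ddir_vertical _ oS Sz sE).
Qed.

Let K : set (R * V) := `[0, 1]%classic `*` [set y : V | `|y| = 1].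

Let KU q : K q -> U (gam q.1) /\ q.2 != 0.
Proof.
move=> [/= q01 q1]; split; first by apply: inU; rewrite in_itv in q01.
by rewrite -normr_eq0 q1 oner_eq0.
Qed.

Let compactK : compact K.
Proof. by apply: compact_setX; [exact: segment_compact|exact: sphere_compact]. Qed.

(** Both derivatives are continuous and agree at [s = 0]; compactness of the segment times the unit
    sphere makes the closeness uniform. The first conclusion keeps the moved vector away from zero,
    where [E] need not be smooth. *)
Lemma step_uniform (e : R) : 0 < e -> exists2 D : R, 0 < D &
  forall t y s, 0 <= t <= 1 -> `|y| = 1 -> `|s| < D ->
    [/\ y + s *: (y *m N (gam t)) != 0, `|f1 ((t, y), s) - f2 ((t, y), 0)| <= e
      & `|f2 ((t, y), s) - f2 ((t, y), 0)| <= e].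
Proof.
move=> e0.
have /compact_near_coveringP nc := compactK.
have := nc R (nbhs (0 : R)) (fun s q => [/\ q.2 + s *: (q.2 *m N (gam q.1)) != 0,
   `|f1 (q, s) - f2 (q, 0)| <= e & `|f2 (q, s) - f2 (q, 0)| <= e]) _.
have cov q : K q -> \forall q' \near q & s \near nbhs (0 : R),
   [/\ q'.2 + s *: (q'.2 *m N (gam q'.1)) != 0,
   `|f1 (q', s) - f2 (q', 0)| <= e & `|f2 (q', s) - f2 (q', 0)| <= e].
  move=> /KU[Uq q0]; case: q Uq q0 => t y /= Ut y0.
  have c1 := f1_continuous Ut y0.
  have c2 : {for ((t, y), 0), continuous f2} by apply: f2_continuous; rewrite ?addr0.
  have c3 : {for ((t, y), 0), continuous (fun q : (R * V) * R => f2 (q.1, 0))}.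
    apply: (@continuous_comp _ _ _ (fun q : (R * V) * R => (q.1, 0)) f2) => //.
    by apply: continuous_pair; [exact: cvg_fst|exact: cvg_cst].
  have c4 : {for ((t, y), 0), continuous (fun q : (R * V) * R =>
      q.1.2 + q.2 *: (q.1.2 *m N (gam q.1.1)))}.
    apply: continuousD; first exact: cq2.
    by apply: cvgZ; [exact: cvg_snd|exact: cyN].
  suff : \forall q \near (((t, y), 0) : (R * V) * R),
    [/\ q.1.2 + q.2 *: (q.1.2 *m N (gam q.1.1)) != 0,
     `|f1 q - f2 (q.1, 0)| <= e & `|f2 q - f2 (q.1, 0)| <= e].
    by move=> [[A B] [/= nA nB] AB]; exists (A, B) => // -[a b] /AB; case: a.
  have n1 : \forall q \near (((t, y), 0) : (R * V) * R), `|f1 q - f2 (q.1, 0)| <= e.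
    have : (fun q => f1 q - f2 (q.1, 0)) @ (((t, y), 0) : (R * V) * R) --> 0.
      have Z : f1 ((t, y), 0) - f2 ((t, y), 0) = 0 by rewrite f12// subrr.
      have := cvgB c1 c3; rewrite Z => H; exact: H.
    move=> /cvgrPdist_le/(_ e e0); apply: filterS => q.
    by rewrite sub0r normrN.
  have n2 : \forall q \near (((t, y), 0) : (R * V) * R), `|f2 q - f2 (q.1, 0)| <= e.
    have : (fun q => f2 q - f2 (q.1, 0)) @ (((t, y), 0) : (R * V) * R) --> 0.
      have Z : f2 ((t, y), 0) - f2 ((t, y), 0) = 0 by rewrite subrr.
      have := cvgB c2 c3; rewrite Z => H; exact: H.
    move=> /cvgrPdist_le/(_ e e0); apply: filterS => q.
    by rewrite sub0r normrN.
  have n3 : \forall q \near (((t, y), 0) : (R * V) * R),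
      q.1.2 + q.2 *: (q.1.2 *m N (gam q.1.1)) != 0.
    apply: (c4 punctured) => /=; apply: open_near open_punctured _.
    by rewrite /punctured /= scale0r addr0.
  by near=> q; split; near: q.
move=> /(_ _ cov) /nbhs_ballP[D /= D0 hD].
exists D => // t y s t01 y1 sD.
have bs : ball (0 : R) D s by rewrite -ball_normE /= sub0r normrN.
by apply: (hD s bs (t, y)); split=> //=; rewrite in_itv.
Unshelve. all: by end_near. Qed.

(** Both increments start from [E (gam t, y)]. By the mean value theorem each is [h] times a
    derivative within [e / 2] of the common value at [s = 0]. *)
Lemma step_sphere (e : R) : 0 < e -> exists2 D : R, 0 < D &
  forall t y h, 0 <= t -> 0 <= h < D -> t + h <= 1 -> `|y| = 1 ->
    `|E (gam t, y + h *: (y *m N (gam t))) - E (gam (t + h), y)| <= e * h.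
Proof.
move=> e0; have e20 : 0 < e / 2 by rewrite divr_gt0.
have [D D0 HD] := step_uniform e20; exists D => // t y h t0 /andP[h0 hD] th1 y1.
have sh s : 0 <= s <= 1 -> 0 <= s * h <= h.
  by move=> /andP[s0 s1]; rewrite mulr_ge0//= ler_piMl.
have shD s : 0 <= s <= 1 -> `|s * h| < D.
  by move=> /sh /andP[a b]; rewrite ger0_norm// (le_lt_trans b).
have t01 : 0 <= t <= 1 by rewrite t0 (le_trans _ th1)// lerDl.
have Ut := inU t01.
have y0 : y != 0 by rewrite -normr_eq0 y1 oner_eq0.
have Sz : slit U (gam t, y) by [].
pose yN := y *m N (gam t).
have p1 s : (gam t, y) + s *: (0, h *: yN) = (gam t, y + (s * h) *: yN) :> P.
  by rewrite [LHS]/GRing.add /= /add_pair /= scaler0 addr0 scalerA.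
have in1 s : 0 <= s <= 1 -> slit U ((gam t, y) + s *: ((0, h *: yN) : P)).
  by move=> s01; rewrite p1; split=> //=; have [] := HD t y (s * h) t01 y1 (shD s s01).
have p2 s : (gam t, y) + s *: (h *: d, 0) = (gam (t + s * h), y) :> P.
  by rewrite [LHS]/GRing.add /= /add_pair /= scaler0 addr0 scalerA scalerDl addrA.
have in2 s : 0 <= s <= 1 -> slit U ((gam t, y) + s *: ((h *: d, 0) : P)).
  move=> s01; rewrite p2; split=> //=; apply: inU.
  have /andP[a b] := sh s s01.
  by rewrite addr_ge0//= (le_trans _ th1)// lerD2l.
have [s s01 Es] := ddir_line sE in1; have [r r01 Er] := ddir_line sE in2.
have S1 := in1 s s01; have S2 := in2 r r01.
have Z1 : (0, h *: yN) = h *: ((0, yN) : P) by rewrite [RHS]/GRing.scale /= /scale_pair /= scaler0.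
have Z2 : (h *: d, 0) = h *: ((d, 0) : P) by rewrite [RHS]/GRing.scale /= /scale_pair /= scaler0.
have q1 := p1 1; rewrite scale1r mul1r in q1.
have q2 := p2 1; rewrite scale1r mul1r in q2.
have F1 : E (gam t, y + h *: yN) - E (gam t, y) = h * f1 ((t, y), s * h).
  rewrite -q1 Es {1}Z1 (ddir_dirZ _ _ sE S1) (ddir_vertical _ oS S1 sE) p1.
  by rewrite /f1.
have F2 : E (gam (t + h), y) - E (gam t, y) = h * f2 ((t, y), r * h).
  by rewrite -q2 Er {1}Z2 (ddir_dirZ _ _ sE S2) p2 /f2.
have -> : E (gam t, y + h *: yN) - E (gam (t + h), y) =
    h * ((f1 ((t, y), s * h) - f2 ((t, y), 0)) - (f2 ((t, y), r * h) - f2 ((t, y), 0))).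
  by rewrite opprB addrA subrK mulrBr -F1 -F2; ring.
rewrite normrM (ger0_norm h0) mulrC ler_wpM2r//.
rewrite (le_trans (ler_normB _ _))// [leRHS](splitr e) lerD//.
  by have [] := HD t y (s * h) t01 y1 (shD s s01).
by have [] := HD t y (r * h) t01 y1 (shD r r01).
Qed.

Lemma sphere_lower_bound : exists2 c : R, 0 < c &
  forall t y, 0 <= t <= 1 -> `|y| = 1 -> c <= E (gam t, y).
Proof.
(* The sphere is empty in dimension zero; any positive constant then serves. *)
have [[q Kq]|Ke] := pselect (K !=set0); last first.
  exists 1 => // t y t01 y1; exfalso; apply: Ke; exists (t, y).
  by split=> //=; rewrite in_itv.
have : {within K, continuous (fun q => E (gam q.1, q.2))}.
  apply: continuous_in_subspaceT => q'; rewrite inE => /KU[Uq q0].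
  apply: (@continuous_comp _ _ _ (fun q : R * V => (gam q.1, q.2)) E).
    by apply: continuous_pair; [apply: cX; exact: cvg_fst|exact: cvg_snd].
  exact: smooth_on_continuous sE _.
move=> /(compact_EVT_min (ex_intro _ q Kq) compactK)[c].
rewrite inE => /KU[Uc c0] cmin; exists (E (gam c.1, c.2)); first exact: E_gt0.
move=> t y t01 y1; apply: (cmin (t, y)); rewrite inE; split=> //=.
Qed.

(** The absolute error on the sphere is taken as [e * c * h], with [c] a positive lower bound of [E]
    there, which makes it relative; homogeneity of degree 2 then gives all nonzero vectors. Relative
    errors are those that multiply along a polygon. *)
Lemma step_relative (e : R) : 0 < e -> exists2 D : R, 0 < D &
  forall t h, 0 <= t -> 0 <= h < D -> t + h <= 1 -> forall y,
    `|E (gam t, y *m (1%:M + h *: N (gam t))) - E (gam (t + h), y)| <= e * h * E (gam (t + h), y).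
Proof.
move=> e0; have [c c0 cE] := sphere_lower_bound.
have [D D0 HD] := step_sphere (mulr_gt0 e0 c0); exists D => // t h t0 hD th1 y.
have /andP[h0 _] := hD.
have t01 : 0 <= t <= 1 by rewrite t0 (le_trans _ th1)// lerDl.
have th01 : 0 <= t + h <= 1 by rewrite th1 addr_ge0.
rewrite mulmxDr mulmx1 -scalemxAr.
have [->|y0] := eqVneq y 0.
  by rewrite mul0mx scaler0 addr0 !E0 ?subrr ?normr0 ?mulr0//; exact: inU.
have ny : 0 < `|y| by rewrite normr_gt0.
pose u := `|y|^-1 *: y.
have u1 : `|u| = 1 by rewrite normrZ ger0_norm ?invr_ge0// mulVf ?gt_eqF.
have yE : y = `|y| *: u by rewrite scalerA mulfV ?gt_eqF// scale1r.
have := HD t u h t0 hD th1 u1.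
have y1 : y + h *: (y *m N (gam t)) = `|y| *: (u + h *: (u *m N (gam t))).
  rewrite scalerDr; congr (_ + _); first exact: yE.
  by rewrite [RHS]scalerA [_ * h]mulrC -scalerA [in RHS]scalemxAl -yE.
have y2 : E (gam (t + h), y) = `|y| ^+ 2 * E (gam (t + h), u).
  by rewrite {1}yE hE//; exact: inU.
rewrite y1 y2 (hE _ (inU t01) ny).
rewrite -mulrBr normrM ger0_norm ?sqr_ge0// => H1.
rewrite [leRHS]mulrCA ler_wpM2l ?sqr_ge0// (le_trans H1)// -mulrA [c * h]mulrC mulrA.
by apply: ler_wpM2l; [apply: mulr_ge0 => //; exact: ltW|exact: cE].
Qed.

(* [L] is the product of the Euler steps [1 + h N]; each step changes [E] by a
   factor between [1 - e h] and [1 + e h]. *)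
Lemma polygon_transport (e : R) : 0 < e <= 1 -> exists L : 'M[R]_n, forall y,
  (1 - e) * E (x0, y *m L) <= E (gam 1, y) /\ (1 - e) * E (gam 1, y) <= E (x0, y *m L).
Proof.
move=> /andP[e0 e1]; have [D D0 HD] := step_relative e0.
have [m mD] : exists m : nat, (m.+1%:R)^-1 < D.
  exists (Num.bound D^-1); rewrite invf_plt ?posrE//.
  rewrite (lt_trans (archi_boundP _))//; first by rewrite invr_ge0 ltW.
  by rewrite ltr_nat.
pose h : R := m.+1%:R^-1.
have m0 : (0 : R) < m.+1%:R by rewrite ltr0n.
have h0 : 0 < h by rewrite invr_gt0.
have hm : m.+1%:R * h = 1 by rewrite mulfV ?gt_eqF.
have h1 : h <= 1 by rewrite invf_le1// ler1n.
have eh : 0 <= e * h <= 1.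
  by apply/andP; split; [apply: mulr_ge0; exact: ltW|apply: mulr_ile1 => //; exact: ltW].
pose a := 1 - e * h.
have a0 : 0 <= a by rewrite subr_ge0; case/andP: eh.
have ge0 t y : 0 <= t <= 1 -> 0 <= E (gam t, y).
  move=> t01; have [->|y0] := eqVneq y 0; first by rewrite E0//; exact: inU.
  by apply: ltW; apply: E_gt0; split=> //=; exact: inU.
have main k : (k <= m.+1)%N -> exists L : 'M[R]_n, forall y,
    a ^+ k * E (x0, y *m L) <= E (gam (k%:R * h), y) /\
    a ^+ k * E (gam (k%:R * h), y) <= E (x0, y *m L).
  elim: k => [_|k IH km].
    by exists 1%:M => y; rewrite mulmx1 !expr0 !mul1r mul0r scale0r addr0.
  have [L HL] := IH (ltnW km).
  (* Vectors are rows and [L] brings the fibre over the current vertex back to the fibre over [x0],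
     so the new step is the left factor. *)
  exists ((1%:M + h *: N (gam (k%:R * h))) *m L) => y; rewrite mulmxA.
  have kh0 : 0 <= k%:R * h by rewrite mulr_ge0// ltW.
  have kh1 : k%:R * h + h <= 1.
    have -> : k%:R * h + h = k.+1%:R * h by rewrite -natr1 mulrDl mul1r.
    by rewrite -[leRHS]hm; apply: ler_wpM2r; [exact: ltW|rewrite ler_nat].
  have hD : 0 <= h < D by rewrite ltW.
  have kE : k.+1%:R * h = k%:R * h + h by rewrite -natr1 mulrDl mul1r.
  have := HD _ _ kh0 hD kh1 y; rewrite kE.
  have := HL (y *m (1%:M + h *: N (gam (k%:R * h)))).
  have g0 : 0 <= E (gam (k%:R * h + h), y).
    by apply: ge0; rewrite kh1 addr_ge0// ltW.
  have ak := exprn_ge0 k a0.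
  move: (E (x0, _)) (E (gam (k%:R * h), _)) (E (gam (k%:R * h + h), y)) g0 => p q r r0 [pq qp].
  rewrite ler_norml => /andP[lo hi].
  have lo' : a * r <= q by rewrite /a; lra.
  (* The step gives an upper factor [1 + e * h], and the product of [1 - e * h] with it is at most
     1; hence [a] serves for both inequalities. *)
  have hi' : a * q <= r.
    apply: (@le_trans _ _ (a * ((1 + e * h) * r))); first by rewrite ler_wpM2l//; lra.
    rewrite mulrA ler_piMl// /a; move: eh => /andP[]; set b := e * h => b0 b1.
    rewrite -subr_ge0 (_ : _ - _ = b ^+ 2) ?sqr_ge0//; ring.
  rewrite exprS -!mulrA; split.
    by rewrite (le_trans _ hi')// ler_wpM2l.
  by rewrite mulrCA (le_trans _ qp)// ler_wpM2l.
have [L HL] := main m.+1 (leqnn _); exists L => y.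
have ea : 1 - e <= a ^+ m.+1.
  have := bernoulli_ineq m.+1 eh; rewrite mulrCA hm mulr1; exact.
have := HL y; rewrite hm => -[l1 l2].
have p0 : 0 <= E (x0, y *m L) by have := ge0 0 (y *m L); rewrite scale0r addr0 lexx ler01; exact.
have q0 : 0 <= E (gam 1, y) by apply: ge0; rewrite lexx ler01.
by split; [apply: le_trans l1|apply: le_trans l2]; rewrite ler_wpM2r.
Qed.

(** The law holds exactly for [y -> E (x0, y *m L)] because [L] is linear, and this function agrees
    with [E (gam 1, _)] up to a factor close to 1. The matrix may vary with [e]: only the values
    pass to the limit. *)
Lemma parallelogram_transport : parallelogram_law (fun y => E (x0, y)) ->
  parallelogram_law (fun y => E (gam 1, y)).
Proof.
move=> PL y z.
have U1 : U (gam 1) by apply: inU; rewrite lexx ler01.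
have g0 w : 0 <= E (gam 1, w).
  have [->|w0] := eqVneq w 0; first by rewrite E0.
  by apply: ltW; apply: E_gt0.
pose T := E (gam 1, y + z) + E (gam 1, y - z) + (2 * E (gam 1, y) + 2 * E (gam 1, z)).
have T0 : 0 <= T by rewrite !addr_ge0 ?mulr_ge0.
apply/eqP; rewrite -subr_eq0 -normr_le0; apply/ler_addgt0Pl => eps eps0; rewrite addr0.
(* The bound 1/2 gives 1 / (1 - e) <= 1 + 2 e, which underlies [dist]; the other bound makes the
   total error [2 e T] at most [eps], with [T + 1] positive even if [T] is zero. *)
pose e : R := Num.min (1 / 2) (eps / (2 * (T + 1))).
have T1 : 0 < 2 * (T + 1) by rewrite mulr_gt0// ltr_wpDl.
have e0 : 0 < e by rewrite lt_min divr_gt0//= divr_gt0.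
have e12 : e <= 1 / 2 by rewrite ge_min lexx.
have eT : e * (2 * T) <= eps.
  have : e <= eps / (2 * (T + 1)) by rewrite ge_min lexx orbT.
  rewrite ler_pdivlMr// => H; apply: le_trans H; apply: ler_wpM2l; first exact: ltW.
  by apply: ler_wpM2l => //; rewrite lerDl.
have [L HL] : exists L : 'M[R]_n, forall y,
  (1 - e) * E (x0, y *m L) <= E (gam 1, y) /\ (1 - e) * E (gam 1, y) <= E (x0, y *m L).
  by apply: polygon_transport; rewrite e0 (le_trans e12)//; lra.
have dist w : `|E (x0, w *m L) - E (gam 1, w)| <= 2 * e * E (gam 1, w).
  have [H1 H2] := HL w; move: (g0 w) H1 H2.
  move: (E (x0, w *m L)) (E (gam 1, w)) => p q q0 H1 H2.
  have p2 : p <= 2 * q by nra.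
  rewrite ler_norml; apply/andP; split; nra.
have := PL (y *m L) (z *m L); rewrite -mulmxDl -mulmxBl.
move: (dist (y + z)) (dist (y - z)) (dist y) (dist z) eT; rewrite /T.
move: (E (x0, (y + z) *m L)) (E (x0, (y - z) *m L)) (E (x0, y *m L)) (E (x0, z *m L)).
move: (E (gam 1, y + z)) (E (gam 1, y - z)) (E (gam 1, y)) (E (gam 1, z)) => a1 a2 a3 a4 b1 b2 b3 b4.
rewrite !ler_norml => /andP[? ?] /andP[? ?] /andP[? ?] /andP[? ?] ? ?.
by apply/andP; split; lra.
Qed.

End Step.
End Transport.

(** * Functions polynomial along the fibres *)

Section FibrePolynomials.
Context {R : realType} {V : normedModType R} {I : Type}.
Variables (D : I -> V) (S : set V).
Hypothesis oS : open S.
Implicit Types (f g : V -> R).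

(* Degree at most [d]: the derivatives of order [d + 1] vanish. *)
Fixpoint fibre_poly d f : Prop :=
  if d is d'.+1 then forall k, fibre_poly d' (ddir (D k) f)
  else forall k z, S z -> ddir (D k) f z = 0.

Lemma fibre_poly_eq d f g : (forall z, S z -> f z = g z) ->
  fibre_poly d f -> fibre_poly d g.
Proof.
elim: d f g => [|d IH] f g fg /= pf k.
  by move=> z Sz; rewrite -(ddir_eq_on _ oS Sz fg) pf.
by apply: IH (pf k) => z Sz; exact: ddir_eq_on oS Sz fg.
Qed.

Lemma fibre_poly0 d f : (forall z, S z -> f z = 0) -> fibre_poly d f.
Proof.
elim: d f => [|d IH] f f0 /= k; first by move=> z Sz; exact: ddir_eq0_on oS Sz f0.
by apply: IH => z Sz; exact: ddir_eq0_on oS Sz f0.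
Qed.

Lemma fibre_polyD d f g : smooth_on S f -> smooth_on S g ->
  fibre_poly d f -> fibre_poly d g -> fibre_poly d (fun z => f z + g z).
Proof.
elim: d f g => [|d IH] f g sf sg pf pg /= k.
  by move=> z Sz; rewrite (ddirD _ sf sg Sz) pf// pg// addr0.
apply: fibre_poly_eq (IH _ _ (smooth_ddir _ sf) (smooth_ddir _ sg) (pf k) (pg k)).
by move=> z Sz; rewrite (ddirD _ sf sg Sz).
Qed.

(** Leibniz' rule lowers one of the two degrees in each summand, whence the induction on [a + b]. A
    factor of degree 0 has zero derivative and its summand disappears; these cases are separate
    because no degree lies below 0. *)
Lemma fibre_polyM a b f g : smooth_on S f -> smooth_on S g ->
  fibre_poly a f -> fibre_poly b g -> fibre_poly (a + b) (fun z => f z * g z).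
Proof.
have [m] := ubnP (a + b); elim: m a b f g => // m IH a b f g abm sf sg pf pg.
have sf' k := smooth_ddir (D k) sf; have sg' k := smooth_ddir (D k) sg.
have E k z : S z -> f z * ddir (D k) g z + g z * ddir (D k) f z =
    ddir (D k) (fun z => f z * g z) z by move=> Sz; rewrite (ddirM _ sf sg Sz).
case: a b pf pg abm => [|a] [|b] pf pg abm /= k.
- by move=> z Sz; rewrite -E// pf// pg// !mulr0 addr0.
- apply: (@fibre_poly_eq _ (fun z => f z * ddir (D k) g z)).
    by move=> z Sz; rewrite -E// pf// mulr0 addr0.
  exact: (IH 0 b).
- rewrite addn0; apply: (@fibre_poly_eq _ (fun z => g z * ddir (D k) f z)).
    by move=> z Sz; rewrite -E// pg// mulr0 add0r.
  by apply: (IH 0 a) => //; rewrite add0n; move: abm; rewrite addn0.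
apply: fibre_poly_eq (E k) _; apply: fibre_polyD.
- exact: smooth_onM.
- exact: smooth_onM.
- by rewrite addnS -addSn; apply: IH => //; move: abm; rewrite addnS ltnS.
by rewrite addnC; apply: IH => //; rewrite addnC; move: abm; rewrite addSn ltnS.
Qed.

Lemma fibre_polyZ d f (c : R) : smooth_on S f -> fibre_poly d f ->
  fibre_poly d (fun z => c * f z).
Proof.
move=> sf pf; apply: (@fibre_polyM 0 d) => //; first exact: smooth_on_cst.
by move=> k z _; exact: ddir_cst.
Qed.

Lemma fibre_poly_sum d (J : finType) (f : J -> V -> R) :
  (forall i, smooth_on S (f i)) -> (forall i, fibre_poly d (f i)) ->
  fibre_poly d (fun z => \sum_i f i z).
Proof.
move=> sf pf; elim: (index_enum J) => [|i r IH].
  by apply: fibre_poly0 => z _; rewrite big_nil.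
apply: (@fibre_poly_eq _ (fun z => f i z + \sum_(j <- r) f j z)).
  by move=> z _; rewrite big_cons.
by apply: fibre_polyD => //; exact: smooth_on_sum.
Qed.

(** [v] is any direction, in particular a base direction; symmetry of second derivatives lets it
    pass through the fibre derivatives. *)
Lemma fibre_poly_ddir d f v : smooth_on S f -> fibre_poly d f ->
  fibre_poly d (ddir v f).
Proof.
elim: d f => [|d IH] f sf pf /= k.
  by move=> z Sz; rewrite (ddirC v (D k) oS Sz sf); exact: ddir_eq0_on oS Sz (pf k).
apply: fibre_poly_eq (IH _ (smooth_ddir (D k) sf) (pf k)) => z Sz.
exact: ddirC oS Sz sf.
Qed.

Lemma fibre_poly_scalar f : scalar f -> fibre_poly 1 f.
Proof.
move=> lf k; apply: (@fibre_poly_eq 0 (fun=> f (D k))) => [z _|j z _].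
  by rewrite (ddir_scalar _ _ lf).
exact: ddir_cst.
Qed.

End FibrePolynomials.

Lemma fibre_poly_comp (R : realType) (V V' : normedModType R) (I I' : Type)
    (D : I -> V) (D' : I' -> V') (S : set V) (S' : set V') (L : V -> V') d f :
  open S -> linear L -> (forall z, S z -> S' (L z)) ->
  (forall k, L (D k) = 0 \/ exists j, L (D k) = D' j) ->
  fibre_poly D' S' d f -> fibre_poly D S d (fun z => f (L z)).
Proof.
move=> oS lL LS LD; elim: d f => [|d IH] f pf /= k.
  move=> z Sz; rewrite (ddir_comp_linear _ _ _ lL); case: (LD k) => [->|[j ->]].
    by rewrite ddir0.
  by apply: pf; exact: LS.
case: (LD k) => [Lk|[j Lj]].
  by apply: fibre_poly0 => // z Sz; rewrite (ddir_comp_linear _ _ _ lL) Lk ddir0.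
apply: (fibre_poly_eq oS _ (IH _ (pf j))) => z Sz.
by rewrite (ddir_comp_linear _ _ _ lL) Lj.
Qed.

(** * Riemannian and Berwald metrics in one chart *)

Section LocalConsequences.
Context {R : realType} {n : nat}.
Local Notation V := 'rV[R]_n.
Local Notation P := (V * V)%type.
Variables (U : set V) (F : V -> V -> R).
Hypothesis lF : local_finsler U F.
Let oU : open U. Proof. by case: lF. Qed.
Let oS : open (slit U). Proof. exact: open_slit. Qed.
Local Notation S := (slit U).
Local Notation E := (unc (sqF F)).
Let sE : smooth_on S E. Proof. exact: smooth_sqF lF. Qed.
Let hE : fibre_homogeneous U 2 E. Proof. exact: homogeneous_sqF lF. Qed.
Let sG i : smooth_on S (unc (spray F i)). Proof. exact: smooth_spray lF i. Qed.

Lemma berwaldE i j k l z : berwald F i j k l z.1 z.2 =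
  ddir (vt l) (ddir (vt k) (ddir (vt j) (unc (spray F i)))) z.
Proof. by rewrite -!unc_d_fib. Qed.

Lemma local_finsler0 x : U x -> F x 0 = 0.
Proof.
case: lF => _ _ hF _ Ux; have := hF x 0 2 Ux (ltr0Sn _ _).
rewrite scaler0 => /eqP; rewrite -subr_eq0 (_ : _ - _ = - F x 0); last by ring.
by rewrite oppr_eq0 => /eqP.
Qed.

Lemma sqF0 x : U x -> sqF F x 0 = 0.
Proof. by move=> Ux; rewrite /sqF local_finsler0// expr0n. Qed.

Lemma sqF_scale x y (t : R) : U x -> 0 < t -> sqF F x (t *: y) = t ^+ 2 * sqF F x y.
Proof. by case: lF => _ _ hF _ Ux t0; rewrite /sqF hF// exprMn. Qed.

(** The third fibre derivatives of F^2 are 4 C_{ijk}, so this is the vanishing of the Cartan tensor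
    over the single point [x]. *)
Definition cubic_free x := forall y, y != 0 -> forall i j k,
  ddir (vt k) (ddir (vt j) (ddir (vt i) E)) (x, y) = 0.

Lemma fundamental_fibre x y i j :
  fundamental F x y i j = 2^-1 * ddir (delta_mx 0 j) (ddir (delta_mx 0 i) (sqF F x)) y.
Proof. by rewrite mxE /d_fib !ddirE. Qed.

Lemma smooth_sqF_fibre x : U x -> smooth_on punctured (sqF F x).
Proof. by move=> Ux; exact: (smooth_fibre Ux sE). Qed.

(** The fundamental tensor has zero fibre derivatives, hence is constant on the punctured fibre as
    [1 < n]; F^2 is then the quadratic form that it defines. *)
Lemma cubic_free_parallelogram x : (1 < n)%N -> U x -> cubic_free x ->
  parallelogram_law (sqF F x).
Proof.
move=> n1 Ux cf.
pose y0 : V := delta_mx 0 (Ordinal (ltnW n1)).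
have y00 : y0 != 0.
  apply/eqP => /matrixP/(_ 0 (Ordinal (ltnW n1)))/eqP.
  by rewrite !mxE !eqxx oner_eq0.
have gE y : y != 0 -> fundamental F x y = fundamental F x y0.
  move=> yn0; apply/matrixP => i j.
  have sg := smooth_fundamental lF i j.
  apply: (@punctured_constant _ _ (fun y => fundamental F x y i j)) => //.
    exact: (smooth_fibre Ux sg).
  move=> k w w0; rewrite (ddir_fibre (fun z => fundamental F z.1 z.2 i j)).
  have Sw : S (x, w) by [].
  rewrite (ddir_eq_on _ oS Sw (fun z _ => fundamentalE F i j z)).
  rewrite (ddirZ _ _ _ Sw); last by do 2 apply: smooth_ddir.
  by rewrite cf// mulr0.
have q y : sqF F x y = \sum_i \sum_j fundamental F x y0 i j * y 0 i * y 0 j.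
  have [->|yn0] := eqVneq y 0.
    rewrite sqF0// big1// => i _; rewrite big1// => j _.
    by rewrite !mxE mulr0.
  by rewrite -(gE y yn0); exact: (sqF_quadratic lF (z := (x, y))).
move=> y z; rewrite !q !mulr_sumr -!big_split /=; apply: eq_bigr => i _.
rewrite !mulr_sumr -!big_split /=; apply: eq_bigr => j _.
by rewrite !mxE; ring.
Qed.

Lemma parallelogram_fundamental x y y' : U x -> parallelogram_law (sqF F x) ->
  y != 0 -> y' != 0 -> fundamental F x y = fundamental F x y'.
Proof.
move=> Ux PL y0 y'0; apply/matrixP => i j; apply: (etrans (fundamental_fibre x y i j)).
apply: (etrans _ (esym (fundamental_fibre x y' i j))).
congr (_ * _); apply: parallelogram_hessian => //; first exact: smooth_sqF_fibre.
by move=> t w t0; exact: sqF_scale.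
Qed.

(** Over each point the second fibre derivatives of the spray do not depend on the vector: they are
    the coefficients of the Berwald connection. Euler's identity recovers the first derivatives from
    them linearly in y, so [spray_horizontal] contracted with [d] becomes the linear transport
    equation with matrix [N]. *)
Lemma berwald_parallelogram x0 x1 : (1 < n)%N -> berwald_vanishes_on S F ->
  (forall t : R, 0 <= t <= 1 -> U (x0 + t *: (x1 - x0))) ->
  parallelogram_law (sqF F x0) -> parallelogram_law (sqF F x1).
Proof.
move=> n1 BF inU PL; pose d := x1 - x0.
pose y0 : V := delta_mx 0 (Ordinal (ltnW n1)).
have y00 : y0 != 0.
  apply/eqP => /matrixP/(_ 0 (Ordinal (ltnW n1)))/eqP.
  by rewrite !mxE !eqxx oner_eq0.
pose G2 i l m := ddir (vt l) (ddir (vt m) (unc (spray F i))).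
have sG2 i l m : smooth_on S (G2 i l m) by do 2 apply: smooth_ddir.
(* The connection coefficients contracted with [d]; [y0] is an arbitrary vector at which to evaluate
   them. *)
pose N x : 'M[R]_n := \matrix_(l, i) \sum_m d 0 m * G2 i l m (x, y0).
have G2E i l m x y : U x -> y != 0 -> G2 i l m (x, y) = G2 i l m (x, y0).
  move=> Ux yn0; apply: (@punctured_constant _ _ (fun y => G2 i l m (x, y))) => //.
    exact: (smooth_fibre Ux (sG2 i l m)).
  move=> k w w0; rewrite (ddir_fibre (G2 i l m)).
  have Sw : S (x, w) by [].
  by have := BF (x, w) Sw i m l k; rewrite berwaldE.
have h1 i m : fibre_homogeneous U 1 (ddir (vt m) (unc (spray F i))).
  by apply: fibre_homogeneous_vt => //; exact: homogeneous_spray.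
have x1E : x1 = x0 + (1 : R) *: d by rewrite scale1r addrC subrK.
rewrite x1E; apply: (@parallelogram_transport _ _ U E x0 d N) => //.
- by move=> x Ux; exact: sqF0.
- by move=> x y t Ux t0; exact: sqF_scale.
- by move=> z Sz; exact: (sqF_gt0 lF Sz).
- move=> i j x Ux; rewrite (_ : (fun x => _) = fun x => \sum_m d 0 m * G2 j i m (x, y0)).
    apply: continuous_sum => m.
    suff c : {for x, continuous (fun x => G2 j i m (x, y0))}.
      exact: (@cvgMl_tmp R V (nbhs x) _ _ (d 0 m) _ c).
    apply: (@continuous_comp V P R (fun x => (x, y0)) (G2 j i m) x).
      apply: (@cvg_pair V V V (nbhs x) (nbhs x) (nbhs y0) _ _ _ id (fun=> y0)).
        exact: cvg_id.
      exact: cvg_cst.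
    exact: smooth_on_continuous (sG2 j i m) _.
  by apply/funext => x'; rewrite mxE.
move=> z Sz; rewrite (ddir_vertical _ oS Sz sE) (ddir_horizontal _ oS Sz sE).
transitivity (\sum_m \sum_i d 0 m * (ddir (vt m) (unc (spray F i)) z * ddir (vt i) E z)).
  by apply: eq_bigr => m _; rewrite -(spray_horizontal lF m Sz) mulr_sumr.
rewrite exchange_big /=; apply: eq_bigr => i _.
have Em m : ddir (vt m) (unc (spray F i)) z = \sum_l z.2 0 l * G2 i l m (z.1, y0).
  rewrite -[LHS]mul1r -(euler_identity oU (smooth_ddir _ (sG i)) (h1 i m) Sz).
  apply: eq_bigr => l _; congr (_ * _); case: z Sz => x y [Ux yn0] /=.
  exact: G2E.
rewrite mxE mulr_suml; under eq_bigr do rewrite Em mulr_suml mulr_sumr.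
rewrite exchange_big /=; apply: eq_bigr => l _.
by rewrite mxE mulr_sumr mulr_suml; apply: eq_bigr => m _; ring.
Qed.

Definition locally_riemannian := forall x, U x -> forall y y' : V,
  connected_component punctured y y' -> fundamental F x y = fundamental F x y'.

Lemma connected_component_ball (y y' : V) (r : R) : ball y r `<=` punctured ->
  0 < r -> ball y r y' -> connected_component punctured y y'.
Proof.
move=> br r0 yy'; exists ((fun s : R => y + s *: (y' - y)) @` `[0, 1]%classic); last first.
  by exists 1; [rewrite /= in_itv /= lexx ler01|rewrite scale1r addrC subrK].
split; first by exists 0; [rewrite /= in_itv /= lexx ler01|rewrite scale0r addr0].
  move=> w [s /=]; rewrite in_itv /= => /andP[s0 s1] <-; apply: br.
  rewrite -ball_normE /= opprD addrA subrr add0r normrN normrZ (ger0_norm s0).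
  move: yy'; rewrite -ball_normE /= distrC; apply: le_lt_trans.
  by rewrite ler_piMl.
apply: connected_continuous_connected; first exact: segment_connected.
apply: continuous_subspaceT => s.
exact: (cvgD (cvg_cst y) (@cvgZr_tmp _ _ _ _ _ _ _ (y' - y) cvg_id)).
Qed.

(** A ball inside the punctured space is convex and so lies in one component. Constancy on
    components thus becomes local constancy, which is what fibre derivatives detect, in dimension
    one as well. *)
Lemma locally_riemannian_near x y : locally_riemannian -> U x -> y != 0 ->
  exists2 W : set V, open W /\ W y & forall y', W y' -> fundamental F x y' = fundamental F x y.
Proof.
move=> rF Ux y0.
have /nbhs_ballP[r /= r0 br] := open_near (@open_punctured R n) y0.
exists (ball y r); first by split; [exact: ball_open|exact: ballxx].
by move=> y' yy'; apply/esym/rF => //; exact: connected_component_ball yy'.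
Qed.

Lemma riemannian_fundamental_poly i j : locally_riemannian ->
  fibre_poly vt S 0 (fun z => fundamental F z.1 z.2 i j).
Proof.
move=> rF k [x y] [/= Ux y0]; have [W [oW Wy] WE] := locally_riemannian_near rF Ux y0.
rewrite -(ddir_fibre (fun z => fundamental F z.1 z.2 i j)).
apply: (etrans (@ddir_eq_on _ _ W _ (fun=> fundamental F x y i j) _ _ oW Wy _)
  (ddir_cst _ _ _)) => y' /WE e.
exact: (congr1 (fun M : 'M[R]_n => M i j) e).
Qed.

Lemma riemannian_inv_fundamental_poly i j : locally_riemannian ->
  fibre_poly vt S 0 (fun z => inv_fundamental F z.1 z.2 i j).
Proof.
move=> rF k [x y] [/= Ux y0]; have [W [oW Wy] WE] := locally_riemannian_near rF Ux y0.
rewrite -(ddir_fibre (fun z => inv_fundamental F z.1 z.2 i j)).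
apply: (etrans (@ddir_eq_on _ _ W _ (fun=> inv_fundamental F x y i j) _ _ oW Wy _)
  (ddir_cst _ _ _)) => y' /WE e.
exact: (congr1 (fun M : 'M[R]_n => invmx M i j) e).
Qed.

Lemma riemannian_sqF_poly : locally_riemannian -> fibre_poly vt S 2 E.
Proof.
move=> rF i j.
apply: (@fibre_poly_eq _ _ _ vt S oS 0 (fun z => 2 * fundamental F z.1 z.2 i j)).
  by move=> z Sz; rewrite fundamentalE mulrA mulfV ?mul1r// pnatr_eq0.
apply: fibre_polyZ => //; first exact: smooth_fundamental lF i j.
exact: riemannian_fundamental_poly.
Qed.

(** The inverse tensor has degree 0 and F^2 degree 2; a mixed derivative of F^2 has degree 1 and is
    multiplied by a coordinate of y. Base derivatives do not raise the degree. *)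
Lemma riemannian_spray_poly i : locally_riemannian ->
  fibre_poly vt S 2 (unc (spray F i)).
Proof.
move=> rF; have pE := riemannian_sqF_poly rF.
apply: (@fibre_poly_eq _ _ _ vt S oS 2 (fun z => 4^-1 * \sum_l
   inv_fundamental F z.1 z.2 i l * spray_rhs F l z)).
  by move=> z _; rewrite [RHS]sprayE.
have sI l := smooth_inv_fundamental lF i l.
have sr l := smooth_spray_rhs lF l.
have sp l : smooth_on S (fun z => inv_fundamental F z.1 z.2 i l * spray_rhs F l z).
  exact: smooth_onM.
apply: fibre_polyZ => //; first exact: smooth_on_sum.
apply: fibre_poly_sum => // l; apply: (fibre_polyM oS (a := 0) (b := 2)) => //.
  exact: riemannian_inv_fundamental_poly.
have sX k : smooth_on S (fun z : P => ddir (hz k) (ddir (vt l) E) z * z.2 0 k).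
  by apply: smooth_onM => //; [do 2 apply: smooth_ddir|exact: smooth_snd_coord].
apply: (fibre_poly_eq oS (f := fun z => (\sum_k ddir (hz k) (ddir (vt l) E) z * z.2 0 k)
   + -1 * ddir (hz l) E z)).
  by move=> z _; rewrite mulN1r.
apply: fibre_polyD => //; first exact: smooth_on_sum.
- by apply: smooth_onZ => //; exact: smooth_ddir.
- apply: fibre_poly_sum => // k; apply: (fibre_polyM oS (a := 1) (b := 1)).
  + by do 2 apply: smooth_ddir.
  + exact: smooth_snd_coord.
  + by apply: fibre_poly_ddir => //; exact: smooth_ddir.
  + by apply: fibre_poly_scalar => //; exact: scalar_snd_coord.
apply: fibre_polyZ => //; first exact: smooth_ddir.
exact: fibre_poly_ddir.
Qed.

Lemma riemannian_berwald : locally_riemannian -> berwald_vanishes_on S F.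
Proof.
move=> rF z Sz i j k l; rewrite berwaldE.
exact: (riemannian_spray_poly i rF j k l Sz).
Qed.

End LocalConsequences.

(** * Berwald metrics on connected manifolds *)

Section VectorValued.
Context {R : realType} {V : normedModType R} {m : nat}.

Lemma Ck_on_coord k (U : set V) (f : V -> 'rV[R]_m) j : open U -> Ck_on k U f ->
  Ck_on k U (fun z => f z 0 j).
Proof.
move=> oU; elim: k f => [|k IH] f [cf df].
  split=> // x Ux; apply: (@continuous_comp _ _ _ f (fun y : 'rV[R]_m => y 0 j)).
    exact: cf.
  exact: coord_continuous.
split=> [x Ux|v].
  apply: (@continuous_comp _ _ _ f (fun y : 'rV[R]_m => y 0 j)); first exact: cf.
  exact: coord_continuous.
have [dv Cv] := df v; split=> [x Ux|].
  by have /derivable_mxP := dv x Ux; exact.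
apply: Ck_on_eq (IH _ Cv) => // z Uz.
by rewrite derive_mx ?mxE//; exact: dv.
Qed.

(** With the next lemma, this is the part of the linearity of the differential of a transition map
    that the parallelogram law uses: sums and differences. *)
Lemma derive_row_additive (U : set V) (f : V -> 'rV[R]_m) x v w :
  open U -> U x -> smooth_on U f -> 'D_(v + w) f x = 'D_v f x + 'D_w f x.
Proof.
move=> oU Ux sf; have dv u : derivable f x u by exact: smooth_on_derivable sf Ux.
apply/rowP => j; rewrite !derive_mx// !mxE.
have sj : smooth_on U (fun z => f z 0 j) by move=> k; exact: Ck_on_coord.
have := ddir_dir_linear 1 v w oU Ux sj; rewrite scale1r mul1r !ddirE.
exact.
Qed.

Lemma derive_rowN (U : set V) (f : V -> 'rV[R]_m) x v :
  U x -> smooth_on U f -> 'D_(- v) f x = - 'D_v f x.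
Proof.
move=> Ux sf; have dv u : derivable f x u by exact: smooth_on_derivable sf Ux.
apply/rowP => j; rewrite !derive_mx// !mxE.
have dj : derivable (fun z => f z 0 j) x v by have /derivable_mxP := dv v; exact.
by have [_] := derive_dirZ (-1) dj; rewrite scaleN1r mulN1r.
Qed.

End VectorValued.

Section GlobalFinsler.
Context {R : realType} {n : nat} {M : smooth_manifold R n}.
Implicit Types (F : finsler_metric M) (c : chart_idx M) (p : M).

Lemma finsler_local F c : local_finsler (chart_im c) (F c).
Proof.
split.
- exact: chart_im_open.
- exact: fm_smooth.
- by move=> x y t Ux t0; exact: fm_homogeneous.
- by move=> x y Ux y0; exact: fm_posdef.
Qed.

Lemma transition_nbhs c c' p : chart_dom c p -> chart_dom c' p ->
  nbhs (chart c p) (chart c @` (chart_dom c `&` chart_dom c')).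
Proof.
move=> cp c'p.
have n1 : nbhs (chart c p) (chart_inv c @^-1` chart_dom c').
  apply: (chart_inv_continuous cp); rewrite chartK//.
  by apply: open_nbhs_nbhs; split=> //; exact: chart_dom_open.
have n2 : nbhs (chart c p) (chart_im c).
  by apply: open_nbhs_nbhs; split; [exact: chart_im_open|exists p].
apply: filterS (filterI n1 n2) => w [/= w1 [q cq qw]].
by exists q => //; split=> //; move: w1; rewrite -qw chartK.
Qed.

(** By [fm_compat] the two expressions of F over [p] differ by the differential of the transition
    map, which respects sums and differences. *)
Lemma chart_change_parallelogram F c c' p : chart_dom c p -> chart_dom c' p ->
  parallelogram_law (sqF (F c) (chart c p)) ->
  parallelogram_law (sqF (F c') (chart c' p)).
Proof.
move=> cp c'p PL.
pose psi := chart c \o chart_inv c'; pose x := chart c' p.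
(* The rules of calculus are stated on open sets; the interior still contains [x] by
   [transition_nbhs]. *)
pose U := interior (chart c' @` (chart_dom c' `&` chart_dom c)).
have oU : open U by exact: open_interior.
have Ux : U x by exact: transition_nbhs.
have sU : smooth_on U psi.
  by apply: smooth_on_subset (transition_smooth c' c); exact: interior_subset.
have E y : sqF (F c') x y = sqF (F c) (chart c p) ('D_y psi x).
  by rewrite /sqF -(fm_compat F y c'p cp).
move=> y z; rewrite -/x !E (derive_row_additive _ _ oU Ux sU).
by rewrite (derive_row_additive y (- z) oU Ux sU) (derive_rowN z Ux sU).
Qed.

(** In a small ball of the chart the segment between the two points can be followed both ways, which
    gives an equivalence. *)
Lemma chart_parallelogram_local F c p : (1 < n)%N -> berwaldian F -> chart_dom c p ->
  \forall q \near p, chart_dom c q /\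
    (parallelogram_law (sqF (F c) (chart c p)) <-> parallelogram_law (sqF (F c) (chart c q))).
Proof.
move=> n1 BF cp; pose x := chart c p.
have Ux : chart_im c x by exists p.
have /nbhs_ballP[r /= r0 br] := open_near (chart_im_open (c := c)) Ux.
have nb : nbhs p (chart c @^-1` ball x r).
  by apply: (chart_continuous cp); exact: nbhsx_ballx.
have nd : nbhs p (chart_dom c).
  by apply: open_nbhs_nbhs; split=> //; exact: chart_dom_open.
have seg a b : ball x r a -> ball x r b -> forall t : R, 0 <= t <= 1 ->
    chart_im c (a + t *: (b - a)).
  move=> xa xb t /andP[t0 t1]; apply: br; move: xa xb; rewrite -!ball_normE /= => xa xb.
  have -> : x - (a + t *: (b - a)) = (1 - t) *: (x - a) + t *: (x - b).
    by apply/rowP => k; rewrite !mxE; ring.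
  rewrite (le_lt_trans (ler_normD _ _))// !normrZ (ger0_norm t0) ger0_norm ?subr_ge0//.
  have -> : r = (1 - t) * r + t * r by rewrite -mulrDl subrK mul1r.
  have [->|tn0] := eqVneq t 0; first by rewrite subr0 !mul1r !mul0r !addr0.
  apply: ler_ltD; first by rewrite ler_wpM2l ?subr_ge0// ltW.
  by rewrite ltr_pM2l// lt_def tn0.
apply: filterS (filterI nb nd) => q [/= xq cq]; split=> //.
have bx : ball x r x by exact: ballxx.
by split; apply: (berwald_parallelogram (finsler_local F c) n1 (BF c)); exact: seg.
Qed.

Lemma berwald_parallelogram_global F : (1 < n)%N -> berwaldian F ->
  (exists c x, chart_im c x /\ parallelogram_law (sqF (F c) x)) ->
  forall c x, chart_im c x -> parallelogram_law (sqF (F c) x).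
Proof.
move=> n1 BF [c0 [x0 [[p0 cp0 px0] PL0]]].
(* All charts at [p] are included, so that the set does not depend on a choice; by [A1] a single
   chart suffices for membership. The local equivalence makes both [A] and its complement open. *)
pose A := [set p : M | forall c, chart_dom c p -> parallelogram_law (sqF (F c) (chart c p))].
have A1 p c : chart_dom c p -> parallelogram_law (sqF (F c) (chart c p)) -> A p.
  by move=> cp PL c' c'p; exact: chart_change_parallelogram PL.
have An p : \forall q \near p, A p <-> A q.
  have [c cp] := chart_cover p.
  apply: filterS (chart_parallelogram_local n1 BF cp) => q [cq pq].
  split=> [Ap|Aq]; first by apply: (A1 q c) => //; apply/pq; exact: Ap.
  by apply: (A1 p c) => //; apply/pq; exact: Aq.
have oA : open A.
  rewrite openE => p Ap; rewrite /interior; apply: filterS (An p) => q pq.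
  exact/pq.
have cA : closed A.
  rewrite -openC openE => p nAp; rewrite /interior; apply: filterS (An p) => q pq Aq.
  by apply: nAp; apply/pq.
have AT : A = setT.
  apply: (m_connected (s := M)).
  - by exists p0; apply: (A1 p0 c0) => //; rewrite px0.
  - by exists A => //; rewrite setTI.
  - by exists A => //; rewrite setTI.
move=> c _ [p cp <-].
have Ap : A p by rewrite AT.
exact: Ap.
Qed.

Lemma connected_component_punctured (y y' : 'rV[R]_n) :
  connected_component [set w : 'rV[R]_n | w != 0] y y' -> y != 0 /\ y' != 0.
Proof. by move=> [C [Cy CA _] Cy']; split; exact: CA. Qed.

Lemma berwald_riemannian_point F : (1 < n)%N -> berwaldian F ->
  (exists c x, chart_im c x /\ parallelogram_law (sqF (F c) x)) -> riemannian F.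
Proof.
move=> n1 BF PL0 c x cx y y' /connected_component_punctured[y0 y'0].
apply: (parallelogram_fundamental (finsler_local F c)) => //.
exact: berwald_parallelogram_global.
Qed.

End GlobalFinsler.

(** The coordinate maps a connected set containing both vectors onto an interval that misses 0. *)
Lemma connected_component_line (R : realType) (y y' : 'rV[R]_1) :
  connected_component [set w : 'rV[R]_1 | w != 0] y y' -> 0 < y 0 0 * y' 0 0.
Proof.
move=> [C [Cy CA cC] Cy'].
have nz (w : 'rV[R]_1) : C w -> w 0 0 != 0.
  move=> /CA /= /eqP w0; apply/eqP => w00; apply: w0.
  by apply/matrixP => i j; rewrite !ord1 mxE.
pose D := (fun w : 'rV[R]_1 => w 0 0) @` C.
have /connected_intervalP iD : connected D.
  apply: connected_continuous_connected => //.
  by apply: continuous_subspaceT => w; exact: coord_continuous.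
have Dn0 : ~ D 0 by move=> [w /nz] /eqP.
have Dy : D (y 0 0) by exists y.
have Dy' : D (y' 0 0) by exists y'.
have := nz _ Cy; have := nz _ Cy'; rewrite !neq_lt => /orP[a|a] /orP[b|b].
- by rewrite nmulr_rgt0.
- by exfalso; apply: Dn0; apply: (iD _ _ Dy' Dy); rewrite !ltW.
- by exfalso; apply: Dn0; apply: (iD _ _ Dy Dy'); rewrite !ltW.
- by rewrite mulr_gt0.
Qed.

Lemma riemannian_dim1 (R : realType) (M : smooth_manifold R 1) (F : finsler_metric M) :
  riemannian F.
Proof.
move=> c x cx y y' yy'; have := connected_component_line yy'.
have [y0 y'0] := connected_component_punctured yy'.
set a := y 0 0; set b := y' 0 0 => ab.
have a0 : a != 0 by apply: contraTneq ab => ->; rewrite mul0r ltxx.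
have t0 : 0 < b / a.
  have -> : b / a = (a * b) / a ^+ 2 by field.
  by rewrite divr_gt0// exprn_even_gt0.
have yE : y' = (b / a) *: y.
  by apply/matrixP => i j; rewrite !ord1 !mxE -/a -/b divfK.
rewrite yE; apply/matrixP => i j; apply/esym.
have := homogeneous_fundamental (finsler_local F c) i j (z := (x, y)) (conj cx y0) t0.
by rewrite expr0 mul1r.
Qed.

(** * Rescaling a Finsler metric by a positive function *)

Section Conformal.
Context {R : realType} {n : nat} {M : smooth_manifold R n}.
Variables (F : finsler_metric M) (phi : M -> R).
Hypothesis phi_gt0 : forall p, 0 < phi p.
Hypothesis phi_smooth : forall c : chart_idx M,
  smooth_on (chart_im c) (fun x => phi (chart_inv c x)).

(** With x in M_1 frozen, f(x, .) is a function on the whole of M_2, so f(x, .) F_2 becomes a metric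
    on M_2 to which the global result on Berwald metrics applies. *)
Definition conformal_fm (c : chart_idx M) (x y : 'rV[R]_n) : R :=
  phi (chart_inv c x) * F c x y.

Lemma sqF_conformal c x y :
  sqF (conformal_fm c) x y = phi (chart_inv c x) ^+ 2 * sqF (F c) x y.
Proof. by rewrite /sqF /conformal_fm exprMn. Qed.

Lemma fundamental_conformal c x y : chart_im c x -> y != 0 ->
  fundamental (conformal_fm c) x y =
  phi (chart_inv c x) ^+ 2 *: fundamental (F c) x y.
Proof.
move=> cx y0; apply/matrixP => i j; rewrite [RHS]mxE.
apply: (etrans (fundamental_fibre _ x y i j)).
rewrite [in RHS](fundamental_fibre (F c) x y i j).
have -> : sqF (conformal_fm c) x = fun y => phi (chart_inv c x) ^+ 2 * sqF (F c) x y.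
  by apply/funext => w; exact: sqF_conformal.
have sE := smooth_sqF_fibre (finsler_local F c) cx.
have oP := @open_punctured R n.
rewrite (ddir_eq_on _ oP y0 (fun w w0 => ddirZ (delta_mx 0 i) (phi (chart_inv c x) ^+ 2) sE w0)).
by rewrite (ddirZ _ _ (smooth_ddir _ sE) y0) mulrCA.
Qed.

Lemma conformal_compat (c c' : chart_idx M) (p : M) (y : 'rV[R]_n) :
  chart_dom c p -> chart_dom c' p ->
  conformal_fm c' (chart c' p) ('D_y (chart c' \o chart_inv c) (chart c p)) =
  conformal_fm c (chart c p) y.
Proof. by move=> cp c'p; rewrite /conformal_fm !chartK// fm_compat. Qed.

Lemma conformal_ge0 (c : chart_idx M) x y : chart_im c x -> 0 <= conformal_fm c x y.
Proof. by move=> cx; apply: mulr_ge0; [exact: ltW|exact: fm_ge0]. Qed.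

Lemma conformal_smooth (c : chart_idx M) : smooth_on (slit_bundle c)
  (fun z : 'rV[R]_n * 'rV[R]_n => conformal_fm c z.1 z.2).
Proof.
have oS : open (slit_bundle c) by exact: (open_slit (chart_im_open (c := c))).
apply: smooth_onM => //; last exact: fm_smooth.
apply: (@smooth_on_comp_linear _ _ _ _ fst _ (chart_im c) (fun x => phi (chart_inv c x))) => //.
  by move=> z; exact: cvg_fst.
by move=> z [].
Qed.

Lemma conformal_homogeneous (c : chart_idx M) x y (t : R) : chart_im c x -> 0 < t ->
  conformal_fm c x (t *: y) = t * conformal_fm c x y.
Proof. by move=> cx t0; rewrite /conformal_fm fm_homogeneous// mulrCA. Qed.

Lemma conformal_posdef (c : chart_idx M) x y : chart_im c x -> y != 0 ->
  forall w : 'rV[R]_n, w != 0 ->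
  0 < \sum_i \sum_j fundamental (conformal_fm c) x y i j * w 0 i * w 0 j.
Proof.
move=> cx y0 w w0; rewrite fundamental_conformal//.
have -> : \sum_i \sum_j (phi (chart_inv c x) ^+ 2 *: fundamental (F c) x y) i j * w 0 i * w 0 j
    = phi (chart_inv c x) ^+ 2 * \sum_i \sum_j fundamental (F c) x y i j * w 0 i * w 0 j.
  rewrite mulr_sumr; apply: eq_bigr => i _; rewrite mulr_sumr; apply: eq_bigr => j _.
  by rewrite [in LHS]mxE !mulrA.
by apply: mulr_gt0; [exact: exprn_gt0|exact: fm_posdef].
Qed.

Definition conformal : finsler_metric M :=
  FinslerMetric conformal_compat conformal_ge0 conformal_smooth
    conformal_homogeneous conformal_posdef.

Lemma riemannian_conformal : riemannian conformal <-> riemannian F.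
Proof.
split=> rF c x cx y y' yy'; have [y0 y'0] := connected_component_punctured yy'.
  have s0 : phi (chart_inv c x) ^+ 2 != 0 by rewrite expf_neq0// gt_eqF.
  apply: (scalerI s0); apply: (etrans (esym (fundamental_conformal cx y0))).
  exact: (etrans (rF c x cx y y' yy') (fundamental_conformal cx y'0)).
apply: (etrans (fundamental_conformal cx y0)).
apply: (etrans _ (esym (fundamental_conformal cx y'0))).
by rewrite (rF c x cx y y' yy').
Qed.

Lemma parallelogram_conformal c x : parallelogram_law (sqF (F c) x) ->
  parallelogram_law (sqF (conformal c) x).
Proof. by move=> PL y z; rewrite !sqF_conformal -mulrDr PL; ring. Qed.

End Conformal.

(** * The twisted product *)

Section LocalTwistedProduct.
Context {R : realType} {n1 n2 : nat}.
Local Notation V1 := 'rV[R]_n1.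
Local Notation V2 := 'rV[R]_n2.
Local Notation V := 'rV[R]_(n1 + n2).
Local Notation P1 := (V1 * V1)%type.
Local Notation P2 := (V2 * V2)%type.
Local Notation P := (V * V)%type.
Variables (U1 : set V1) (U2 : set V2) (A1 : V1 -> V1 -> R) (A2 : V2 -> V2 -> R).
Variable phi : V1 -> V2 -> R.

(** The expression of [twisted_metric] in one pair of charts, f being replaced by a function [phi]
    of the coordinates. *)
Definition local_twisted (z w : V) : R :=
  Num.sqrt (A1 (lsubmx z) (lsubmx w) ^+ 2 +
    phi (lsubmx z) (rsubmx z) ^+ 2 * A2 (rsubmx z) (rsubmx w) ^+ 2).

Definition local_conformal (x : V1) (u v : V2) : R := phi x u * A2 u v.

Hypothesis lA1 : local_finsler U1 A1.
Hypothesis lA2 : local_finsler U2 A2.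
Hypothesis lC : forall x, U1 x -> local_finsler U2 (local_conformal x).
Hypothesis phi_gt0 : forall x u, U1 x -> U2 u -> 0 < phi x u.
Hypothesis phi_smooth : forall u, U2 u -> smooth_on U1 (fun x => phi x u).

Let oU1 : open U1. Proof. by case: lA1. Qed.
Let oU2 : open U2. Proof. by case: lA2. Qed.
Let oS1 : open (slit U1). Proof. exact: open_slit. Qed.
Let oS2 : open (slit U2). Proof. exact: open_slit. Qed.
Local Notation T := local_twisted.
Local Notation C := local_conformal.
Local Notation Et := (unc (sqF T)).
Local Notation E1 := (unc (sqF A1)).
Local Notation E2 := (unc (sqF A2)).
Let sE1 : smooth_on (slit U1) E1. Proof. exact: smooth_sqF lA1. Qed.
Let sE2 : smooth_on (slit U2) E2. Proof. exact: smooth_sqF lA2. Qed.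
Let sEC x : U1 x -> smooth_on (slit U2) (unc (sqF (C x))).
Proof. by move=> Ux; exact: smooth_sqF (lC Ux). Qed.

Let pt (x : V1) (u : V2) (y : V1) (v : V2) : P := (row_mx x u, row_mx y v).
Let inj1 (D : P1) : P := (row_mx D.1 0, row_mx D.2 0).
Let inj2 (D : P2) : P := (row_mx 0 D.1, row_mx 0 D.2).

Let vt_l j : vt (lshift n2 j) = inj1 (vt j) :> P.
Proof. by rewrite /vt /inj1 /= delta_mx_lshift row_mx0. Qed.
Let hz_l j : hz (lshift n2 j) = inj1 (hz j) :> P.
Proof. by rewrite /hz /inj1 /= delta_mx_lshift row_mx0. Qed.
Let vt_r j : vt (rshift n1 j) = inj2 (vt j) :> P.
Proof. by rewrite /vt /inj2 /= delta_mx_rshift row_mx0. Qed.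
Let hz_r j : hz (rshift n1 j) = inj2 (hz j) :> P.
Proof. by rewrite /hz /inj2 /= delta_mx_rshift row_mx0. Qed.

Let ddir_inj1 (G : P -> R) D x u y v :
  ddir (inj1 D) G (pt x u y v) = ddir D (fun q : P1 => G (pt q.1 u q.2 v)) (x, y).
Proof.
rewrite (@ddir_comp_affine _ _ _ (fun q : P1 => pt q.1 u q.2 v) inj1)// => h a b.
rewrite /pt /inj1 [RHS]/GRing.add /= /add_pair /= !scale_row_mx !add_row_mx.
by rewrite !scaler0 !add0r.
Qed.

Let ddir_inj2 (G : P -> R) D x u y v :
  ddir (inj2 D) G (pt x u y v) = ddir D (fun q : P2 => G (pt x q.1 y q.2)) (u, v).
Proof.
rewrite (@ddir_comp_affine _ _ _ (fun q : P2 => pt x q.1 y q.2) inj2)// => h a b.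
rewrite /pt /inj2 [RHS]/GRing.add /= /add_pair /= !scale_row_mx !add_row_mx.
by rewrite !scaler0 !add0r.
Qed.

Let Et_pt x u y v : Et (pt x u y v) = E1 (x, y) + phi x u ^+ 2 * E2 (u, v).
Proof.
rewrite /unc /sqF /T /= !row_mxKl !row_mxKr sqr_sqrtr//.
by apply: addr_ge0; [exact: sqr_ge0|apply: mulr_ge0; exact: sqr_ge0].
Qed.

Let EC_E x q : unc (sqF (C x)) q = phi x q.1 ^+ 2 * E2 q.
Proof. by rewrite /unc /sqF /C exprMn. Qed.

Definition d_warp2 k x u : R := ddir (delta_mx 0 k) (fun x => phi x u ^+ 2) x.

Let sphi2 u : U2 u -> smooth_on U1 (fun x => phi x u ^+ 2).
Proof. by move=> Uu; exact: smooth_onX 2 oU1 (phi_smooth Uu). Qed.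

Let sphi_fst u : U2 u -> smooth_on (slit U1) (fun q : P1 => phi q.1 u ^+ 2).
Proof.
move=> Uu; apply: (@smooth_on_comp_linear _ _ _ _ fst _ U1 (fun x => phi x u ^+ 2)) => //.
- by move=> z; exact: cvg_fst.
- by move=> z [].
exact: sphi2.
Qed.

Let ddir_phi_fst u D q : ddir D (fun q : P1 => phi q.1 u ^+ 2) q =
  ddir D.1 (fun x => phi x u ^+ 2) q.1.
Proof. exact: (@ddir_comp_linear _ _ _ fst (fun x => phi x u ^+ 2)). Qed.

Section At.
Variables (x : V1) (u : V2) (y : V1) (v : V2).
Hypotheses (Ux : U1 x) (Uu : U2 u) (y0 : y != 0) (v0 : v != 0).
Let S1 : slit U1 (x, y). Proof. by []. Qed.
Let S2 : slit U2 (u, v). Proof. by []. Qed.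

Lemma ddir_l D : ddir (inj1 D) Et (pt x u y v) =
  ddir D E1 (x, y) + E2 (u, v) * ddir D.1 (fun x => phi x u ^+ 2) x.
Proof.
rewrite ddir_inj1.
rewrite (_ : (fun q => _) = fun q => E1 q + E2 (u, v) * phi q.1 u ^+ 2); last first.
  by apply/funext => -[x' y']; rewrite Et_pt [_ ^+ 2 * _]mulrC.
have s2 := smooth_onZ (E2 (u, v)) oS1 (sphi_fst Uu).
by rewrite (ddirD _ sE1 s2 S1) (ddirZ _ _ (sphi_fst Uu) S1) ddir_phi_fst.
Qed.

Lemma ddir_r D : ddir (inj2 D) Et (pt x u y v) = ddir D (unc (sqF (C x))) (u, v).
Proof.
rewrite ddir_inj2.
rewrite (_ : (fun q => _) = fun q => E1 (x, y) + unc (sqF (C x)) q); last first.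
  by apply/funext => -[u' v']; rewrite Et_pt EC_E.
by rewrite (ddirD _ (smooth_on_cst _ _) (sEC Ux) S2) ddir_cst add0r.
Qed.

Lemma ddir_C_vt a : ddir (vt a) (unc (sqF (C x))) (u, v) =
  phi x u ^+ 2 * ddir (vt a) E2 (u, v).
Proof.
rewrite -!(ddir_fibre _ u (delta_mx 0 a)).
rewrite (_ : (fun q => _) = fun q => phi x u ^+ 2 * E2 (u, q)); last first.
  by apply/funext => q; rewrite EC_E.
have so := smooth_fibre Uu sE2.
by rewrite (ddirZ _ _ so v0).
Qed.

End At.

Section At2.
Variables (x : V1) (u : V2) (y : V1) (v : V2).
Hypotheses (Ux : U1 x) (Uu : U2 u) (y0 : y != 0) (v0 : v != 0).
Let S1 : slit U1 (x, y). Proof. by []. Qed.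
Let S2 : slit U2 (u, v). Proof. by []. Qed.

(** The two terms of E_1 + phi^2 E_2 interact only through phi, which does not depend on the fibre
    coordinates. After a first derivative along the fibre, the only cross term left is that of
    [ddir_lr], and it vanishes unless the outer direction moves the base point. Hence the block form
    of g below. *)
Lemma ddir_ll D j : ddir (inj1 D) (ddir (inj1 (vt j)) Et) (pt x u y v) =
  ddir D (ddir (vt j) E1) (x, y).
Proof.
rewrite ddir_inj1; apply: (ddir_eq_on _ oS1 S1) => -[x' y'] [/= Ux' y'0].
by rewrite ddir_l//= ddir0 mulr0 addr0.
Qed.

Lemma ddir_rl D j : ddir (inj2 D) (ddir (inj1 (vt j)) Et) (pt x u y v) = 0.
Proof.
rewrite ddir_inj2; apply: (etrans _ (ddir_cst D (ddir (vt j) E1 (x, y)) (u, v))).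
apply: (ddir_eq_on _ oS2 S2) => -[u' v'] [/= Uu' v'0].
by rewrite ddir_l//= ddir0 mulr0 addr0.
Qed.

Lemma ddir_rr D D' : ddir (inj2 D') (ddir (inj2 D) Et) (pt x u y v) =
  ddir D' (ddir D (unc (sqF (C x)))) (u, v).
Proof.
rewrite ddir_inj2; apply: (ddir_eq_on _ oS2 S2) => -[u' v'] [/= Uu' v'0].
by rewrite ddir_r.
Qed.

Lemma ddir_lr D a : ddir (inj1 D) (ddir (inj2 (vt a)) Et) (pt x u y v) =
  ddir D.1 (fun x => phi x u ^+ 2) x * ddir (vt a) E2 (u, v).
Proof.
rewrite ddir_inj1 -(ddir_phi_fst u D (x, y)) [RHS]mulrC.
rewrite -(ddirZ _ _ (sphi_fst Uu) S1).
apply: (ddir_eq_on _ oS1 S1) => -[x' y'] [/= Ux' y'0].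
by rewrite ddir_r// ddir_C_vt// mulrC.
Qed.

Lemma fundamental_twisted : fundamental T (row_mx x u) (row_mx y v) =
  block_mx (fundamental A1 x y) 0 0 (fundamental (C x) u v).
Proof.
apply/matrixP => a b.
apply: (etrans (fundamentalE T a b (pt x u y v))).
case: (split_ordP a) => i ->; case: (split_ordP b) => j ->.
- by rewrite block_mxEul !vt_l ddir_ll; exact/esym/(fundamentalE A1 i j (x, y)).
- by rewrite block_mxEur vt_l vt_r ddir_rl mulr0 mxE.
- by rewrite block_mxEdl vt_l vt_r ddir_lr /= ddir0 mul0r mulr0 mxE.
- by rewrite block_mxEdr !vt_r ddir_rr; exact/esym/(fundamentalE (C x) i j (u, v)).
Qed.

Lemma inv_fundamental_twisted : inv_fundamental T (row_mx x u) (row_mx y v) =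
  block_mx (inv_fundamental A1 x y) 0 0 (inv_fundamental (C x) u v).
Proof.
have u1 : fundamental A1 x y \in unitmx by exact: (fundamental_unit lA1 S1).
have u2 : fundamental (C x) u v \in unitmx by exact: (fundamental_unit (lC Ux) S2).
rewrite /inv_fundamental fundamental_twisted invmx_block_diag//.
by rewrite unitmxE det_ublock unitrM -!unitmxE u1.
Qed.

Lemma spray_rhs_l i : spray_rhs T (lshift n2 i) (pt x u y v) =
  spray_rhs A1 i (x, y) - d_warp2 i x u * E2 (u, v).
Proof.
rewrite /spray_rhs big_split_ord /= [X in _ + X - _]big1 ?addr0; last first.
  by move=> g _; rewrite hz_r vt_l ddir_rl mul0r.
rewrite hz_l ddir_l// opprD addrA [E2 _ * _]mulrC; congr (_ - _ - _).
by apply: eq_bigr => k _; rewrite hz_l vt_l ddir_ll row_mxEl.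
Qed.

Lemma spray_rhs_r a : spray_rhs T (rshift n1 a) (pt x u y v) =
  (\sum_k d_warp2 k x u * y 0 k) * ddir (vt a) E2 (u, v) + spray_rhs (C x) a (u, v).
Proof.
rewrite /spray_rhs big_split_ord /= -[LHS]addrA; congr (_ + (_ - _)).
- rewrite mulr_suml; apply: eq_bigr => k _.
  by rewrite hz_l vt_r ddir_lr row_mxEl /= -/(d_warp2 k x u); ring.
- by apply: eq_bigr => g _; rewrite hz_r vt_r ddir_rr row_mxEr.
by rewrite hz_r ddir_r.
Qed.

Lemma spray_twisted_l i : spray T (lshift n2 i) (row_mx x u) (row_mx y v) =
  spray A1 i x y -
  4^-1 * (\sum_l inv_fundamental A1 x y i l * d_warp2 l x u) * sqF A2 u v.
Proof.
apply: (etrans (sprayE T _ (pt x u y v))).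
have -> := sprayE A1 i (x, y).
rewrite inv_fundamental_twisted big_split_ord /= [X in _ + X]big1 ?addr0; last first.
  by move=> a _; rewrite block_mxEur mxE mul0r.
rewrite -mulrA -mulrBr; congr (_ * _); rewrite mulr_suml -sumrB.
by apply: eq_bigr => l _; rewrite block_mxEul spray_rhs_l; rewrite /unc /=; ring.
Qed.

(** By Euler's identity the derivative of F_2^2 along v^b is 2 phi^{-2} times the index-lowered v,
    lowered by the tensor of phi F_2. Raising the index again leaves a multiple of v^a, which is the
    correction term. *)
Lemma spray_twisted_r a : spray T (rshift n1 a) (row_mx x u) (row_mx y v) =
  spray (C x) a u v +
  (2 * phi x u ^+ 2)^-1 * (\sum_k d_warp2 k x u * y 0 k) * v 0 a.
Proof.
apply: (etrans (sprayE T _ (pt x u y v))).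
have -> := sprayE (C x) a (u, v).
rewrite inv_fundamental_twisted big_split_ord /= big1 ?add0r; last first.
  by move=> l _; rewrite block_mxEdl mxE mul0r.
pose s := \sum_k d_warp2 k x u * y 0 k; rewrite -/s.
have pn : phi x u != 0 by rewrite gt_eqF// phi_gt0.
have p0 : phi x u ^+ 2 != 0 by rewrite expf_neq0.
have Vb b : ddir (vt b) E2 (u, v) =
    2 * (phi x u ^+ 2)^-1 * \sum_g fundamental (C x) u v b g * v 0 g.
  apply: (mulfI p0); rewrite -ddir_C_vt// -(euler_sqF_vt (lC Ux) b S2).
  rewrite [RHS]mulrA [phi x u ^+ 2 * _]mulrCA mulfV// mulr1.
  rewrite mulr_sumr; apply: eq_bigr => g _.
  by have -> := fundamentalE (C x) b g (u, v); field.
have u2 : fundamental (C x) u v \in unitmx by exact: (fundamental_unit (lC Ux) S2).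
have iv : \sum_b inv_fundamental (C x) u v a b * \sum_g fundamental (C x) u v b g * v 0 g = v 0 a.
  under eq_bigr do rewrite mulr_sumr.
  rewrite exchange_big /= (bigD1 a)//= [X in _ + X]big1 ?addr0.
    under eq_bigr do rewrite mulrA; rewrite -mulr_suml.
    have := congr1 (fun N : 'M[R]_n2 => N a a) (mulVmx u2).
    by rewrite !mxE eqxx => ->; rewrite mul1r.
  move=> g ga; under eq_bigr do rewrite mulrA; rewrite -mulr_suml.
  have := congr1 (fun N : 'M[R]_n2 => N a g) (mulVmx u2).
  by rewrite !mxE eq_sym (negPf ga) => ->; rewrite mul0r.
transitivity (4^-1 * \sum_l inv_fundamental (C x) u v a l * spray_rhs (C x) l (u, v) +
   4^-1 * (s * (2 * (phi x u ^+ 2)^-1 * \sum_b inv_fundamental (C x) u v a b *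
     \sum_g fundamental (C x) u v b g * v 0 g))).
  rewrite -mulrDr; congr (_ * _); rewrite !mulr_sumr -big_split /=.
  by apply: eq_bigr => b _; rewrite block_mxEdr spray_rhs_r Vb -/s; ring.
by rewrite iv; congr (_ + _); field.
Qed.

End At2.
End LocalTwistedProduct.

(** * Fibre derivatives over a fixed point *)

Section FibreDerivatives.
Context {R : realType} {n : nat}.
Local Notation V := 'rV[R]_n.
Variables (U : set V) (F : V -> V -> R).
Hypothesis lF : local_finsler U F.
Local Notation del k := (delta_mx 0 k : V).

Lemma berwald_fibre i j k l x y : berwald F i j k l x y =
  ddir (del l) (ddir (del k) (ddir (del j) (spray F i x))) y.
Proof. by rewrite !ddirE. Qed.

Lemma cartan_fibre i j k x y : cartan F i j k x y =
  2^-1 * ddir (del k) (fun y => fundamental F x y i j) y.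
Proof. by rewrite ddirE. Qed.

Lemma smooth_spray_fibre i x : U x -> smooth_on punctured (spray F i x).
Proof. by move=> Ux; exact: (smooth_fibre Ux (smooth_spray lF i)). Qed.

Lemma smooth_inv_fundamental_fibre i j x : U x ->
  smooth_on punctured (fun y => inv_fundamental F x y i j).
Proof. by move=> Ux; exact: (smooth_fibre Ux (smooth_inv_fundamental lF i j)). Qed.

Lemma smooth_fundamental_fibre i j x : U x ->
  smooth_on punctured (fun y => fundamental F x y i j).
Proof. by move=> Ux; exact: (smooth_fibre Ux (smooth_fundamental lF i j)). Qed.

Lemma inv_fundamental_sym i j x y : U x -> y != 0 ->
  inv_fundamental F x y i j = inv_fundamental F x y j i.
Proof.
move=> Ux y0.
have gT : (fundamental F x y)^T = fundamental F x y.
  by apply/matrixP => a b; rewrite mxE; exact: (fundamental_sym lF b a (z := (x, y))).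
have : (inv_fundamental F x y)^T = inv_fundamental F x y.
  by rewrite /inv_fundamental trmx_inv gT.
by move=> /(congr1 (fun N : 'M[R]_n => N j i)); rewrite mxE.
Qed.

(** Differentiating g^{-1} g = 1 gives d(g^{-1}) = - g^{-1} (dg) g^{-1} with dg = 2 C; symmetry of
    the inverse puts the indices in the order of [cartan_up]. *)
Lemma ddir_inv_fundamental k h l x y : U x -> y != 0 ->
  ddir (del l) (fun y => inv_fundamental F x y k h) y = - 2 * cartan_up F k h l x y.
Proof.
move=> Ux y0; have oP := @open_punctured R n.
pose A w := fundamental F x w; pose B w := inv_fundamental F x w.
have sA i j : smooth_on punctured (fun w => A w i j) by exact: smooth_fundamental_fibre.
have sB i j : smooth_on punctured (fun w => B w i j) by exact: smooth_inv_fundamental_fibre.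
have uA w : w != 0 -> A w \in unitmx.
  by move=> w0; exact: (fundamental_unit lF (z := (x, w)) (conj Ux w0)).
pose dA : 'M[R]_n := \matrix_(i, j) ddir (del l) (fun w => A w i j) y.
pose dB : 'M[R]_n := \matrix_(i, j) ddir (del l) (fun w => B w i j) y.
have dAE i j : dA i j = ddir (del l) (fun w => A w i j) y by rewrite [LHS]mxE.
have dBE i j : dB i j = ddir (del l) (fun w => B w i j) y by rewrite [LHS]mxE.
have dBA : B y *m dA + dB *m A y = 0.
  apply/matrixP => i j; rewrite !mxE.
  have sM m : smooth_on punctured (fun w => B w i m * A w m j) by exact: smooth_onM.
  have e w : punctured w -> \sum_m B w i m * A w m j = (1%:M : 'M[R]_n) i j.
    by move=> w0; rewrite -(mulVmx (uA w w0)) mxE.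
  have := ddir_eq_on (del l) oP y0 e; rewrite (ddir_sum _ _ _ oP sM y0) ddir_cst => e0.
  rewrite -[RHS]e0 -big_split /=; apply: eq_bigr => m _.
  by rewrite (ddirM _ (sB i m) (sA m j) y0) dAE dBE [A y m j * _]mulrC.
have dB' : dB = - (B y *m dA *m B y).
  rewrite -[dB]mulmx1 -(mulmxV (uA y y0)) mulmxA.
  move/eqP: dBA; rewrite addrC addr_eq0 => /eqP ->.
  by rewrite mulNmx.
have -> : ddir (del l) (fun y => inv_fundamental F x y k h) y = dB k h by rewrite dBE.
rewrite dB' [LHS]mxE [X in - X]mxE /cartan_up mulNr; congr (- _).
transitivity (\sum_i \sum_j B y k i * dA i j * B y j h).
  rewrite exchange_big /=; apply: eq_bigr => j _.
  by rewrite [X in X * _]mxE mulr_suml.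
rewrite mulr_sumr; apply: eq_bigr => i _; rewrite mulr_sumr; apply: eq_bigr => j _.
rewrite cartan_fibre dAE (inv_fundamental_sym h j Ux y0) -/(A _) -/(B _).
move: (ddir _ _ _) (B y k i) (B y j h) => p q r.
by field.
Qed.

End FibreDerivatives.

(** * Products of a function of y and a function of v *)

Section Tensor.
Context {R : realType} {n1 n2 : nat}.
Local Notation V1 := 'rV[R]_n1.
Local Notation V2 := 'rV[R]_n2.
Local Notation V := 'rV[R]_(n1 + n2).
Implicit Types (a : V1 -> R) (b : V2 -> R).

Definition bipunctured : set V := [set w | lsubmx w != 0 /\ rsubmx w != 0].

Lemma linear_lsubmx : linear (lsubmx : V -> V1).
Proof. by move=> h u v; rewrite linearP. Qed.

Lemma linear_rsubmx : linear (rsubmx : V -> V2).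
Proof. by move=> h u v; rewrite linearP. Qed.

Lemma continuous_lsubmx : continuous (lsubmx : V -> V1).
Proof.
move=> w; apply: continuous_row => k.
rewrite (_ : (fun s : V => lsubmx s 0 k) = fun s : V => s 0 (lshift n2 k)).
  exact: coord_continuous.
by apply/funext => s; rewrite mxE.
Qed.

Lemma continuous_rsubmx : continuous (rsubmx : V -> V2).
Proof.
move=> w; apply: continuous_row => k.
rewrite (_ : (fun s : V => rsubmx s 0 k) = fun s : V => s 0 (rshift n1 k)).
  exact: coord_continuous.
by apply/funext => s; rewrite mxE.
Qed.

Lemma open_bipunctured : open bipunctured.
Proof.
apply: openI.
  by apply: (open_comp _ (@open_punctured R n1)) => w _; exact: continuous_lsubmx.
by apply: (open_comp _ (@open_punctured R n2)) => w _; exact: continuous_rsubmx.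
Qed.
Let oO := open_bipunctured.

Lemma smooth_lsub a : smooth_on punctured a -> smooth_on bipunctured (fun w => a (lsubmx w)).
Proof.
apply: smooth_on_comp_linear; [exact: linear_lsubmx|exact: continuous_lsubmx|].
by move=> w [].
Qed.

Lemma smooth_rsub b : smooth_on punctured b -> smooth_on bipunctured (fun w => b (rsubmx w)).
Proof.
apply: smooth_on_comp_linear; [exact: linear_rsubmx|exact: continuous_rsubmx|].
by move=> w [].
Qed.

(** Over a fixed base point each spray coefficient of the twisted product is a sum of two such
    products. Derivatives along y and along v fall on different factors, so each component of the
    curvature is a sum of products too. *)
Definition tens a b (w : V) : R := a (lsubmx w) * b (rsubmx w).

Lemma smooth_tens a b : smooth_on punctured a -> smooth_on punctured b ->
  smooth_on bipunctured (tens a b).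
Proof. by move=> sa sb; apply: smooth_onM => //; [exact: smooth_lsub|exact: smooth_rsub]. Qed.

Lemma ddir_tens_l a b j w : smooth_on punctured a -> smooth_on punctured b ->
  bipunctured w -> ddir (delta_mx 0 (lshift n2 j)) (tens a b) w =
  tens (ddir (delta_mx 0 j) a) b w.
Proof.
move=> sa sb Ow; rewrite (ddirM _ (smooth_lsub sa) (smooth_rsub sb) Ow).
rewrite (ddir_comp_linear b _ _ linear_rsubmx) (ddir_comp_linear a _ _ linear_lsubmx).
by rewrite delta_mx_lshift row_mxKl row_mxKr ddir0 mulr0 add0r mulrC.
Qed.

Lemma ddir_tens_r a b j w : smooth_on punctured a -> smooth_on punctured b ->
  bipunctured w -> ddir (delta_mx 0 (rshift n1 j)) (tens a b) w =
  tens a (ddir (delta_mx 0 j) b) w.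
Proof.
move=> sa sb Ow; rewrite (ddirM _ (smooth_lsub sa) (smooth_rsub sb) Ow).
rewrite (ddir_comp_linear b _ _ linear_rsubmx) (ddir_comp_linear a _ _ linear_lsubmx).
by rewrite delta_mx_rshift row_mxKl row_mxKr ddir0 mulr0 addr0.
Qed.

(** With the next two lemmas, these are the types from which the forward direction is read off: all
    three derivatives in one factor, or one in the first and two in the second. *)
Lemma ddir3_tens_lll a b i j k w : smooth_on punctured a -> smooth_on punctured b ->
  bipunctured w ->
  ddir (delta_mx 0 (lshift n2 k)) (ddir (delta_mx 0 (lshift n2 j))
    (ddir (delta_mx 0 (lshift n2 i)) (tens a b))) w =
  tens (ddir (delta_mx 0 k) (ddir (delta_mx 0 j) (ddir (delta_mx 0 i) a))) b w.
Proof.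
move=> sa sb Ow; rewrite -ddir_tens_l//; last by do 2 apply: smooth_ddir.
apply: (ddir_eq_on _ oO Ow) => w' Ow'; rewrite -ddir_tens_l//; last exact: smooth_ddir.
by apply: (ddir_eq_on _ oO Ow') => w'' Ow''; rewrite -ddir_tens_l.
Qed.

Lemma ddir3_tens_rrr a b i j k w : smooth_on punctured a -> smooth_on punctured b ->
  bipunctured w ->
  ddir (delta_mx 0 (rshift n1 k)) (ddir (delta_mx 0 (rshift n1 j))
    (ddir (delta_mx 0 (rshift n1 i)) (tens a b))) w =
  tens a (ddir (delta_mx 0 k) (ddir (delta_mx 0 j) (ddir (delta_mx 0 i) b))) w.
Proof.
move=> sa sb Ow; rewrite -ddir_tens_r//; last by do 2 apply: smooth_ddir.
apply: (ddir_eq_on _ oO Ow) => w' Ow'; rewrite -ddir_tens_r//; last exact: smooth_ddir.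
by apply: (ddir_eq_on _ oO Ow') => w'' Ow''; rewrite -ddir_tens_r.
Qed.

Lemma ddir3_tens_lrr a b i j k w : smooth_on punctured a -> smooth_on punctured b ->
  bipunctured w ->
  ddir (delta_mx 0 (rshift n1 k)) (ddir (delta_mx 0 (rshift n1 j))
    (ddir (delta_mx 0 (lshift n2 i)) (tens a b))) w =
  tens (ddir (delta_mx 0 i) a) (ddir (delta_mx 0 k) (ddir (delta_mx 0 j) b)) w.
Proof.
move=> sa sb Ow; rewrite -ddir_tens_r//; [|exact: smooth_ddir|exact: smooth_ddir].
apply: (ddir_eq_on _ oO Ow) => w' Ow'; rewrite -ddir_tens_r//; last exact: smooth_ddir.
by apply: (ddir_eq_on _ oO Ow') => w'' Ow''; rewrite -ddir_tens_l.
Qed.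

Lemma fibre_poly_lsub d a : fibre_poly (fun k => delta_mx 0 k : V1) punctured d a ->
  fibre_poly (fun k => delta_mx 0 k : V) bipunctured d (fun w => a (lsubmx w)).
Proof.
apply: fibre_poly_comp => //; first exact: linear_lsubmx.
  by move=> w [].
move=> k; case: (split_ordP k) => j ->.
  by right; exists j; rewrite delta_mx_lshift row_mxKl.
by left; rewrite delta_mx_rshift row_mxKl.
Qed.

Lemma fibre_poly_rsub d b : fibre_poly (fun k => delta_mx 0 k : V2) punctured d b ->
  fibre_poly (fun k => delta_mx 0 k : V) bipunctured d (fun w => b (rsubmx w)).
Proof.
apply: fibre_poly_comp => //; first exact: linear_rsubmx.
  by move=> w [].
move=> k; case: (split_ordP k) => j ->.
  by left; rewrite delta_mx_lshift row_mxKr.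
by right; exists j; rewrite delta_mx_rshift row_mxKr.
Qed.

Lemma fibre_poly_tens d d' a b : smooth_on punctured a -> smooth_on punctured b ->
  fibre_poly (fun k => delta_mx 0 k : V1) punctured d a ->
  fibre_poly (fun k => delta_mx 0 k : V2) punctured d' b ->
  fibre_poly (fun k => delta_mx 0 k : V) bipunctured (d + d') (tens a b).
Proof.
move=> sa sb pa pb; apply: fibre_polyM => //.
- exact: smooth_lsub.
- exact: smooth_rsub.
- exact: fibre_poly_lsub.
exact: fibre_poly_rsub.
Qed.

Lemma ddir3D (S : set V) (g h : V -> R) (d1 d2 d3 w : V) : open S -> S w ->
  smooth_on S g -> smooth_on S h ->
  ddir d3 (ddir d2 (ddir d1 (fun w => g w + h w))) w =
  ddir d3 (ddir d2 (ddir d1 g)) w + ddir d3 (ddir d2 (ddir d1 h)) w.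
Proof.
move=> oS Sw sg sh; have sD v := smooth_ddir v sg; have sD' v := smooth_ddir v sh.
rewrite -(ddirD _ (smooth_ddir d2 (sD d1)) (smooth_ddir d2 (sD' d1)) Sw).
apply: (ddir_eq_on _ oS Sw) => w' Sw'; rewrite -(ddirD _ (sD d1) (sD' d1) Sw').
by apply: (ddir_eq_on _ oS Sw') => w'' Sw''; rewrite (ddirD _ sg sh Sw'').
Qed.

End Tensor.

(** * Berwald curvature of the twisted product over a fixed base point *)

Section LocalBerwald.
Context {R : realType} {n1 n2 : nat}.
Local Notation V1 := 'rV[R]_n1.
Local Notation V2 := 'rV[R]_n2.
Local Notation V := 'rV[R]_(n1 + n2).
Variables (U1 : set V1) (U2 : set V2) (A1 : V1 -> V1 -> R) (A2 : V2 -> V2 -> R).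
Variable phi : V1 -> V2 -> R.
Hypothesis lA1 : local_finsler U1 A1.
Hypothesis lA2 : local_finsler U2 A2.
Local Notation C := (local_conformal A2 phi).
Local Notation T := (local_twisted A1 A2 phi).
Hypothesis lC : forall x, U1 x -> local_finsler U2 (C x).
Hypothesis phi_gt0 : forall x u, U1 x -> U2 u -> 0 < phi x u.
Hypothesis phi_smooth : forall u, U2 u -> smooth_on U1 (fun x => phi x u).
Variables (x : V1) (u : V2).
Hypotheses (Ux : U1 x) (Uu : U2 u).
Let oU1 : open U1. Proof. by case: lA1. Qed.
Let oO := @open_bipunctured R n1 n2.

(** The gradient of f(., u) with respect to g(x, y). It depends on y through g alone, and the
    equation on the Cartan tensor says that its fibre derivatives vanish. *)
Definition warp_grad k y : R :=
  \sum_l inv_fundamental A1 x y k l * ddir (delta_mx 0 l) (fun x => phi x u) x.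
Local Notation K := warp_grad.

Let d_warp2E l : d_warp2 phi l x u = 2 * phi x u * ddir (delta_mx 0 l) (fun x => phi x u) x.
Proof.
rewrite /d_warp2; have sp := phi_smooth Uu.
rewrite (ddir_eq_on _ oU1 Ux (g := fun x => phi x u * phi x u)); last by move=> z _; rewrite expr2.
by rewrite (ddirM _ sp sp Ux); ring.
Qed.

Let sK k : smooth_on punctured (K k).
Proof.
have oP := @open_punctured R n1.
apply: smooth_on_sum => // l; apply: smooth_onM => //; last exact: smooth_on_cst.
exact: (smooth_inv_fundamental_fibre lA1 k l Ux).
Qed.

Let sS i : smooth_on punctured (spray A1 i x).
Proof. exact: (smooth_spray_fibre lA1 i Ux). Qed.

Let se : smooth_on punctured (sqF A2 u).
Proof. exact: (smooth_sqF_fibre lA2 Uu). Qed.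

Let sC a : smooth_on punctured (spray (C x) a u).
Proof. exact: (smooth_spray_fibre (lC Ux) a Uu). Qed.

Let s1 n : smooth_on (@punctured R n) (fun=> 1 : R).
Proof. exact: smooth_on_cst. Qed.

(** The coefficient -1/4 of the spray formula times the factor 2 phi from the derivative of
    phi^2. *)
Let c := - (2^-1 * phi x u).

Let cK k y : R := c * K k y.
Let scK k : smooth_on punctured (cK k).
Proof. by apply: smooth_onZ; [exact: open_punctured|exact: sK]. Qed.

Lemma spray_l_tens i w : bipunctured w -> spray T (lshift n2 i) (row_mx x u) w =
  tens (spray A1 i x) (fun=> 1) w + tens (cK i) (sqF A2 u) w.
Proof.
move=> [w1 w2]; rewrite -{1}(hsubmxK w).
rewrite (spray_twisted_l lA1 lA2 lC phi_smooth Ux Uu w1 w2 i).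
rewrite /tens mulr1; congr (_ + _); rewrite -mulNr; congr (_ * _).
rewrite /cK /K /c mulNr; congr (- _).
rewrite mulr_sumr [RHS]mulr_sumr; apply: eq_bigr => l _.
rewrite d_warp2E; move: (inv_fundamental _ _ _ _ _) (ddir _ _ _) (phi x u) => p q r.
by field.
Qed.

(** This is phi^{-1} phi_k y^k, the derivative of log phi along y. *)
Let lin (y : V1) : R := (2 * phi x u ^+ 2)^-1 * \sum_k d_warp2 phi k x u * y 0 k.

Let slin : smooth_on (@punctured R n1) lin.
Proof.
have oP := @open_punctured R n1.
apply: smooth_onZ => //; apply: smooth_on_sum => // k; apply: smooth_onZ => //.
apply: smooth_scalar; last exact: coord_continuous.
by move=> h p q; rewrite !mxE.
Qed.

Let scoord a : smooth_on (@punctured R n2) (fun v => v 0 a).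
Proof.
apply: smooth_scalar; last exact: coord_continuous.
by move=> h p q; rewrite !mxE.
Qed.

Lemma spray_r_tens a w : bipunctured w -> spray T (rshift n1 a) (row_mx x u) w =
  tens (fun=> 1) (spray (C x) a u) w + tens lin (fun v => v 0 a) w.
Proof.
move=> [w1 w2]; rewrite -{1}(hsubmxK w).
rewrite (spray_twisted_r lA1 lA2 lC phi_gt0 phi_smooth Ux Uu w1 w2 a).
by rewrite /tens mul1r.
Qed.

Let ddir3_eq (g h : V -> R) (d1 d2 d3 w : V) : (forall w, bipunctured w -> g w = h w) ->
  bipunctured w -> ddir d3 (ddir d2 (ddir d1 g)) w = ddir d3 (ddir d2 (ddir d1 h)) w.
Proof.
move=> gh Ow; apply: (ddir_eq_on _ oO Ow) => w' Ow'; apply: (ddir_eq_on _ oO Ow').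
by move=> w'' Ow''; exact: (ddir_eq_on _ oO Ow'').
Qed.

Lemma berwald_twisted_l i p q r w : bipunctured w ->
  berwald T (lshift n2 i) p q r (row_mx x u) w =
  ddir (delta_mx 0 r) (ddir (delta_mx 0 q) (ddir (delta_mx 0 p)
    (tens (spray A1 i x) (fun=> 1)))) w +
  ddir (delta_mx 0 r) (ddir (delta_mx 0 q) (ddir (delta_mx 0 p)
    (tens (cK i) (sqF A2 u)))) w.
Proof.
move=> Ow; rewrite berwald_fibre (ddir3_eq _ _ _ (spray_l_tens i) Ow).
by rewrite (ddir3D _ _ _ oO Ow (smooth_tens (sS i) (s1 n2)) (smooth_tens (scK i) se)).
Qed.

Lemma berwald_twisted_r a p q r w : bipunctured w ->
  berwald T (rshift n1 a) p q r (row_mx x u) w =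
  ddir (delta_mx 0 r) (ddir (delta_mx 0 q) (ddir (delta_mx 0 p)
    (tens (fun=> 1) (spray (C x) a u)))) w +
  ddir (delta_mx 0 r) (ddir (delta_mx 0 q) (ddir (delta_mx 0 p)
    (tens lin (fun v => v 0 a)))) w.
Proof.
move=> Ow; rewrite berwald_fibre (ddir3_eq _ _ _ (spray_r_tens a) Ow).
by rewrite (ddir3D _ _ _ oO Ow (smooth_tens (s1 n1) (sC a)) (smooth_tens slin (scoord a))).
Qed.

Lemma ddir_warp_grad k l y : y != 0 -> ddir (delta_mx 0 l) (K k) y =
  - 2 * \sum_h cartan_up A1 k h l x y * ddir (delta_mx 0 h) (fun x => phi x u) x.
Proof.
move=> y0; have oP := @open_punctured R n1.
have sI h : smooth_on punctured (fun y => inv_fundamental A1 x y k h).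
  exact: (smooth_inv_fundamental_fibre lA1 k h Ux).
have st h : smooth_on punctured (fun y => inv_fundamental A1 x y k h *
    ddir (delta_mx 0 h) (fun x => phi x u) x).
  by apply: smooth_onM => //; exact: smooth_on_cst.
rewrite /K (ddir_sum _ _ _ oP st y0) mulr_sumr; apply: eq_bigr => h _.
rewrite (ddirM _ (sI h) (smooth_on_cst _ _) y0) ddir_cst mulr0 add0r.
by rewrite (ddir_inv_fundamental lA1 k h l Ux y0); ring.
Qed.

Let c_neq0 : c != 0.
Proof.
by rewrite oppr_eq0 mulf_neq0 ?invr_eq0 ?pnatr_eq0// gt_eqF// phi_gt0.
Qed.

Let ddir_cK k d y : y != 0 -> ddir d (cK k) y = c * ddir d (K k) y.
Proof. by move=> y0; rewrite (ddirZ d c (sK k) y0). Qed.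

Let ddir_tens_pt (a : V1 -> R) (b : V2 -> R) y v : tens a b (row_mx y v) = a y * b v.
Proof. by rewrite /tens row_mxKl row_mxKr. Qed.

Let bip (y : V1) (v : V2) : y != 0 -> v != 0 -> bipunctured (row_mx y v).
Proof. by move=> y0 v0; split; rewrite ?row_mxKl ?row_mxKr. Qed.

Let ddir2_cst m (d1 d2 : 'rV[R]_m) y : y != 0 -> ddir d2 (ddir d1 (fun=> 1)) y = 0.
Proof.
move=> y0; apply: (ddir_eq0_on _ (@open_punctured R m) y0) => z _.
exact: ddir_cst.
Qed.

Let ddir3_cst m (d1 d2 d3 : 'rV[R]_m) y : y != 0 ->
  ddir d3 (ddir d2 (ddir d1 (fun=> 1))) y = 0.
Proof.
move=> y0; apply: (ddir_eq0_on _ (@open_punctured R m) y0) => z z0.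
exact: ddir2_cst.
Qed.

(** * Components of a vanishing curvature *)

Section Forward.
Hypothesis BT : forall y v, y != 0 -> v != 0 -> forall i p q r,
  berwald T i p q r (row_mx x u) (row_mx y v) = 0.
Variable v : V2.
Hypothesis v0 : v != 0.

(** B^i_{jab} is this derivative times [c] times twice the fundamental tensor of F_2, and a positive
    definite tensor is not zero. *)
Lemma twisted_warp_grad_constant i j y : y != 0 -> ddir (delta_mx 0 j) (K i) y = 0.
Proof.
move=> y0; have Ow := bip y0 v0.
have key a b : ddir (delta_mx 0 j) (K i) y * fundamental A2 u v a b = 0.
  have := BT y0 v0 (lshift n2 i) (lshift n2 j) (rshift n1 a) (rshift n1 b).
  rewrite (berwald_twisted_l _ _ _ _ Ow).
  rewrite (ddir3_tens_lrr _ _ _ (sS i) (s1 n2) Ow) (ddir3_tens_lrr _ _ _ (scK i) se Ow).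
  rewrite !ddir_tens_pt (ddir2_cst _ _ v0) mulr0 add0r ddir_cK//.
  rewrite -mulrA => /eqP; rewrite mulf_eq0 (negPf c_neq0) /= => /eqP E0.
  by rewrite (fundamental_fibre A2 u v a b) mulrCA E0 mulr0.
apply/eqP; apply: contraT => Kn0.
have g0 a b : fundamental A2 u v a b = 0.
  by have /eqP := key a b; rewrite mulf_eq0 (negPf Kn0) => /eqP.
case: lA2 => _ _ _ /(_ u v Uu v0 v v0).
rewrite big1 ?ltxx// => a _; rewrite big1// => b _.
by rewrite g0 !mul0r.
Qed.

(** In B^i_{jkl} the second summand carries third derivatives of the gradient, whose first
    derivatives already vanish. *)
Lemma twisted_berwald_base i p q r y : y != 0 -> berwald A1 i p q r x y = 0.
Proof.
move=> y0; have Ow := bip y0 v0; have oP := @open_punctured R n1.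
have := BT y0 v0 (lshift n2 i) (lshift n2 p) (lshift n2 q) (lshift n2 r).
rewrite (berwald_twisted_l _ _ _ _ Ow).
rewrite (ddir3_tens_lll _ _ _ (sS i) (s1 n2) Ow) (ddir3_tens_lll _ _ _ (scK i) se Ow).
rewrite !ddir_tens_pt mulr1 -berwald_fibre.
rewrite (_ : ddir _ (ddir _ _) y = 0) ?mul0r ?addr0//.
apply: (ddir_eq0_on _ oP y0) => y' y'0; apply: (ddir_eq0_on _ oP y'0) => y'' y''0.
by rewrite ddir_cK// twisted_warp_grad_constant// mulr0.
Qed.

(** In B^a_{bcd} the second summand is linear in v, so three derivatives along v remove it. The
    vector [y] supplies a point of the domain of the product. *)
Lemma twisted_berwald_fibre a p q r (y : V1) : y != 0 -> berwald (C x) a p q r u v = 0.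
Proof.
move=> y0; have Ow := bip y0 v0; have oP := @open_punctured R n2.
have := BT y0 v0 (rshift n1 a) (rshift n1 p) (rshift n1 q) (rshift n1 r).
rewrite (berwald_twisted_r _ _ _ _ Ow).
rewrite (ddir3_tens_rrr _ _ _ (s1 n1) (sC a) Ow) (ddir3_tens_rrr _ _ _ slin (scoord a) Ow).
rewrite !ddir_tens_pt mul1r -berwald_fibre.
rewrite (_ : ddir _ (ddir _ _) v = 0) ?mulr0 ?addr0//.
apply: (ddir_eq0_on _ oP v0) => v' v'0.
apply: (etrans (ddir_eq_on _ oP v'0 (g := fun=> (delta_mx 0 p : V2) 0 a) _)).
  by move=> v'' _; apply: ddir_scalar => h s t; rewrite !mxE.
exact: ddir_cst.
Qed.

(** B^i_{abc} is [c] times the [i]-th component of the gradient times this derivative. Were the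
    derivative nonzero, the whole gradient would vanish, and with it every f_h, since g is
    invertible. *)
Lemma twisted_cubic h p q r (y : V1) : y != 0 ->
  ddir (delta_mx 0 h) (fun x => phi x u) x != 0 ->
  ddir (delta_mx 0 r) (ddir (delta_mx 0 q) (ddir (delta_mx 0 p) (sqF A2 u))) v = 0.
Proof.
move=> y0 fh; have Ow := bip y0 v0.
have key i : K i y * ddir (delta_mx 0 r) (ddir (delta_mx 0 q)
    (ddir (delta_mx 0 p) (sqF A2 u))) v = 0.
  have := BT y0 v0 (lshift n2 i) (rshift n1 p) (rshift n1 q) (rshift n1 r).
  rewrite (berwald_twisted_l _ _ _ _ Ow).
  rewrite (ddir3_tens_rrr _ _ _ (sS i) (s1 n2) Ow) (ddir3_tens_rrr _ _ _ (scK i) se Ow).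
  rewrite !ddir_tens_pt (ddir3_cst _ _ _ v0) mulr0 add0r /cK.
  by rewrite -mulrA => /eqP; rewrite mulf_eq0 (negPf c_neq0) /= => /eqP.
apply/eqP; apply: contraT => En0.
have K0 i : K i y = 0.
  by have /eqP := key i; rewrite mulf_eq0 (negPf En0) orbF => /eqP.
pose a : 'cV[R]_n1 := \col_l ddir (delta_mx 0 l) (fun x => phi x u) x.
have Ba : inv_fundamental A1 x y *m a = 0.
  apply/matrixP => i j; rewrite [RHS]mxE; apply: (etrans _ (K0 i)).
  by rewrite mxE; apply: eq_bigr => l _; rewrite [a l j]mxE.
have uA : fundamental A1 x y \in unitmx by exact: (fundamental_unit lA1 (z := (x, y))).
have a0 : a = 0 by rewrite -[a]mul1mx -(mulmxV uA) -mulmxA Ba mulmx0.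
by move/eqP: fh; have := congr1 (fun N : 'cV[R]_n1 => N h 0) a0; rewrite !mxE.
Qed.

End Forward.

(** A count of degrees in y and v: 2 + 0 and 0 + 2 for the two summands of G^i, 0 + 2 and 1 + 1 for
    those of G^a. Third derivatives of every type vanish at once. *)
Lemma twisted_berwald_vanishes :
  (forall y, y != 0 -> forall i p q r, berwald A1 i p q r x y = 0) ->
  (forall v, v != 0 -> forall p q r,
    ddir (delta_mx 0 r) (ddir (delta_mx 0 q) (ddir (delta_mx 0 p) (sqF A2 u))) v = 0) ->
  (forall y, y != 0 -> forall i j, ddir (delta_mx 0 j) (K i) y = 0) ->
  (forall v, v != 0 -> forall a p q r, berwald (C x) a p q r u v = 0) ->
  forall y v, y != 0 -> v != 0 -> forall i p q r,
  berwald T i p q r (row_mx x u) (row_mx y v) = 0.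
Proof.
move=> B1 c2 dK BC y v y0 v0 i p q r; have Ow := bip y0 v0.
have oP m := @open_punctured R m.
have p1 m : fibre_poly (fun k => delta_mx 0 k : 'rV[R]_m) punctured 0 (fun=> 1).
  by move=> k z _; exact: ddir_cst.
case: (split_ordP i) => j ->.
  have P1 : fibre_poly (fun k => delta_mx 0 k : V) bipunctured 2
      (tens (spray A1 j x) (fun=> 1)).
    apply: (@fibre_poly_tens _ _ _ 2 0) => // k k' k'' z z0.
    by rewrite -berwald_fibre B1.
  have P2 : fibre_poly (fun k => delta_mx 0 k : V) bipunctured 2 (tens (cK j) (sqF A2 u)).
    apply: (@fibre_poly_tens _ _ _ 0 2) => //.
      by move=> k z z0; rewrite ddir_cK// dK// mulr0.
    by move=> k k' k'' z z0; rewrite c2.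
  by rewrite (berwald_twisted_l _ _ _ _ Ow) (P1 p q r _ Ow) (P2 p q r _ Ow) addr0.
have P1 : fibre_poly (fun k => delta_mx 0 k : V) bipunctured 2
    (tens (fun=> 1) (spray (C x) j u)).
  apply: (@fibre_poly_tens _ _ _ 0 2) => // k k' k'' z z0.
  by rewrite -berwald_fibre BC.
have P2 : fibre_poly (fun k => delta_mx 0 k : V) bipunctured 2 (tens lin (fun v => v 0 j)).
  apply: (@fibre_poly_tens _ _ _ 1 1) => //.
    apply: fibre_poly_scalar; first exact: oP.
    move=> h s t; rewrite /lin [h * _]mulrCA -mulrDr; congr (_ * _).
    rewrite mulr_sumr -big_split /=; apply: eq_bigr => k _.
    by rewrite !mxE; ring.
  apply: fibre_poly_scalar; first exact: oP.
  by move=> h s t; rewrite !mxE.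
by rewrite (berwald_twisted_r _ _ _ _ Ow) (P1 p q r _ Ow) (P2 p q r _ Ow) addr0.
Qed.

End LocalBerwald.

(** * From charts to the manifolds *)

Section TwistedTheorem.
Context {R : realType} {n1 n2 : nat}.
Context {M1 : smooth_manifold R n1} {M2 : smooth_manifold R n2}.
Variables (F1 : finsler_metric M1) (F2 : finsler_metric M2) (f : M1 * M2 -> R).
Hypothesis f_gt0 : forall p, 0 < f p.
Hypothesis f_smooth : smooth_on_product f.

Lemma smooth_warp_l (c1 : chart_idx M1) (c2 : chart_idx M2) u : chart_im c2 u ->
  smooth_on (chart_im c1) (fun x => loc2 f c1 c2 x u).
Proof.
move=> cu; apply: (@smooth_on_comp_affine _ _ _ _ (fun x => (x, u)) (fun x => (x, 0)) _ _
  (fun z => loc2 f c1 c2 z.1 z.2) _ _ _ (f_smooth c1 c2)) => //.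
  by move=> h a b; rewrite [RHS]/GRing.add /= /add_pair /= scaler0 add0r.
move=> x; apply: (@cvg_pair _ _ _ (nbhs x) (nbhs x) (nbhs u) _ _ _ id (fun=> u)).
  exact: cvg_id.
exact: cvg_cst.
Qed.

Lemma smooth_warp_r (c1 : chart_idx M1) x : chart_im c1 x -> forall c2 : chart_idx M2,
  smooth_on (chart_im c2) (fun u => f (chart_inv c1 x, chart_inv c2 u)).
Proof.
move=> cx c2; apply: (@smooth_on_comp_affine _ _ _ _ (fun u => (x, u)) (fun u => (0, u)) _ _
  (fun z => loc2 f c1 c2 z.1 z.2) _ _ _ (f_smooth c1 c2)) => //.
  by move=> h a b; rewrite [RHS]/GRing.add /= /add_pair /= scaler0 add0r.
move=> u; apply: (@cvg_pair _ _ _ (nbhs u) (nbhs x) (nbhs u) _ _ _ (fun=> x) id).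
  exact: cvg_cst.
exact: cvg_id.
Qed.

Definition warped_fibre (c1 : chart_idx M1) x (cx : chart_im c1 x) : finsler_metric M2 :=
  conformal F2 (fun q => f_gt0 (chart_inv c1 x, q)) (smooth_warp_r cx).

Lemma riemannian_warped_fibre (c1 : chart_idx M1) x (cx : chart_im c1 x) :
  riemannian (warped_fibre cx) <-> riemannian F2.
Proof. exact: riemannian_conformal. Qed.

Let lF1 c1 := finsler_local F1 c1.
Let lF2 c2 := finsler_local F2 c2.
Let lC c1 c2 x (cx : chart_im c1 x) :
  local_finsler (chart_im c2) (local_conformal (F2 c2) (loc2 f c1 c2) x) :=
  finsler_local (warped_fibre cx) c2.
Let f_pos c1 c2 x u (_ : chart_im c1 x) (_ : chart_im c2 u) : 0 < loc2 f c1 c2 x u :=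
  f_gt0 _.
Let f_sm c1 c2 u (cu : chart_im c2 u) := smooth_warp_l c1 cu.

Let d_M1E c1 c2 h x u : d_M1 f c1 c2 h x u =
  ddir (delta_mx 0 h) (fun x => loc2 f c1 c2 x u) x.
Proof. by rewrite ddirE. Qed.

Let nonzero_vector (n : nat) : (0 < n)%N -> exists v : 'rV[R]_n, v != 0.
Proof.
move=> n0; exists (delta_mx 0 (Ordinal n0)).
by apply/eqP => /matrixP/(_ 0 (Ordinal n0))/eqP; rewrite !mxE !eqxx oner_eq0.
Qed.

Let BT_local (BT : twisted_berwaldian F1 F2 f) c1 c2 x u : chart_im c1 x -> chart_im c2 u ->
  forall y v, y != 0 -> v != 0 -> forall i p q r,
  berwald (local_twisted (F1 c1) (F2 c2) (loc2 f c1 c2)) i p q r (row_mx x u) (row_mx y v) = 0.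
Proof.
move=> cx cu y v y0 v0 i p q r; apply: (BT c1 c2 (row_mx x u, row_mx y v)).
by split; rewrite /= ?row_mxKl ?row_mxKr.
Qed.

(** The curvature of F_1 is read off over some point of M_2; [smooth_manifold] admits the empty
    manifold, hence the hypothesis. *)
Lemma twisted_berwaldian_base : [set: M2] !=set0 ->
  twisted_berwaldian F1 F2 f -> berwaldian F1.
Proof.
move=> [p2 _] BT c1 [x y] [/= cx y0] i j k l.
have [c2 cp2] := chart_cover p2; have cu : chart_im c2 (chart c2 p2) by exists p2.
have [v v0] := nonzero_vector (dim_gt0 M2).
exact: (twisted_berwald_base (lF1 c1) (lF2 c2) (@lC c1 c2) (@f_pos c1 c2) (@f_sm c1 c2)
  cx cu (BT_local BT cx cu) v0 i j k l y0).
Qed.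

Lemma twisted_berwaldian_cartan : twisted_berwaldian F1 F2 f -> cartan_df_vanishes F1 f.
Proof.
move=> BT c1 c2 x u y cx cu y0 k l; have [v v0] := nonzero_vector (dim_gt0 M2).
have := twisted_warp_grad_constant (lF1 c1) (lF2 c2) (@lC c1 c2) (@f_pos c1 c2) (@f_sm c1 c2)
  cx cu (BT_local BT cx cu) v0 k l y0.
rewrite (ddir_warp_grad _ (lF1 c1) _ cx _ _ y0) => /eqP.
rewrite mulf_eq0 oppr_eq0 pnatr_eq0 /= => /eqP E0.
by rewrite -[RHS]E0; apply: eq_bigr => h _; rewrite d_M1E.
Qed.

Lemma third_derivative_fibre c2 u v p q r :
  ddir (vt r) (ddir (vt q) (ddir (vt p) (unc (sqF (F2 c2))))) (u, v) =
  ddir (delta_mx 0 r) (ddir (delta_mx 0 q) (ddir (delta_mx 0 p) (sqF (F2 c2) u))) v.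
Proof.
rewrite -(ddir_fibre _ u (delta_mx 0 r)); congr (ddir _ _ v); apply/funext => v'.
rewrite -(ddir_fibre _ u (delta_mx 0 q)); congr (ddir _ _ v'); apply/funext => v''.
by rewrite -(ddir_fibre _ u (delta_mx 0 p)).
Qed.

(** The point x is taken where some f_h(x, u) is nonzero and then kept for all points of M_2: f(x,
    .) F_2 is Berwald everywhere, also over points at which the derivatives f_h vanish. *)
Lemma twisted_berwaldian_fibre : ~ constant_on_M1 f -> (1 < n2)%N ->
  twisted_berwaldian F1 F2 f -> riemannian F2.
Proof.
move=> nc n21 BT.
have [c1 [c2 [x [u [cx [cu [h fh]]]]]]] : exists c1 c2 x u, chart_im c1 x /\
    (chart_im c2 u /\ exists h, d_M1 f c1 c2 h x u != 0).
  apply: contrapT => H; apply: nc => c1 c2 x u cx cu h; apply/eqP.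
  apply: contrapT => /negP fh; apply: H.
  by exists c1, c2, x, u; split=> //; split=> //; exists h.
rewrite d_M1E in fh; have [y y0] := nonzero_vector (dim_gt0 M1).
apply: (riemannian_warped_fibre cx).1.
apply: berwald_riemannian_point => //.
  move=> c [u' v'] [/= cu' v'0] i j k l.
  exact: (twisted_berwald_fibre (lF1 c1) (lF2 c) (@lC c1 c) (@f_pos c1 c) (@f_sm c1 c)
    cx cu' (BT_local BT cx cu') v'0 i j k l y0).
exists c2, u; split=> //; apply: parallelogram_conformal.
apply: (cubic_free_parallelogram (lF2 c2)) => // v v0 p q r.
rewrite third_derivative_fibre.
exact: (twisted_cubic (lF1 c1) (lF2 c2) (@lC c1 c2) (@f_pos c1 c2) (@f_sm c1 c2)
  cx cu (BT_local BT cx cu) v0 p q r y0 fh).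
Qed.

(** The Riemannian condition enters twice: F_2^2 is quadratic along the fibres, and f(x, .) F_2 is
    Riemannian as well, hence Berwald. *)
Lemma riemannian_twisted_berwaldian : berwaldian F1 -> riemannian F2 ->
  cartan_df_vanishes F1 f -> twisted_berwaldian F1 F2 f.
Proof.
move=> B1 rF2 CF c1 c2 [z w] [/= cx cu y0 v0] i p q r.
rewrite -(hsubmxK z) -(hsubmxK w).
set x := lsubmx z in cx *; set u := rsubmx z in cu *.
apply: (twisted_berwald_vanishes (lF1 c1) (lF2 c2) (@lC c1 c2) (@f_pos c1 c2) (@f_sm c1 c2)
  cx cu) => //.
- by move=> y yn0 a b c d; exact: (B1 c1 (x, y)).
- move=> v vn0 a b c; rewrite -third_derivative_fibre.
  have pE := riemannian_sqF_poly (lF2 c2) (rF2 c2).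
  exact: (pE a b c (u, v) (conj cu vn0)).
- move=> y yn0 a b; rewrite (ddir_warp_grad _ (lF1 c1) _ cx _ _ yn0).
  rewrite (_ : \sum_h _ = 0) ?mulr0// -[RHS](CF c1 c2 x u y cx cu yn0 a b).
  by apply: eq_bigr => h _; rewrite d_M1E.
move=> v vn0 a b c d.
have rC : riemannian (warped_fibre cx) by exact: (riemannian_warped_fibre cx).2.
exact: (riemannian_berwald (finsler_local (warped_fibre cx) c2) (rC c2) (z := (u, v))).
Qed.

End TwistedTheorem.

Theorem theorem6 (R : realType) (n1 n2 : nat)
    (M1 : smooth_manifold R n1) (M2 : smooth_manifold R n2)
    (F1 : finsler_metric M1) (F2 : finsler_metric M2)
    (f : M1 * M2 -> R)
    (f_gt0 : forall p, 0 < f p)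
    (f_smooth : smooth_on_product f)
    (f_nonconst : ~ constant_on_M1 f) :
  twisted_berwaldian F1 F2 f <->
  [/\ berwaldian F1, riemannian F2 & cartan_df_vanishes F1 f].
Proof.
split=> [BT|[B1 rF2 CF]]; last exact: riemannian_twisted_berwaldian.
split; last exact: twisted_berwaldian_cartan BT.
- apply: (twisted_berwaldian_base f_gt0 f_smooth) BT.
  (* Over an empty M_2 the function f would be constant on M_1 vacuously. *)
  apply: contrapT => M2e; apply: f_nonconst => c1 c2 x u _ [p _ _] h.
  by exfalso; apply: M2e; exists p.
(* Dimension 0 is excluded by [dim_gt0]; the transport argument covers dimensions from 2 on. *)
- case: n2 M2 F2 f f_gt0 f_smooth f_nonconst BT => [|[|n]] M2' F2' f' f0' fs' fn' BT.
  + by have := dim_gt0 M2'.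
  + exact: riemannian_dim1.
  + exact: (twisted_berwaldian_fibre f0' fs' fn') BT.
Qed.
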